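(* Let $t\in\mathbb{Z}_{\geq 1}$ and let $\mathcal{I}_0=i_{0+}(\mathcal{O}_0)$ and $\mathcal{I}_\infty=i_{\infty+}(\mathcal{O}_\infty)$ be the standard Harish-Chandra sheaves for $\mathcal{D}_t$ attached to the closed $K$-orbits $0$ and $\infty$ in $X=\mathbb{CP}^1$, respectively. Then, as modules over $\mathfrak{g}=\mathfrak{sl}(2,\mathbb{C})$, \[ \Gamma(X,\mathcal{I}_0)\simeq D_+(-t-1)\quad\text{and}\quad \Gamma(X,\mathcal{I}_\infty)\simeq D_-(t+1), \] where $D_+(-t-1)$ is the Harish-Chandra module of the (holomorphic) discrete series representation of $\mathrm{SL}(2,\mathbb{R})$ of highest weight $-t-1$, and $D_-(t+1)$ is the Harish-Chandra module of the (antiholomorphic) discrete series representation of $\mathrm{SL}(2,\mathbb{R})$ of lowest weight $t+1$. Both of these modules are irreducible.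
   Context: Let $\mathfrak{g}=\mathfrak{sl}(2,\mathbb{C})$ with standard basis $E=\begin{pmatrix}0&1\\0&0\end{pmatrix}$, $H=\begin{pmatrix}1&0\\0&-1\end{pmatrix}$, $F=\begin{pmatrix}0&0\\1&0\end{pmatrix}$, $\mathfrak{h}=\mathbb{C}H$, $G=\mathrm{SL}(2,\mathbb{C})$, and let $K\subset G$ be the subgroup of diagonal matrices $\mathrm{diag}(a,a^{-1})$, $a\in\mathbb{C}^\times$. $K$ is the complexification of the maximal compact (diagonal) subgroup of $\mathrm{SU}(1,1)=\{M\in\mathrm{SL}(2,\mathbb{C}): M\,\mathrm{diag}(1,-1)M^*=\mathrm{diag}(1,-1)\}$, which is isomorphic (conjugate in $\mathrm{SL}(2,\mathbb{C})$) to $\mathrm{SL}(2,\mathbb{R})$. Representations of $\mathrm{SL}(2,\mathbb{R})$ are regarded as representations of $\mathrm{SU}(1,1)$ through such an isomorphism, and their Harish-Chandra modules (the $\mathfrak{g}$-modules of $K$-finite vectors) are taken with respect to this $K$; a weight means an eigenvalue of $H$. The highest weight vector of $D_+(-t-1)$ is an $H$-eigenvector of eigenvalue $-t-1$ killed by $E$; the lowest weight vector of $D_-(t+1)$ is an $H$-eigenvector of eigenvalue $t+1$ killed by $F$. Flag variety. $X=\mathbb{CP}^1$ with points $[x_0:x_1]$; $G$ acts by $\begin{pmatrix}a&b\\c&d\end{pmatrix}\cdot[x_0:x_1]=[ax_0+bx_1:cx_0+dx_1]$. Put $0=[1:0]$, $\infty=[0:1]$, $U_0=X\setminus\{\infty\}$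 with coordinate $z=x_1/x_0$, $U_\infty=X\setminus\{0\}$ with coordinate $w=x_0/x_1$, and $V=U_0\cap U_\infty\simeq\mathbb{C}^\times$, on which $w=1/z$. The $K$-orbits on $X$ are $\{0\}$, $\{\infty\}$ and $V$. For $U$ affine open, $D(U)$ is its ring of differential operators. The sheaf $\mathcal{D}_t$. For $t\in\mathbb{Z}$, let $\mathcal{O}(t-1)$ be the line bundle whose sections over $U$ are homogeneous functions of degree $t-1$ on the preimage of $U$ in $\mathbb{C}^2\setminus\{0\}$, trivialized by $f\mapsto f(1,z)$ on $U_0$ and $f\mapsto f(w,1)$ on $U_\infty$ (so a section given by $q(w)$ on $U_\infty$ is given by $z^{t-1}q(1/z)$ on $U_0$). $\mathcal{D}_t$ is the sheaf of differential endomorphisms of $\mathcal{O}(t-1)$. The trivializations identify $\mathcal{D}_t|_{U_0}$ with $\mathcal{D}_{U_0}$ and $\mathcal{D}_t|_{U_\infty}$ with $\mathcal{D}_{U_\infty}$; over $V$ the two identifications differ by the ring automorphism $T\mapsto z^{t-1}Tz^{-(t-1)}$ of $D(V)$ (from the $U_\infty$ to the $U_0$ description). Differentiating the $G$-action $(g\cdot f)(x)=f(g^{-1}x)$ gives an algebra homomorphism $\mathcal{U}(\mathfrak{g})\to\Gamma(X,\mathcal{D}_t)$, under which $E,F,H$ map to the following operators. On $U_0$: $E_0=z^2\partial_z-z(t-1)$, $F_0=-\partial_z$, $H_0=2z\partial_z-(t-1)$. On $U_\infty$: $E_\infty=-\partial_w$, $F_\infty=w^2\partial_w-w(t-1)$,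 $H_\infty=-2w\partial_w+(t-1)$. Through this homomorphism the global sections of any $\mathcal{D}_t$-module form a $\mathfrak{g}$-module. The sheaves. $\mathcal{I}_0=i_{0+}(\mathcal{O}_0)$ and $\mathcal{I}_\infty=i_{\infty+}(\mathcal{O}_\infty)$ are the $\mathcal{D}_t$-module direct images of the structure sheaves of the points $0$ and $\infty$ under the inclusions into $X$. Concretely, $\mathcal{I}_0$ is supported at $0$ with $\mathcal{I}_0(U_0)=D(U_0)/D(U_0)z$ and $\mathcal{I}_0(U_\infty)=0$; $\mathcal{I}_\infty$ is supported at $\infty$ with $\mathcal{I}_\infty(U_\infty)=D(U_\infty)/D(U_\infty)w$ and $\mathcal{I}_\infty(U_0)=0$. *)

(* Defs.v *)
From HB Require Import structures.
From mathcomp Require Import all_boot all_order all_algebra.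
From mathcomp Require Import all_classical all_reals all_analysis.
From mathcomp.real_closed Require Import complex.
From mathcomp Require Import ring.

Set Implicit Arguments.
Unset Strict Implicit.
Unset Printing Implicit Defensive.

Import Order.TTheory GRing.Theory Num.Theory.
Import numFieldNormedType.Exports.

Local Open Scope classical_set_scope.
Local Open Scope ring_scope.
Local Open Scope quotient_scope.

(** [diffop A] is Grothendieck's ring of [k]-linear differential operators on
    the commutative [k]-algebra [A], the product being composition. *)

Section DifferentialOperators.
Variables (k : fieldType) (A : comAlgType k).
Implicit Types (P Q : A -> A) (a f : A) (n : nat).

(** [P] has order [< n] when every [n]-fold iterated commutator
    [[..[[P, a_1], a_2],.., a_n]] with multiplication operators vanishes. *)
Fixpoint order_lt n P : Prop :=
  if n is m.+1 then forall a, order_lt m (fun f => P (a * f) - a * P f)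
  else forall f, P f = 0.

Definition is_diffop P : Prop :=
  (forall (c : k) f g, P (c *: f + g) = c *: P f + P g)
  /\ exists n, order_lt n P.

Record diffop := Diffop { diffop_fun :> A -> A; diffopP : is_diffop diffop_fun }.

HB.instance Definition _ := gen_eqMixin diffop.
HB.instance Definition _ := gen_choiceMixin diffop.

Lemma diffop_ext (P Q : diffop) : (forall f, P f = Q f) -> P = Q.
Proof.
case: P Q => [P hP] [Q hQ] /= /funext eqPQ; case: _ / eqPQ in hQ *.
by congr Diffop; exact: Prop_irrelevance.
Qed.

Lemma order_lt_ext n P Q : P =1 Q -> order_lt n P -> order_lt n Q.
Proof. by move=> /funext ->. Qed.

Lemma order_ltS n P : order_lt n P -> order_lt n.+1 P.
Proof.
elim: n P => [|n IHn] P hP a; last exact: IHn.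
by move=> f; rewrite !hP mulr0 subrr.
Qed.

Lemma order_lt_le m n P : (m <= n)%N -> order_lt m P -> order_lt n P.
Proof.
by move=> /subnK <-; elim: (n - m)%N => //= d IHd /IHd; exact: order_ltS.
Qed.

Lemma order_lt0 n P : P =1 (fun=> 0) -> order_lt n P.
Proof. by move=> P0; apply: (@order_lt_le 0). Qed.

Lemma order_ltD n P Q : order_lt n P -> order_lt n Q ->
  order_lt n (fun f => P f + Q f).
Proof.
elim: n P Q => [|n IHn] P Q hP hQ /=; first by move=> f; rewrite hP hQ addr0.
move=> a; apply: order_lt_ext (IHn _ _ (hP a) (hQ a)) => f /=.
by rewrite mulrDr opprD addrACA.
Qed.

Lemma order_ltN n P : order_lt n P -> order_lt n (fun f => - P f).
Proof.
elim: n P => [|n IHn] P hP /=; first by move=> f; rewrite hP oppr0.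
move=> a; apply: order_lt_ext (IHn _ (hP a)) => f /=.
by rewrite mulrN opprB opprK addrC.
Qed.

Lemma order_lt_comp m n P Q : {morph P : f g / f + g} ->
  order_lt m P -> order_lt n Q -> order_lt (m + n) (P \o Q).
Proof.
move: {2}(m + n)%N (leqnn (m + n)) => N; elim: N m n P Q => [|N IHN] m n P Q.
  rewrite leqn0 addn_eq0 => /andP[/eqP-> /eqP->] PD /= hP _ f.
  exact: hP.
have Psub R : {morph R : f g / f + g :> A} -> R 0 = 0 /\ {morph R : f / - f}.
  move=> RD; have R0 : R 0 = 0 by apply: (addrI (R 0)); rewrite -RD !addr0.
  by split=> // f; apply: (addrI (R f)); rewrite -RD !subrr.
case: m n => [|m] n lemn PD hP hQ.
  by apply: order_lt0 => f /=; rewrite hP.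
case: n => [|n] in lemn hQ *.
  by apply: order_lt0 => f /=; rewrite hQ (Psub _ PD).1.
rewrite addnS /= => a.
have PaD : {morph (fun f => P (a * f) - a * P f) : f g / f + g}.
  by move=> f g; rewrite mulrDr !PD mulrDr opprD addrACA.
have h1 : order_lt (m + n.+1) ((fun f => P (a * f) - a * P f) \o Q).
  by apply: IHN => //; rewrite -ltnS -addSn.
have h2 : order_lt (m.+1 + n) (P \o (fun f => Q (a * f) - a * Q f)).
  by apply: IHN => //; rewrite -ltnS -addnS.
rewrite addnS -addSn in h1.
apply: order_lt_ext (order_ltD h1 h2) => f /=.
by rewrite PD (Psub _ PD).2 addrC addrA subrK.
Qed.

Lemma diffopZD (P : diffop) (c : k) f g : P (c *: f + g) = c *: P f + P g.
Proof. by case: (diffopP P). Qed.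

Lemma diffopD (P : diffop) : {morph P : f g / f + g}.
Proof. by move=> f g; have := diffopZD P 1 f g; rewrite !scale1r. Qed.

Lemma diffop_zero_subproof : is_diffop (fun=> 0).
Proof. by split; [move=> c f g; rewrite scaler0 addr0 | exists 0%N]. Qed.

Lemma diffop_add_subproof (P Q : diffop) : is_diffop (fun f => P f + Q f).
Proof.
split=> [c f g|]; first by rewrite !diffopZD scalerDr addrACA.
have [[_ [m hP]] [_ [n hQ]]] := (diffopP P, diffopP Q).
exists (maxn m n); apply: order_ltD.
  exact: order_lt_le (leq_maxl m n) hP.
exact: order_lt_le (leq_maxr m n) hQ.
Qed.

Lemma diffop_opp_subproof (P : diffop) : is_diffop (fun f => - P f).
Proof.
split=> [c f g|]; first by rewrite diffopZD opprD scalerN.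
by have [_ [n hP]] := diffopP P; exists n; exact: order_ltN.
Qed.

Lemma diffop_comp_subproof (P Q : diffop) : is_diffop (P \o Q).
Proof.
split=> [c f g|] /=; first by rewrite !diffopZD.
have [[_ [m hP]] [_ [n hQ]]] := (diffopP P, diffopP Q).
by exists (m + n)%N; apply: order_lt_comp => //; exact: diffopD.
Qed.

Lemma mulop_subproof a : is_diffop ( *%R a).
Proof.
split=> [c f g|]; first by rewrite mulrDr scalerAr.
by exists 1%N => b f /=; rewrite mulrCA subrr.
Qed.

Definition mulop a : diffop := Diffop (mulop_subproof a).

Let zero := Diffop diffop_zero_subproof.
Let add (P Q : diffop) := Diffop (diffop_add_subproof P Q).
Let opp (P : diffop) := Diffop (diffop_opp_subproof P).
Let comp (P Q : diffop) := Diffop (diffop_comp_subproof P Q).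

Let addA : associative add.
Proof. by move=> P Q R; apply: diffop_ext => f /=; rewrite addrA. Qed.
Let addC : commutative add.
Proof. by move=> P Q; apply: diffop_ext => f /=; rewrite addrC. Qed.
Let add0 : left_id zero add.
Proof. by move=> P; apply: diffop_ext => f /=; rewrite add0r. Qed.
Let addN : left_inverse zero opp add.
Proof. by move=> P; apply: diffop_ext => f /=; rewrite addNr. Qed.

HB.instance Definition _ := GRing.isZmodule.Build diffop addA addC add0 addN.

Let compA : associative comp.
Proof. by move=> P Q R; apply: diffop_ext. Qed.
Let comp1l : left_id (mulop 1) comp.
Proof. by move=> P; apply: diffop_ext => f /=; rewrite mul1r. Qed.
Let comp1r : right_id (mulop 1) comp.
Proof. by move=> P; apply: diffop_ext => f /=; rewrite mul1r. Qed.
Let compDl : left_distributive comp +%R.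
Proof. by move=> P Q R; apply: diffop_ext. Qed.
Let compDr : right_distributive comp +%R.
Proof. by move=> P Q R; apply: diffop_ext => f /=; rewrite diffopD. Qed.
Let one_neq0 : mulop 1 != 0.
Proof.
apply/eqP => /(congr1 (fun P : diffop => P 1)) /=.
by rewrite mulr1 => /eqP; rewrite oner_eq0.
Qed.

HB.instance Definition _ :=
  GRing.Zmodule_isNzRing.Build diffop compA comp1l comp1r compDl compDr one_neq0.

Lemma diffop_addE (P Q : diffop) f : (P + Q) f = P f + Q f.
Proof. by []. Qed.
Lemma diffop_oppE (P : diffop) f : (- P) f = - P f.
Proof. by []. Qed.
Lemma diffop_mulE (P Q : diffop) f : (P * Q) f = P (Q f).
Proof. by []. Qed.

End DifferentialOperators.

Section DerivativeOperator.
Variable k : fieldType.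

Lemma derivop_subproof : is_diffop (k := k) (A := {poly k}) (@deriv k).
Proof.
split=> [c f g|]; first by rewrite derivD derivZ.
exists 2%N => a b f /=; rewrite !derivM !mulrDr !mulrA.
by ring.
Qed.

Definition derivop : diffop {poly k} := Diffop derivop_subproof.

End DerivativeOperator.

(** [laurent k] is [k[z, z^-1]], as a subring of [k(z)]. *)

Section Laurent.
Variable k : fieldType.
Local Notation K := {fraction {poly k}}.

Definition laurent_pred : {pred K} :=
  fun f => `[< exists n (p : {poly k}), f * (tofrac 'X) ^+ n = tofrac p >].

Lemma laurent_predP f : reflect
  (exists n (p : {poly k}), f * (tofrac 'X) ^+ n = tofrac p) (f \in laurent_pred).
Proof. exact: asboolP. Qed.

Lemma laurent_subring_closed : subring_closed laurent_pred.
Proof.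
split=> [|f g|f g]; first by apply/laurent_predP; exists 0%N, 1; rewrite mulr1 rmorph1.
- move=> /laurent_predP[m [p hp]] /laurent_predP[n [q hq]].
  apply/laurent_predP; exists (m + n)%N, (p * 'X^n - q * 'X^m).
  rewrite exprD mulrBl mulrA hp [X in g * X]mulrC mulrA hq.
  by rewrite rmorphB !rmorphM !rmorphXn.
- move=> /laurent_predP[m [p hp]] /laurent_predP[n [q hq]].
  apply/laurent_predP; exists (m + n)%N, (p * q).
  by rewrite exprD mulrACA hp hq rmorphM.
Qed.

HB.instance Definition _ :=
  GRing.isSubringClosed.Build K laurent_pred laurent_subring_closed.

Record laurent := Laurent { laurent_val :> K; _ : laurent_val \in laurent_pred }.

HB.instance Definition _ := [isSub for laurent_val].
HB.instance Definition _ := [Choice of laurent by <:].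
HB.instance Definition _ := [SubChoice_isSubComNzRing of laurent by <:].

Lemma tofrac_laurent (p : {poly k}) : tofrac p \in laurent_pred.
Proof. by apply/laurent_predP; exists 0%N, p; rewrite mulr1. Qed.

Definition laurent_of_poly (p : {poly k}) : laurent := Laurent (tofrac_laurent p).

Lemma laurent_of_poly_is_zmod_morphism : zmod_morphism laurent_of_poly.
Proof. by move=> p q; apply: val_inj; rewrite /= rmorphB. Qed.
Lemma laurent_of_poly_is_monoid_morphism : monoid_morphism laurent_of_poly.
Proof. by split=> [|p q]; apply: val_inj; rewrite /= ?rmorph1 ?rmorphM. Qed.
HB.instance Definition _ := GRing.isZmodMorphism.Build {poly k} laurent
  laurent_of_poly laurent_of_poly_is_zmod_morphism.
HB.instance Definition _ := GRing.isMonoidMorphism.Build {poly k} laurent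
  laurent_of_poly laurent_of_poly_is_monoid_morphism.

Let scale (c : k) (f : laurent) : laurent := laurent_of_poly c%:P * f.
Let scaleA a b f : scale a (scale b f) = scale (a * b) f.
Proof. by rewrite /scale mulrA polyCM rmorphM. Qed.
Let scale1 : left_id 1 scale.
Proof. by move=> f; rewrite /scale rmorph1 mul1r. Qed.
Let scaleDr : right_distributive scale +%R.
Proof. by move=> c f g; rewrite /scale mulrDr. Qed.
Let scaleDl f : {morph scale^~ f : a b / a + b}.
Proof. by move=> a b; rewrite /scale polyCD rmorphD mulrDl. Qed.
HB.instance Definition _ :=
  GRing.Zmodule_isLmodule.Build k laurent scaleA scale1 scaleDr scaleDl.

Let scaleAl (c : k) (f g : laurent) : c *: (f * g) = (c *: f) * g.
Proof. exact: mulrA. Qed.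
HB.instance Definition _ := GRing.Lmodule_isLalgebra.Build k laurent scaleAl.
HB.instance Definition _ := GRing.Lalgebra_isComAlgebra.Build k laurent.

Lemma zpow_subproof (n : int) : (tofrac 'X : K) ^ n \in laurent_pred.
Proof.
case: n => n; first by rewrite -exprnP -rmorphXn tofrac_laurent.
apply/laurent_predP; exists n.+1, 1; rewrite NegzE -exprnN mulVf ?rmorph1 //.
by rewrite expf_neq0 // tofrac_eq0 polyX_eq0.
Qed.

(** [zpow n] is the function [z ^ n], and [poly_at_z], [poly_at_zinv] are the
    restriction maps [p(z) |-> p(z)] and [p(w) |-> p(1/z)]. *)
Definition zpow (n : int) : laurent := Laurent (zpow_subproof n).
Definition poly_at_z : {poly k} -> laurent := horner_alg (zpow 1).
Definition poly_at_zinv : {poly k} -> laurent := horner_alg (zpow (-1)).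

End Laurent.

(** [cyclic_module a] is the left [D]-module [D / D a]. *)

Section CyclicModule.
Variables (D : nzRingType) (a : D).

Definition lideal : {pred D} := fun P => `[< exists Q, P = Q * a >].

Lemma lidealP P : reflect (exists Q, P = Q * a) (P \in lideal).
Proof. exact: asboolP. Qed.

Lemma lideal_zmod_closed : zmod_closed lideal.
Proof.
split=> [|P Q]; first by apply/lidealP; exists 0; rewrite mul0r.
by move=> /lidealP[P' ->] /lidealP[Q' ->]; apply/lidealP; exists (P' - Q'); rewrite mulrBl.
Qed.
HB.instance Definition _ := GRing.isZmodClosed.Build D lideal lideal_zmod_closed.

Definition cyclic_module := Quotient.quot lideal.
HB.instance Definition _ := GRing.Zmodule.on cyclic_module.

Definition cyclic_class (P : D) : cyclic_module := \pi_(cyclic_module) P.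

Lemma cyclic_class_eq P Q : (cyclic_class P = cyclic_class Q) <-> P - Q \in lideal.
Proof. by rewrite Quotient.idealrBE; split=> [/eqP|/eqP]. Qed.

Lemma cyclic_class_repr (m : cyclic_module) : cyclic_class (repr m) = m.
Proof. exact: reprK. Qed.

Lemma cyclic_classB P Q : cyclic_class (P - Q) = cyclic_class P - cyclic_class Q.
Proof. by rewrite /cyclic_class !piE. Qed.

Lemma cyclic_classD P Q : cyclic_class (P + Q) = cyclic_class P + cyclic_class Q.
Proof. by rewrite /cyclic_class !piE. Qed.

Definition cyclic_scale (P : D) (m : cyclic_module) := cyclic_class (P * repr m).

Lemma cyclic_scaleE P Q : cyclic_scale P (cyclic_class Q) = cyclic_class (P * Q).
Proof.
apply/cyclic_class_eq; rewrite -mulrBr.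
have /lidealP[S ->] : repr (cyclic_class Q) - Q \in lideal.
  by apply/cyclic_class_eq; exact: cyclic_class_repr.
by apply/lidealP; exists (P * S); rewrite mulrA.
Qed.

Let scaleA P Q m : cyclic_scale P (cyclic_scale Q m) = cyclic_scale (P * Q) m.
Proof. by rewrite -[m]cyclic_class_repr !cyclic_scaleE mulrA. Qed.
Let scale1 : left_id 1 cyclic_scale.
Proof. by move=> m; rewrite /cyclic_scale mul1r cyclic_class_repr. Qed.
Let scaleDr : right_distributive cyclic_scale +%R.
Proof.
move=> P m n; rewrite -[m]cyclic_class_repr -[n]cyclic_class_repr.
by rewrite -cyclic_classD !cyclic_scaleE mulrDr cyclic_classD.
Qed.
Let scaleDl m : {morph cyclic_scale^~ m : P Q / P + Q}.
Proof. by move=> P Q; rewrite /cyclic_scale mulrDl cyclic_classD. Qed.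
HB.instance Definition _ :=
  GRing.Zmodule_isLmodule.Build D cyclic_module scaleA scale1 scaleDr scaleDl.

End CyclicModule.

Section TwistedDModules.
Variable k : fieldType.

(** A quasi-coherent D_t-module, given by its sections over [U_0] (coordinate
    [z]), [U_oo] (coordinate [w]) and [V = U_0 /\ U_oo] (where [w = 1/z]).
    D_t is the sheaf of differential endomorphisms of O(t-1), and O(t-1) is
    trivialized by [f |-> f(1, z)] on [U_0] and [f |-> f(w, 1)] on [U_oo].  D_t
    over [V] is described through the former, whence the conjugation by
    [z ^ (t - 1)] in [resoo_semilinear].  In the two semilinearity axioms, [Q]
    is the restriction to [V] of the differential operator [P].  The last four
    axioms say that [secV] is the localization of [sec0] at [z] and of [secoo]
    at [w]. *)
Record Dt_module (t : int) := DtModule {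
  sec0 : lmodType (diffop {poly k});
  secoo : lmodType (diffop {poly k});
  secV : lmodType (diffop (laurent k));
  res0 : {additive sec0 -> secV};
  resoo : {additive secoo -> secV};
  res0_semilinear : forall (P : diffop {poly k}) (Q : diffop (laurent k)),
    (forall p, Q (poly_at_z p) = poly_at_z (P p)) ->
    forall m, res0 (P *: m) = Q *: res0 m;
  resoo_semilinear : forall (P : diffop {poly k}) (Q : diffop (laurent k)),
    (forall p, Q (poly_at_zinv p) = poly_at_zinv (P p)) ->
    forall m, resoo (P *: m) =
      (mulop (zpow k (t - 1)) * Q * mulop (zpow k (- (t - 1)))) *: resoo m;
  res0_torsion : forall m, res0 m = 0 ->
    exists n, mulop ('X^n : {poly k}) *: m = 0;
  resoo_torsion : forall m, resoo m = 0 ->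
    exists n, mulop ('X^n : {poly k}) *: m = 0;
  res0_denom : forall v, exists n m, mulop (zpow k n%:Z) *: v = res0 m;
  resoo_denom : forall v, exists n m, mulop (zpow k (- n%:Z)) *: v = resoo m
}.

Definition chart_sections t (M : Dt_module t) : Type := (sec0 M * secoo M)%type.

Section ChartSections.
Variables (t : int) (M : Dt_module t).
HB.instance Definition _ := GRing.Zmodule.on (chart_sections M).

Definition chart_act (P Q : diffop {poly k}) (m : chart_sections M) :
  chart_sections M := (P *: m.1, Q *: m.2).

Let scale (c : k) := chart_act (mulop c%:P) (mulop c%:P).
Let mulopCM (a b : k) :
  mulop (a * b)%:P = mulop a%:P * mulop b%:P :> diffop {poly k}.
Proof. by apply: diffop_ext => f /=; rewrite polyCM mulrA. Qed.
Let mulopCD (a b : k) :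
  mulop (a + b)%:P = mulop a%:P + mulop b%:P :> diffop {poly k}.
Proof. by apply: diffop_ext => f /=; rewrite polyCD mulrDl. Qed.
Let scaleA a b m : scale a (scale b m) = scale (a * b) m.
Proof. by rewrite /scale /chart_act /= mulopCM !scalerA. Qed.
Let scale1 : left_id 1 scale.
Proof. by case=> m n; rewrite /scale /chart_act /= !scale1r. Qed.
Let scaleDr : right_distributive scale +%R.
Proof. by move=> c m n; rewrite /scale /chart_act /= !scalerDr. Qed.
Let scaleDl m : {morph scale^~ m : a b / a + b}.
Proof. by move=> a b; rewrite /scale /chart_act /= mulopCD !scalerDl. Qed.
HB.instance Definition _ := GRing.Zmodule_isLmodule.Build k (chart_sections M)
  scaleA scale1 scaleDr scaleDl.

End ChartSections.

(** The images of [E], [F], [H] in the global sections of D_t, on each chart,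
    for the action [(g f)(x) = f(g^-1 x)] on sections of O(t-1). *)
Section VectorFields.
Variable t : int.
Local Notation d := (derivop k).
Local Notation "'x" := ('X : {poly k}).

Definition E0 := mulop ('x ^+ 2) * d - mulop ((t - 1)%:~R * 'x).
Definition F0 := - d.
Definition H0 := mulop (2%:R * 'x) * d - mulop (t - 1)%:~R.
Definition Eoo := - d.
Definition Foo := mulop ('x ^+ 2) * d - mulop ((t - 1)%:~R * 'x).
Definition Hoo := - (mulop (2%:R * 'x) * d) + mulop (t - 1)%:~R.

(** A matrix in sl(2) is [X 0 0 *: H + X 0 1 *: E + X 1 0 *: F]. *)
Definition sl2_comb (H E F : diffop {poly k}) (X : 'M[k]_2) :=
  mulop (X 0 0)%:P * H + mulop (X 0 1)%:P * E + mulop (X 1 0)%:P * F.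
Definition sl2_op0 := sl2_comb H0 E0 F0.
Definition sl2_opoo := sl2_comb Hoo Eoo Foo.

End VectorFields.

Lemma zero_row_eq0 (D : nzRingType) (v : 'rV[D]_0) : v = 0.
Proof. by rewrite thinmx0. Qed.

Lemma delta_torsion (A : comAlgType k) (z : A)
  (m : cyclic_module (mulop z : diffop A)) : exists n, mulop (z ^+ n) *: m = 0.
Proof.
suff tors n (P : diffop A) : order_lt n P ->
    exists N, mulop (z ^+ N) * P \in lideal (mulop z).
  rewrite -[m]cyclic_class_repr; have [_ [n /tors[N hN]]] := diffopP (repr m).
  exists N; have -> : mulop (z ^+ N) *: cyclic_class (mulop z) (repr m) =
      cyclic_class (mulop z) (mulop (z ^+ N) * repr m).
    exact: cyclic_scaleE.
  rewrite -[RHS](_ : cyclic_class (mulop z) 0 = 0); first by apply/cyclic_class_eq; rewrite subr0.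
  by rewrite -(subrr 0) cyclic_classB subrr.
elim: n P => [|n IHn] P hP.
  exists 0%N; have -> : P = 0 by apply: diffop_ext => f; rewrite hP.
  by rewrite mulr0 rpred0.
have [|N /lidealP[Q hQ]] := IHn (P * mulop z - mulop z * P); first exact: hP.
exists N.+1; apply/lidealP; exists (mulop (z ^+ N) * P - Q).
have expS : mulop (z ^+ N.+1) = mulop (z ^+ N) * mulop z :> diffop A.
  by apply: diffop_ext => f /=; rewrite exprSr mulrA.
by rewrite mulrBl -hQ mulrBr !mulrA expS opprB addrC subrK.
Qed.

Section StandardSheaves.
Variable t : int.
Local Notation D := (diffop {poly k}).
Local Notation DV := (diffop (laurent k)).
Local Notation delta := (cyclic_module (mulop 'X : D)).

(** [I_0], supported at [z = 0]: its sections are [D(U_0) / D(U_0) z] over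
    [U_0], and [0] over [U_oo] and [V]. *)
Definition sheaf_I0 : Dt_module t.
Proof.
refine (@DtModule t delta 'rV[D]_0 'rV[DV]_0 \0 \0 _ _ _ _ _ _).
- by move=> *; rewrite scaler0.
- by move=> *; rewrite scaler0.
- by move=> m _; exact: delta_torsion.
- by move=> m _; exists 0%N; rewrite [LHS]zero_row_eq0.
- by move=> v; exists 0%N, 0; rewrite [LHS]zero_row_eq0 [RHS]zero_row_eq0.
- by move=> v; exists 0%N, 0; rewrite [LHS]zero_row_eq0 [RHS]zero_row_eq0.
Defined.

(** [I_oo], supported at [w = 0]. *)
Definition sheaf_Ioo : Dt_module t.
Proof.
refine (@DtModule t 'rV[D]_0 delta 'rV[DV]_0 \0 \0 _ _ _ _ _ _).
- by move=> *; rewrite scaler0.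
- by move=> *; rewrite scaler0.
- by move=> m _; exists 0%N; rewrite [LHS]zero_row_eq0.
- by move=> m _; exact: delta_torsion.
- by move=> v; exists 0%N, 0; rewrite [LHS]zero_row_eq0 [RHS]zero_row_eq0.
- by move=> v; exists 0%N, 0; rewrite [LHS]zero_row_eq0 [RHS]zero_row_eq0.
Defined.

End StandardSheaves.
End TwistedDModules.

(** Harish-Chandra modules are subspaces of function spaces on which the Lie
    algebra acts by a limit, so a module is presented by an ambient vector
    space, the subset of its elements, and the graph of the action. *)

Section Sl2Modules.
Variable C : fieldType.
Implicit Types X Y : 'M[C]_2.

Definition in_sl2 X : Prop := \tr X = 0.

Record sl2_data := Sl2Data {
  ambient : lmodType C;
  carrier : set ambient;
  act_rel : 'M[C]_2 -> ambient -> ambient -> Prop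
}.

Arguments carrier : clear implicits.
Arguments act_rel : clear implicits.

(** [act_rel M X v u] reads [X . v = u]. *)
Record is_sl2_module (M : sl2_data) : Prop := IsSl2Module {
  carrier0 : carrier M 0;
  carrier_lin : forall (c : C) u v,
    carrier M u -> carrier M v -> carrier M (c *: u + v);
  act_total : forall X v, in_sl2 X -> carrier M v ->
    exists! u, carrier M u /\ act_rel M X v u;
  act_linear : forall X (c : C) v v' u u', in_sl2 X ->
    carrier M v -> carrier M v' -> carrier M u -> carrier M u' ->
    act_rel M X v u -> act_rel M X v' u' ->
    act_rel M X (c *: v + v') (c *: u + u');
  act_linear_sl2 : forall X Y (c : C) v u u', in_sl2 X -> in_sl2 Y ->
    carrier M v -> carrier M u -> carrier M u' ->
    act_rel M X v u -> act_rel M Y v u' ->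
    act_rel M (c *: X + Y) v (c *: u + u');
  act_bracket : forall X Y v vX vY vXY vYX, in_sl2 X -> in_sl2 Y ->
    carrier M v -> carrier M vX -> carrier M vY ->
    carrier M vXY -> carrier M vYX ->
    act_rel M X v vX -> act_rel M Y v vY ->
    act_rel M X vY vXY -> act_rel M Y vX vYX ->
    act_rel M (X *m Y - Y *m X) v (vXY - vYX)
}.

Definition sl2_isomorphic (M N : sl2_data) : Prop :=
  is_sl2_module M /\ is_sl2_module N /\
  exists phi : ambient M -> ambient N,
  [/\ set_bij (carrier M) (carrier N) phi,
      forall (c : C) u v, carrier M u -> carrier M v ->
        phi (c *: u + v) = c *: phi u + phi v &
      forall X u v, in_sl2 X -> carrier M u -> carrier M v ->
        act_rel M X u v <-> act_rel N X (phi u) (phi v)].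

Definition sl2_irreducible (M : sl2_data) : Prop :=
  is_sl2_module M /\ (exists2 v, carrier M v & v <> 0) /\
  forall W : set (ambient M),
    W `<=` carrier M -> W 0 ->
    (forall (c : C) u v, W u -> W v -> W (c *: u + v)) ->
    (forall X u v, in_sl2 X -> W u -> carrier M v -> act_rel M X u v -> W v) ->
    W = [set 0] \/ W = carrier M.

Definition global_sections (t : int) (M : Dt_module C t) : sl2_data :=
  @Sl2Data (chart_sections M)
    [set m | res0 M m.1 = resoo M m.2]
    (fun X m u => u = chart_act (sl2_op0 t X) (sl2_opoo t X) m).

End Sl2Modules.

Section SU11.
Variable R : realType.
Local Notation C := R[i].
Implicit Types (g X : 'M[C]_2) (z : C).

Definition J11 : 'M[C]_2 := \matrix_(i, j) ((i == j)%:R * (-1) ^+ i).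
Definition adjoint g : 'M[C]_2 := (map_mx conjc g)^T.

Definition SU11 : set 'M[C]_2 :=
  [set g | g *m J11 *m adjoint g = J11 /\ \det g = 1].

Definition su11 : set 'M[C]_2 :=
  [set X | X *m J11 + J11 *m adjoint X = 0 /\ \tr X = 0].
Definition K11 : set 'M[C]_2 := [set g | SU11 g /\ is_diag_mx g].

Definition expmx X : 'M[C]_2 :=
  \matrix_(i, j) limn (series (fun m => (m`!%:R^-1 *: X ^+ m) i j : C^o)).

(** A representation of SU(1,1) on a Hilbert space of functions on the unit disc;
    a function on the disc is represented by its extension by [0] to [C]. *)
Record disc_rep := DiscRep {
  vectors : set (C -> C);
  sqnorm : (C -> C) -> \bar R;
  gaction : 'M[C]_2 -> (C -> C) -> (C -> C)
}.

(** [d/ds exp(s X) v] at [s = 0] exists in norm and equals [u]. *)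
Definition dact (pi : disc_rep) X (v u : C -> C) : Prop :=
  vectors pi u /\
  (sqnorm pi ((s^-1)%:C%C *: (gaction pi (expmx (s%:C%C *: X)) v - v) - u)
     @[s --> (0 : R)^']) --> (0 : R)%:E.

(** The complexified action, sl(2, C) being [su(1,1) + i su(1,1)]. *)
Definition dactC (pi : disc_rep) X (v u : C -> C) : Prop :=
  exists X1 X2 u1 u2, [/\ su11 X1, su11 X2, X = X1 + 'i%C *: X2,
    dact pi X1 v u1 /\ dact pi X2 v u2 & u = u1 + 'i%C *: u2].

Definition K_finite (pi : disc_rep) (v : C -> C) : Prop :=
  exists n (e : 'I_n -> C -> C), forall g, K11 g ->
    exists c : 'I_n -> C, gaction pi g v = \sum_i c i *: e i.

Definition harish_chandra (pi : disc_rep) : sl2_data C :=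
  @Sl2Data C (C -> C)
    [set v | vectors pi v /\ K_finite pi v]
    (dactC pi).

Definition holomorphic_on_disc (f : C -> C) : Prop :=
  forall z, `|z| < 1 -> derivable (f : C^o -> C^o) z 1.

(** The square norm of weight [n]: the integral over the disc of
    [|f(x + i y)| ^ 2 (1 - x ^ 2 - y ^ 2) ^ (n - 2) dx dy]. *)
Definition bergman_sqnorm (n : int) (f : C -> C) : \bar R :=
  (\int[lebesgue_measure \x lebesgue_measure]_(p in
      [set p : R * R | (p.1 ^+ 2 + p.2 ^+ 2 < 1)%R])
    (((Normc.normc (f (Complex p.1 p.2))) ^+ 2 *
      (1 - p.1 ^+ 2 - p.2 ^+ 2) ^ (n - 2))%R)%:E)%E.

Definition bergman (n : int) (hol : set (C -> C)) : set (C -> C) :=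
  [set f | [/\ hol f, forall z, ~~ (`|z| < 1) -> f z = 0
             & (bergman_sqnorm n f < +oo)%E]].

Definition cocycle (m : int) g z : C := (g 1 0 * z + g 1 1) ^ m.
Definition moebius g z : C := (g 0 0 * z + g 0 1) / (g 1 0 * z + g 1 1).

(** [D_+(m)], of highest weight [m <= -2]: holomorphic functions on the disc,
    with [(g f)(z) = (c z + d) ^ m f(g^-1 z)], where [(c, d)] is the second row
    of [g^-1].  The constant functions are killed by [E] and have weight [m]. *)
Definition D_plus (m : int) : disc_rep := {|
  vectors := bergman (- m) holomorphic_on_disc;
  sqnorm := bergman_sqnorm (- m);
  gaction := fun g f z => if `|z| < 1
    then cocycle m (invmx g) z * f (moebius (invmx g) z) else 0
|}.

(** [D_-(m)], of lowest weight [m >= 2]: antiholomorphic functions on the disc,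
    with the complex conjugate cocycle.  The constant functions are killed by
    [F] and have weight [m]. *)
Definition D_minus (m : int) : disc_rep := {|
  vectors := bergman m [set f | holomorphic_on_disc (fun z => (f z)^*%C)];
  sqnorm := bergman_sqnorm m;
  gaction := fun g f z => if `|z| < 1
    then (cocycle (- m) (invmx g) z)^*%C * f (moebius (invmx g) z) else 0
|}.

End SU11.

(* Main.v *)
(** A weight basis identifies every module involved with [{poly C}], on which a
    matrix of sl(2) acts by the first order operator [weight_op].  For the
    delta functions at [0] the basis is made of rescaled derivatives of delta.
    For the discrete series it is made of the monomials on the disc: near
    [s = 0] the group element [exp (s X)] acts on a polynomial by an expression
    with a first order expansion in [s], uniform on the disc, which gives the
    derivative in norm.  A [K]-finite holomorphic function is a polynomial: its
    rotations span a finite dimensional space, hence it is a component of a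
    holomorphic solution of an Euler system [z phi' = A phi], and periodicity
    along circles forces such solutions to be polynomials.  Antiholomorphic
    functions follow by conjugation, which exchanges the roles of [E] and [F]. *)
From HB Require Import structures.
Require Import Defs.
From mathcomp Require Import all_boot all_order all_algebra.
From mathcomp Require Import all_classical all_reals all_analysis.
From mathcomp.real_closed Require Import complex.
From mathcomp Require Import ring.

Set Implicit Arguments.
Unset Strict Implicit.
Unset Printing Implicit Defensive.

Import Order.TTheory GRing.Theory Num.Theory.
Import numFieldNormedType.Exports.

Local Open Scope classical_set_scope.
Local Open Scope ring_scope.

(** The hypothesis [1 <= t] enters through [t + 1 = k.+2]. The scalars [mu + n], with [mu = t + 1],
    then never vanish, so the rescaling of the derivatives of delta is invertible and [F] climbs
    from the constants to every monomial. Moreover the Bergman weight has exponent [k >= 0], so it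
    is at most 1 and bounded functions have finite norm.

    The action on a discrete series is a relation defined by a limit in norm, so computing it takes
    two estimates: an upper bound showing that the expected derivative is a limit, and a lower
    bound, local around a point, showing that nothing else is.

    The functions [e i] in [K_finite] are arbitrary and their coefficients depend on the rotation in
    an uncontrolled way, so they cannot be differentiated. A nonzero minor of maximal size of the
    values [f (a_i z_j)] replaces them by values of [f] itself, which can. The resulting Euler
    system is then integrated along circles and radii: suitable products are constant because their
    derivative along a real curve vanishes. Pointwise complex differentiability is all that this
    uses. *)

(** * Modules modelled on polynomials, and the operator of weight [mu] *)

Section PolynomialModels.
Variable C : fieldType.
Implicit Types (X Y : 'M[C]_2) (p q : {poly C}).

(** The last clause quantifies over every [u] of the ambient space, so it contains both existence
    and uniqueness of the value of the action; module axioms, isomorphisms and irreducibility then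
    reduce to identities for [op]. *)
Definition sl2_model (op : 'M[C]_2 -> {poly C} -> {poly C}) (M : sl2_data C)
    (psi : {poly C} -> ambient M) : Prop :=
  [/\ forall c p q, psi (c *: p + q) = c *: psi p + psi q,
      injective psi,
      @carrier C M = range psi &
      forall X p u, in_sl2 X -> @act_rel C M X (psi p) u <-> u = psi (op X p)].

Definition sl2_op_axioms (op : 'M[C]_2 -> {poly C} -> {poly C}) : Prop :=
  [/\ forall X c p q, op X (c *: p + q) = c *: op X p + op X q,
      forall X Y c p, op (c *: X + Y) p = c *: op X p + op Y p &
      forall X Y p, op (X *m Y - Y *m X) p = op X (op Y p) - op Y (op X p)].

Lemma sl2_model_module op M psi : sl2_op_axioms op -> @sl2_model op M psi ->
  is_sl2_module M.
Proof.
case=> opP opX opB [psiL psi_inj carM actM].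
have psi0 : psi 0 = 0.
  by have := psiL (-1) 0 0; rewrite scaler0 addr0 scaleN1r addNr.
have psiB p q : psi (p - q) = psi p - psi q.
  by have := psiL (-1) q p; rewrite !scaleN1r [- q + p]addrC [- psi q + _]addrC.
split.
- by rewrite carM; exists 0.
- by rewrite carM => c _ _ [p _ <-] [q _ <-]; exists (c *: p + q).
- move=> X v sX; rewrite carM => -[p _ <-]; exists (psi (op X p)); split.
    by split; [exists (op X p) | exact/actM].
  by move=> u [_ /actM ->].
- move=> X c v v' u u' sX; rewrite carM => -[p _ <-] [q _ <-] _ _.
  by move=> /(actM _ _ _ sX) -> /(actM _ _ _ sX) ->; rewrite -psiL; apply/actM => //; rewrite opP.
- move=> X Y c v u u' sX sY; rewrite carM => -[p _ <-] _ _.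
  move=> /(actM _ _ _ sX) -> /(actM _ _ _ sY) ->; rewrite -psiL; apply/actM => //; last by rewrite opX.
  by rewrite /in_sl2 linearP /= sX sY mulr0 addr0.
- move=> X Y v vX vY vXY vYX sX sY; rewrite carM => -[p _ <-] _ _ _ _.
  move=> /(actM _ _ _ sX) -> /(actM _ _ _ sY) -> /(actM _ _ _ sX) -> /(actM _ _ _ sY) ->.
  rewrite -psiB; apply/actM; last by rewrite opB.
  by rewrite /in_sl2 raddfB /= mxtrace_mulC subrr.
Qed.

Lemma sl2_model_isomorphic op M N psi psi' : sl2_op_axioms op ->
  @sl2_model op M psi -> @sl2_model op N psi' -> sl2_isomorphic M N.
Proof.
move=> opA hM hN; split; first exact: sl2_model_module hM.
split; first exact: sl2_model_module hN.
case: hM hN => psiL psi_inj carM actM [psi'L psi'_inj carN actN].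
(* Off the range of [psi] the left inverse takes the default value 0; only its values on the carrier
   matter. *)
have [g psiK] : exists g, cancel psi g.
  have /boolp.choice[g hg] u : exists p, forall q, psi q = u -> p = q.
    have [[p <-]|np] := pselect (exists p, psi p = u); first by exists p => q /psi_inj ->.
    by exists 0 => q pq; case: np; exists q.
  by exists g => p; apply: hg.
exists (psi' \o g); split.
- split.
  + by rewrite carM carN => _ [p _ <-] /=; exists p; rewrite ?psiK.
  + move=> u v; rewrite !inE carM => -[p _ <-] [q _ <-] /=.
    by rewrite !psiK => /psi'_inj ->.
  + by rewrite carM carN => _ [p _ <-]; exists (psi p) => /=; [exists p | rewrite psiK].
- by rewrite carM => c _ _ [p _ <-] [q _ <-] /=; rewrite -psiL !psiK psi'L.
- rewrite carM => X _ _ sX [p _ <-] [q _ <-] /=; rewrite !psiK.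
  split=> [/(actM _ _ _ sX)/psi_inj -> | /(actN _ _ _ sX)/psi'_inj ->].
    exact/actN.
  exact/actM.
Qed.

Lemma sl2_model_irreducible op M psi : sl2_op_axioms op ->
  @sl2_model op M psi ->
  (forall W : set {poly C}, W 0 ->
    (forall c p q, W p -> W q -> W (c *: p + q)) ->
    (forall X p, in_sl2 X -> W p -> W (op X p)) ->
    W = [set 0] \/ W = setT) ->
  sl2_irreducible M.
Proof.
move=> opA hM opI; split; first exact: sl2_model_module hM.
case: hM => psiL psi_inj carM actM.
have psi0 : psi 0 = 0.
  by have := psiL (-1) 0 0; rewrite scaler0 addr0 scaleN1r addNr.
split.
  exists (psi 1); first by rewrite carM; exists 1.
  by rewrite -psi0 => /psi_inj/eqP; rewrite oner_eq0.
move=> W WM W0 WL WX.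
have [||| W0'|WT] := opI (psi @^-1` W).
- by rewrite /= psi0.
- by move=> c p q Wp Wq; rewrite /= psiL; exact: WL.
- move=> X p sX Wp; apply: (WX X (psi p)) => //; last exact/actM.
  by rewrite carM; exists (op X p).
- left; apply/seteqP; split=> [u Wu|_ ->] //.
  have := WM _ Wu; rewrite carM => -[p _ pu].
  have : (psi @^-1` W) p by rewrite /= pu.
  by rewrite W0' => /= p0; rewrite -pu p0 psi0.
- right; apply/seteqP; split=> // v; rewrite carM => -[p _ <-].
  by have : (psi @^-1` W) p by rewrite WT.
Qed.

(** This is the derivative at [s = 0] of [(c z + d) ^ (- mu) * p (g^-1 z)] for [g = exp (s X)], with
    [(c, d)] the second row of [g^-1]. Thus [E] acts by [- p'], [H] multiplies ['X^n] by
    [- (mu + 2 n)], and [F] sends ['X^n] to [(mu + n) 'X^n.+1]. Written with [X 1 1 - X 0 0], it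
    respects brackets for all 2 by 2 matrices, whatever their trace. *)
Definition weight_op (mu : C) X p : {poly C} :=
  (X 1 0 *: 'X^2 + (X 1 1 - X 0 0) *: 'X - (X 0 1)%:P) * p^`()
  + mu *: ((X 1 0 *: 'X + (X 1 1)%:P) * p).

Lemma weight_op_axioms mu : sl2_op_axioms (weight_op mu).
Proof.
split=> [X c p q|X Y c p|X Y p]; rewrite /weight_op.
- by rewrite derivD derivZ -!mul_polyC; ring.
- by rewrite !mxE -!mul_polyC !polyCB !polyCD !polyCM; ring.
- rewrite !mxE !big_ord_recl !big_ord0 /= !addr0 -[ord0]/(0 : 'I_2).
  have -> : lift 0 0 = 1 :> 'I_2 by apply: val_inj.
  rewrite -!mul_polyC !(polyCB, polyCD, polyCM).
  rewrite !(derivD, derivN, derivB, derivM, derivC, derivXn, derivX) /= expr1.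
  by ring.
Qed.

(** Conjugation by the antidiagonal permutation matrix: it exchanges [E] with [F] and negates [H].
    It accounts both for the change of coordinate from [z] to [w] and for complex conjugation on
    su(1,1). *)
Definition wflip X : 'M[C]_2 := \matrix_(i, j) X (rev_ord i) (rev_ord j).

Lemma wflipE X : (wflip X 0 0 = X 1 1) * (wflip X 1 1 = X 0 0) *
  (wflip X 0 1 = X 1 0) * (wflip X 1 0 = X 0 1).
Proof.
have r0 : rev_ord 0 = 1 :> 'I_2 by apply: val_inj.
have r1 : rev_ord 1 = 0 :> 'I_2 by apply: val_inj.
by rewrite !mxE r0 r1.
Qed.

Lemma in_sl2E X : in_sl2 X <-> X 1 1 = - X 0 0.
Proof.
rewrite /in_sl2 /mxtrace !big_ord_recl big_ord0 addr0 -[ord0]/(0 : 'I_2).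
have -> : lift 0 0 = 1 :> 'I_2 by apply: val_inj.
split=> [/eqP|->]; last by rewrite subrr.
by rewrite addrC addr_eq0 => /eqP.
Qed.

Lemma in_sl2_wflip X : in_sl2 X -> in_sl2 (wflip X).
Proof. by rewrite !in_sl2E !wflipE => ->; rewrite opprK. Qed.

Lemma wflipK : involutive wflip.
Proof. by move=> X; apply/matrixP=> i j; rewrite !mxE !rev_ordK. Qed.

Lemma sl2_op_axioms_wflip op : sl2_op_axioms op ->
  sl2_op_axioms (fun X => op (wflip X)).
Proof.
case=> opP opX opB; split=> [//|X Y c p|X Y p].
  by rewrite -opX; congr (op _ _); apply/matrixP=> i j; rewrite !mxE.
rewrite -opB; congr (op _ _); apply/matrixP=> i j; rewrite !mxE.
by congr (_ - _); rewrite (reindex_inj rev_ord_inj); apply: eq_bigr => k _; rewrite !mxE.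
Qed.

(** Differentiation, the action of [- E], brings a nonzero polynomial of [W] down to a nonzero
    constant in characteristic 0; from 1, the operator [F] reaches every monomial because its
    coefficients [mu + n] are invertible. *)
Lemma weight_op_irreducible mu (W : set {poly C}) :
  [pchar C] =i pred0 -> (forall n : nat, mu + n%:R != 0) ->
  W 0 -> (forall c p q, W p -> W q -> W (c *: p + q)) ->
  (forall X p, in_sl2 X -> W p -> W (weight_op mu X p)) ->
  W = [set 0] \/ W = setT.
Proof.
move=> charC muN W0 WL WX.
have WZ c p : W p -> W (c *: p) by move=> Wp; have := WL c p 0 Wp W0; rewrite addr0.
have Wd p : W p -> W p^`().
  move=> Wp; have sX : in_sl2 (- delta_mx 0 1 : 'M[C]_2) by apply/in_sl2E; rewrite !mxE /= !oppr0.
  have := WX _ _ sX Wp; congr W; rewrite /weight_op !mxE /= -!mul_polyC.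
  by rewrite oppr0 subr0 polyC0 polyCN; ring.
have Wx p : W p -> W ('X^2 * p^`() + mu *: ('X * p)).
  move=> Wp; have sX : in_sl2 (delta_mx 1 0 : 'M[C]_2) by apply/in_sl2E; rewrite !mxE /= oppr0.
  have := WX _ _ sX Wp; congr W; rewrite /weight_op !mxE /= -!mul_polyC.
  by rewrite subr0 polyC0 polyC1; ring.
have [->|[p Wp p0]] : W = [set 0] \/ exists2 p, W p & p != 0.
  have [[p]|nW] := pselect (exists2 p, W p & p != 0); first by right; exists p.
  left; apply/seteqP; split=> [p Wp|_ -> //]; apply/eqP/negPn/negP => p0.
  by apply: nW; exists p.
  by left.
right; have W1 : W 1.
  elim: {p}(size p) {-2}p (leqnn (size p)) Wp p0 => [|n IHn] p.
    by rewrite leqn0 size_poly_eq0 => /eqP -> _; rewrite eqxx.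
  move=> sp Wp p0; have [p1|p1] := eqVneq p^`() 0.
    have [c pc] : exists c, p = c%:P.
      exists p`_0; apply/polyP=> -[|i]; rewrite coefC //=.
      have /(congr1 (fun q : {poly C} => q`_i)) := p1; rewrite coef_deriv coef0 -mulr_natr => /eqP.
      by rewrite mulf_eq0 ((pcharf0P C).1 charC) orbF => /eqP.
    have c0 : c != 0 by rewrite -polyC_eq0 -pc.
    by have := WZ c^-1 _ Wp; rewrite pc -mul_polyC -polyCM mulVf // polyC1.
  apply: (IHn p^`()) => //; last exact: Wd.
  by rewrite -ltnS (leq_trans (lt_size_deriv p0)).
have WXn n : W 'X^n.
  elim: n => [|n IHn]; first by rewrite expr0.
  have := WZ (mu + n%:R)^-1 _ (Wx 'X^n IHn); congr W.
  rewrite derivXn mulrnAr -exprD -exprS.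
  have -> : 'X^(2 + n.-1) *+ n = n%:R *: 'X^(n.+1) :> {poly C}.
    by case: n {IHn} => [|n]; rewrite ?mulr0n ?scale0r // scaler_nat.
  by rewrite -scalerDl scalerA [n%:R + mu]addrC mulVf ?scale1r.
apply/seteqP; split=> // q _; rewrite -[q]coefK poly_def.
by elim/big_ind: _ => // [q1 q2 Wq1 Wq2|i _]; [rewrite -[q1]scale1r; apply: WL|apply: WZ].
Qed.

End PolynomialModels.

(** * The module of delta functions on the affine line *)

Section DeltaModule.
Variable k : fieldType.
Hypothesis char0 : [pchar k] =i pred0.
Local Notation D := (diffop {poly k}).
Local Notation z := (mulop 'X : D).
Local Notation d := (derivop k : D).
Local Notation delta := (@cyclic_module D z).
Local Notation cls := (@cyclic_class D z).

Lemma diffop0 (P : D) : P 0 = 0.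
Proof. by have := diffopZD P (-1) 0 0; rewrite scaler0 addr0 scaleN1r addNr. Qed.

Lemma diffopZ (P : D) c f : P (c *: f) = c *: P f.
Proof. by have := diffopZD P c f 0; rewrite diffop0 !addr0. Qed.

Definition diffopC (c : k) : D := mulop c%:P.

Lemma diffopC_is_zmod_morphism : zmod_morphism diffopC.
Proof. by move=> a b; apply: diffop_ext => f /=; rewrite polyCB mulrBl. Qed.
Lemma diffopC_is_monoid_morphism : monoid_morphism diffopC.
Proof. by split=> // a b; apply: diffop_ext => f /=; rewrite polyCM mulrA. Qed.
HB.instance Definition _ := GRing.isZmodMorphism.Build k D
  diffopC diffopC_is_zmod_morphism.
HB.instance Definition _ := GRing.isMonoidMorphism.Build k D
  diffopC diffopC_is_monoid_morphism.

(** The operator [q (d)] with constant coefficients. Through it the delta module becomes [k[d]], on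
    which [d] is multiplication by the variable and [z] is minus the derivative: a Fourier
    transform. *)
Definition constcoef (q : {poly k}) : D := (map_poly diffopC q).[d].

Lemma diffopC_derivop c : diffopC c * d = d * diffopC c.
Proof. by apply: diffop_ext => f /=; rewrite derivM derivC mul0r add0r. Qed.

Lemma diffopC_mulX c : diffopC c * z = z * diffopC c.
Proof. by apply: diffop_ext => f /=; rewrite mulrCA. Qed.

Lemma diffop_oneE (f : {poly k}) : (1 : D) f = f.
Proof. exact: mul1r. Qed.

Lemma derivop_mulX : d * z = z * d + 1.
Proof.
by apply: diffop_ext => f; rewrite diffop_addE !diffop_mulE diffop_oneE /= derivM derivX mul1r addrC.
Qed.

Lemma constcoefD p q : constcoef (p + q) = constcoef p + constcoef q.
Proof. by rewrite /constcoef rmorphD hornerD. Qed.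

Lemma constcoefZ c q : constcoef (c *: q) = diffopC c * constcoef q.
Proof. by rewrite /constcoef -mul_polyC rmorphM /= map_polyC /= hornerCM. Qed.

Lemma constcoefC c : constcoef c%:P = diffopC c.
Proof. by rewrite /constcoef map_polyC hornerC. Qed.

Lemma constcoefMX q : constcoef (q * 'X) = constcoef q * d.
Proof. by rewrite /constcoef rmorphM /= map_polyX hornerMX. Qed.

Lemma derivop_constcoef q : d * constcoef q = constcoef ('X * q).
Proof.
rewrite mulrC; elim/poly_ind: q => [|q c IHq].
  by rewrite mul0r (_ : constcoef 0 = 0) ?mulr0 // -polyC0 constcoefC rmorph0.
rewrite constcoefD constcoefC mulrDr -diffopC_derivop constcoefMX mulrA IHq.
by rewrite mulrDl constcoefD !constcoefMX constcoefC.
Qed.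

Lemma mulX_constcoef q : z * constcoef q = constcoef q * z - constcoef q^`().
Proof.
have cc0 : constcoef 0 = 0 by rewrite -polyC0 constcoefC rmorph0.
elim/poly_ind: q => [|q c IHq]; first by rewrite deriv0 cc0 mul0r mulr0 subrr.
rewrite derivMXaddC !constcoefD !constcoefMX constcoefC mulrDr mulrA IHq !mulrDl !mulNr.
rewrite -diffopC_mulX -[constcoef q * d * z]mulrA derivop_mulX mulrDr mulr1 mulrA.
by rewrite [X in _ = X - _]addrAC opprD !addrA addrK addrAC.
Qed.

(** Induction on the order. The commutator of [P] with [z] is known by induction; integrating it
    formally with respect to [d] gives an operator [P'] with the same commutator. The difference
    then commutes with [z], hence is multiplication by its value at 1. *)
Lemma diffop_derivatives (P : D) :
  exists n (b : nat -> {poly k}), P = \sum_(i < n) mulop (b i) * d ^+ i.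
Proof.
have [_ [n hP]] := diffopP P; elim: n P hP => [|n IHn] P hP.
  by exists 0%N, (fun=> 0); rewrite big_ord0; apply: diffop_ext => f; rewrite hP.
have [|m [b hb]] := IHn (P * z - z * P); first exact: hP.
(* Since the commutator of [d ^ (i + 1)] with [z] is [(i + 1) d ^ i], the antiderivative in [d]
   divides by [i + 1]; this is where characteristic 0 is used. *)
pose P' : D := \sum_(i < m) mulop (i.+1%:R^-1 *: b i) * d ^+ i.+1.
have dz i : d ^+ i.+1 * z = z * d ^+ i.+1 + i.+1%:R * d ^+ i.
  elim: i => [|i IHi]; first by rewrite expr1 expr0 mulr1 derivop_mulX.
  rewrite exprS -mulrA IHi mulrDr !mulrA derivop_mulX mulrDl mul1r -addrA; congr (_ + _).
  rewrite -[in RHS]natr1 mulrDl mul1r addrC -mulrA; congr (_ + _).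
  by rewrite -?mulrA !mulr_natl mulrnAr -exprS.
have hP' : P' * z - z * P' = P * z - z * P.
  rewrite hb mulr_suml mulr_sumr -sumrB; apply: eq_bigr => i _.
  rewrite -mulrA dz mulrDr !mulrA.
  have -> : mulop (i.+1%:R^-1 *: b i) * z = z * mulop (i.+1%:R^-1 *: b i).
    by apply: diffop_ext => f /=; rewrite mulrCA.
  rewrite addrC addKr; congr (_ * _).
  rewrite -(rmorph_nat diffopC); apply: diffop_ext => f /=.
  rewrite mulrA -scalerAl [b i * _]mulrC mul_polyC scalerA mulVf ?scale1r //.
  by rewrite ((pcharf0P k).1 char0).
pose R := P - P'.
have Rz f : R ('X * f) = 'X * R f.
  apply/eqP; rewrite -subr_eq0; apply/eqP.
  rewrite -[R ('X * f)]/((R * z) f) -['X * R f]/((z * R) f) -diffop_oppE -diffop_addE.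
  have -> : R * z - z * R = 0.
    rewrite /R mulrBl mulrBr opprD opprK addrACA [X in _ + X](_ : _ = - (P' * z - z * P')).
      by rewrite hP' subrr.
    by rewrite opprB addrC.
  by [].
have R1 f : R f = R 1 * f.
  elim/poly_ind: f => [|f c IHf].
    by rewrite mulr0 diffop0.
  rewrite diffopD mulrC Rz IHf -[c%:P]mulr1 mul_polyC diffopZ.
  by rewrite mulrDr mulrCA -scalerAr mulr1.
exists m.+1, (fun i => if i is j.+1 then j.+1%:R^-1 *: b j else R 1).
rewrite big_ord_recl /= expr0 mulr1.
rewrite [LHS](_ : P = R + P'); last by rewrite subrK.
by congr (_ + _); apply: diffop_ext => f; rewrite R1.
Qed.


Definition delta_of (q : {poly k}) : delta := cls (constcoef q).

Lemma delta_class0 : cls 0 = 0.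
Proof. by have := cyclic_classB z 0 0; rewrite !subrr. Qed.

Lemma delta_ofP c p q : delta_of (c *: p + q) = diffopC c *: delta_of p + delta_of q.
Proof. by rewrite /delta_of constcoefD constcoefZ cyclic_classD; congr (_ + _); rewrite -[LHS]cyclic_scaleE. Qed.

Lemma delta_of0 : delta_of 0 = 0.
Proof. by have := delta_ofP (-1) 0 0; rewrite scaler0 addr0 rmorphN rmorph1 scaleN1r addNr. Qed.

Lemma delta_ofZ c q : delta_of (c *: q) = diffopC c *: delta_of q.
Proof. by rewrite -[c *: q]addr0 delta_ofP delta_of0 addr0. Qed.

Lemma delta_ofD p q : delta_of (p + q) = delta_of p + delta_of q.
Proof. by rewrite -[p]scale1r delta_ofP rmorph1 !scale1r. Qed.

Lemma delta_ofN q : delta_of (- q) = - delta_of q.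
Proof. by rewrite -scaleN1r delta_ofZ rmorphN rmorph1 scaleN1r. Qed.

Lemma derivop_delta q : d *: delta_of q = delta_of ('X * q).
Proof. by rewrite /delta_of -derivop_constcoef -[RHS]cyclic_scaleE. Qed.

Lemma mulX_delta q : z *: delta_of q = - delta_of q^`().
Proof.
rewrite [LHS]cyclic_scaleE mulX_constcoef cyclic_classB.
have -> : cls (constcoef q * z) = cls 0.
  by apply/cyclic_class_eq/lidealP; exists (constcoef q); rewrite subr0.
by rewrite delta_class0 sub0r.
Qed.

(** A class is a sum of terms [b_i d ^ i delta] by [diffop_derivatives], and the image of [delta_of]
    is stable under sums, under [d], and under multiplication by polynomials. *)
Lemma delta_of_surj (m : delta) : exists q, delta_of q = m.
Proof.
have sD m1 m2 : (exists q, delta_of q = m1) -> (exists q, delta_of q = m2) ->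
    exists q, delta_of q = m1 + m2.
  move=> [q1 <-] [q2 <-]; exists (1 *: q1 + q2).
  by rewrite delta_ofP rmorph1 scale1r.
have sz b m1 : (exists q, delta_of q = m1) -> exists q, delta_of q = (mulop b : D) *: m1.
  elim/poly_ind: b m1 => [|b c IHb] m1 hm.
    exists 0; rewrite delta_of0 (_ : mulop 0 = 0 :> D) ?scale0r //.
    by apply: diffop_ext => f /=; rewrite mul0r.
  have -> : mulop (b * 'X + c%:P) = mulop b * z + diffopC c.
    by apply: diffop_ext => f; rewrite diffop_addE diffop_mulE /= mulrDl mulrA.
  rewrite scalerDl -scalerA; apply: sD.
    by apply: IHb; case: hm => q <-; exists (- q^`()); rewrite mulX_delta delta_ofN.
  by case: hm => q <-; exists (c *: q); rewrite delta_ofZ.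
rewrite -[m]cyclic_class_repr; have [n [b ->]] := diffop_derivatives (repr m).
have -> : cls (\sum_(i < n) mulop (b i) * d ^+ i) = (\sum_(i < n) mulop (b i) * d ^+ i) *: delta_of 1.
  by rewrite [RHS]cyclic_scaleE -polyC1 constcoefC rmorph1 mulr1.
rewrite scaler_suml; elim/big_ind: _ => [|m1 m2|i _]; last 2 first.
- exact: sD.
- rewrite -scalerA; apply: sz; exists 'X^i.
  elim: {i}(i : nat) => [|i IHi]; first by rewrite !expr0 scale1r.
  by rewrite !exprS -scalerA -IHi derivop_delta.
by exists 0; rewrite delta_of0.
Qed.

(** The linear map [f |-> (f - f(0)) / z] is a left inverse of [z], so the contradiction must come
    from the order. If [Q z = 1], then [S = 1 - z Q] kills the multiples of [z], and each commutator
    with [z] turns [z ^ j S] into [- z ^ (j + 1) S]. None of these vanishes at 1, because [S 1] has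
    value 1 at the origin. *)
Lemma one_notin_lidealX : (1 : D) \notin lideal z.
Proof.
apply/negP => /lidealP[Q hQ].
have Qz f : Q ('X * f) = f by rewrite -[LHS]/((Q * z) f) -hQ diffop_oneE.
have tors n j : ~ order_lt n (fun f : {poly k} => 'X^j * (f - 'X * Q f)).
  elim: n j => [|n IHn] j h.
    have := h 1; move=> /eqP; rewrite mulf_eq0 expf_eq0 polyX_eq0 andbF /= subr_eq0.
    by move=> /eqP/(congr1 (fun p : {poly k} => p.[0])); rewrite hornerM hornerX mul0r hornerC => /eqP; rewrite oner_eq0.
  apply: (IHn j.+1); have /order_ltN := h 'X; apply: order_lt_ext => f.
  by rewrite Qz exprSr; ring.
have [_ [n]] := diffopP (1 - z * Q).
by move=> h; apply: (tors n 0%N); apply: order_lt_ext h => f; rewrite expr0 mul1r diffop_addE diffop_oneE.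
Qed.

(** Multiplication by [z] differentiates [q], so induction on the size leaves a constant; a nonzero
    one would put 1 in the left ideal of [z]. *)
Lemma delta_of_inj q : delta_of q = 0 -> q = 0.
Proof.
elim: {q}(size q) {-2}q (leqnn (size q)) => [|n IHn] q.
  by rewrite leqn0 size_poly_eq0 => /eqP.
move=> sq hq; have q'0 : q^`() = 0.
  have [->|q0] := eqVneq q 0; first by rewrite deriv0.
  apply: IHn; first by rewrite -ltnS (leq_trans (lt_size_deriv q0)).
  by apply/eqP; rewrite -oppr_eq0 -mulX_delta hq scaler0.
have qc : q = (q`_0)%:P.
  apply/polyP=> -[|i]; rewrite coefC //=.
  have /(congr1 (fun q : {poly k} => q`_i)) := q'0; rewrite coef_deriv coef0 -mulr_natr => /eqP.
  by rewrite mulf_eq0 ((pcharf0P k).1 char0) orbF => /eqP.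
apply/eqP; rewrite qc polyC_eq0; apply/negPn/negP => q0.
have := one_notin_lidealX; rewrite -[1]subr0 => /negP; apply.
apply/cyclic_class_eq.
have qE : constcoef q = diffopC q`_0 by rewrite [in LHS]qc constcoefC.
have -> : 1 = diffopC (q`_0)^-1 * constcoef q by rewrite qE -rmorphM mulVf ?rmorph1.
rewrite -[LHS]cyclic_scaleE -/(delta_of q) hq delta_class0.
exact: scaler0.
Qed.

End DeltaModule.

(** * Global sections of the two sheaves as polynomial models *)

Section GlobalSections.
Variables (k : fieldType) (t : int).
Hypothesis char0 : [pchar k] =i pred0.
Local Notation D := (diffop {poly k}).
Local Notation mu := ((t + 1)%:~R : k).
Hypothesis mu_neq : forall n : nat, mu + n%:R != 0.

(* With [w i] the weight vector ['X^i] of [weight_op] and [d^i] the derivatives of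
   the delta function, [w i = wt i * d^i]. *)
Definition wt (n : nat) : k := \prod_(i < n) - (mu + i%:R).

Lemma wt_neq0 n : wt n != 0.
Proof. by apply/prodf_neq0 => i _; rewrite oppr_eq0. Qed.

Lemma wtS n : wt n.+1 = - (mu + n%:R) * wt n.
Proof. by rewrite /wt big_ord_recr mulrC. Qed.

(** The factor is dictated by [F]: it sends ['X^n] to [(mu + n) 'X^n.+1] but acts on delta functions
    by [- d], so the image of ['X^n] must be [(wt n)^-1 d ^ n delta]. *)
Definition rescale (p : {poly k}) := \poly_(i < size p) ((wt i)^-1 * p`_i).

Lemma coef_rescale p i : (rescale p)`_i = (wt i)^-1 * p`_i.
Proof. by rewrite coef_poly; case: ltnP => // h; rewrite nth_default // mulr0. Qed.

Lemma rescaleP c p q : rescale (c *: p + q) = c *: rescale p + rescale q.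
Proof.
by apply/polyP => i; rewrite coefD coefZ !coef_rescale coefD coefZ mulrDr mulrCA.
Qed.

Lemma rescale_inj : injective rescale.
Proof.
move=> p q /polyP h; apply/polyP => i; have := h i; rewrite !coef_rescale.
by apply: mulfI; rewrite invr_neq0 // wt_neq0.
Qed.

Lemma rescale_surj q : exists p, rescale p = q.
Proof.
exists (\poly_(i < size q) (wt i * q`_i)); apply/polyP => i.
rewrite coef_rescale coef_poly; case: ltnP => h; last by rewrite mulr0 nth_default.
by rewrite mulKf // wt_neq0.
Qed.

(** The vector fields [H0], [E0], [F0] after the substitution of multiplication by ['X] for [d] and
    of minus the derivative for [z]. *)
Definition fourier_op (X : 'M[k]_2) (q : {poly k}) : {poly k} :=
  X 0 0 *: - (('X * q)^`() *+ 2 + (t - 1)%:~R *: q)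
  + (X 0 1 *: (('X * q)^`(2) + (t - 1)%:~R *: q^`()) + X 1 0 *: - ('X * q)).

Lemma rescale_weight_op X p : in_sl2 X ->
  rescale (weight_op mu X p) = fourier_op X (rescale p).
Proof.
move=> /in_sl2E X11; apply/polyP => i.
have muE : mu = (t - 1)%:~R + 2%:R by rewrite -[2%:R]/((Posz 2)%:~R) -intrD -addrA.
rewrite /weight_op /fourier_op X11 mulrBl mulrDl mulrDl -!scalerAl mul_polyC.
rewrite derivnS derivn1.
rewrite !(coef_rescale, coefD, coefB, coefN, coefZ, coefMn, coef_deriv, coefCM, coefXM, coefXnM, mul_polyC) /=.
case: i => [|[|i]] /=; rewrite ?subSS ?subn0.
- move: (mu_neq 0); rewrite addr0 wtS /wt big_ord0 addr0 muE; move: (t - 1)%:~R => T h.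
  by field; rewrite oppr_eq0 h oner_neq0.
- move: (mu_neq 0) (mu_neq 1); rewrite addr0 !wtS /wt big_ord0 addr0 muE; move: (t - 1)%:~R => T h1 h2.
  by field; rewrite !oppr_eq0 h1 h2 oner_neq0.
- move: (mu_neq i) (mu_neq i.+1) (mu_neq i.+2) (wt_neq0 i); rewrite !wtS muE.
  move: (t - 1)%:~R (wt i) => T w h0 h1 h2 hw; field.
  by rewrite hw !oppr_eq0 h0 nat1r h1 -(natrD _ 2 i) h2.
Qed.

Lemma sl2_op0_delta X q : sl2_op0 t X *: delta_of q = delta_of (fourier_op X q).
Proof.
have intC n : n%:~R = n%:~R%:P :> {poly k} by rewrite -(rmorph_int (@polyC k)).
have -> : sl2_op0 t X = diffopC (X 0 0) * (diffopC 2%:R * mulop 'X * derivop k - diffopC (t - 1)%:~R)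
    + diffopC (X 0 1) * (mulop 'X * mulop 'X * derivop k - diffopC (t - 1)%:~R * mulop 'X)
    + diffopC (X 1 0) * - derivop k.
  rewrite /sl2_op0 /sl2_comb /H0 /E0 /F0 intC; congr (_ * (_ * _ - _) + _ * (_ * _ - _) + _).
  - by apply: diffop_ext => f /=; rewrite polyC_natr mulrA.
  - by apply: diffop_ext => f /=; rewrite expr2 mulrA.
  - by apply: diffop_ext => f /=; rewrite mulrA.
rewrite !scalerDl -!scalerA !scalerBl -!scalerA scaleNr derivop_delta.
rewrite !(mulX_delta, scalerN, opprK) -opprD -addrA.
rewrite /fourier_op derivnS derivn1 !(delta_ofD, delta_ofZ, delta_ofN, mulr2n) !scalerN.
by rewrite (rmorph_nat (@diffopC k) 2) scaler_nat mulr2n.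
Qed.

(** In the coordinate [w] the operators of [E], [F], [H] have the formulas of [F0], [E0], [- H0] in
    [z], so the point at infinity reduces to the point 0. *)
Lemma sl2_opoo_wflip X : in_sl2 X -> sl2_opoo t X = sl2_op0 t (wflip X) :> D.
Proof.
move=> /in_sl2E X11; rewrite /sl2_opoo /sl2_op0 /sl2_comb !wflipE X11.
rewrite -!/(diffopC _) rmorphN /= /Hoo /Eoo /Foo /H0 /E0 /F0.
by rewrite mulNr -mulrN opprB [- _ + mulop _]addrC addrAC.
Qed.

Lemma sl2_model_I0 :
  sl2_model (weight_op mu) (M := global_sections (sheaf_I0 k t))
    (fun p => (delta_of (rescale p), 0)).
Proof.
split=> /=.
- by move=> c p q; rewrite rescaleP delta_ofP; congr (_, _); rewrite [LHS]zero_row_eq0 [RHS]zero_row_eq0.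
- move=> p q [] /eqP; rewrite -subr_eq0 -delta_ofN -delta_ofD => /eqP/(delta_of_inj char0)/eqP.
  by rewrite subr_eq0 => /eqP/rescale_inj.
- apply/seteqP; split=> [[m1 m2] _|m _] /=; last by rewrite [LHS]zero_row_eq0 [RHS]zero_row_eq0.
  have [q <-] := delta_of_surj char0 m1; have [p <-] := rescale_surj q.
  by exists p => //; congr (_, _); rewrite [RHS]zero_row_eq0.
- move=> X p u sX; rewrite /chart_act /= sl2_op0_delta rescale_weight_op //.
  by rewrite scaler0.
Qed.

Lemma sl2_model_Ioo :
  sl2_model (fun X => weight_op mu (wflip X)) (M := global_sections (sheaf_Ioo k t))
    (fun p => (0, delta_of (rescale p))).
Proof.
split=> /=.
- by move=> c p q; rewrite rescaleP delta_ofP; congr (_, _); rewrite [LHS]zero_row_eq0 [RHS]zero_row_eq0.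
- move=> p q [] /eqP; rewrite -subr_eq0 -delta_ofN -delta_ofD => /eqP/(delta_of_inj char0)/eqP.
  by rewrite subr_eq0 => /eqP/rescale_inj.
- apply/seteqP; split=> [[m1 m2] _|m _] /=; last by rewrite [LHS]zero_row_eq0 [RHS]zero_row_eq0.
  have [q <-] := delta_of_surj char0 m2; have [p <-] := rescale_surj q.
  by exists p => //; congr (_, _); rewrite [RHS]zero_row_eq0.
- move=> X p u sX; rewrite /chart_act /= sl2_opoo_wflip // sl2_op0_delta.
  by rewrite rescale_weight_op ?scaler0 //; exact: in_sl2_wflip.
Qed.

End GlobalSections.

(** * Derivatives through continuous slope functions, complex and along real curves *)

Section Caratheodory.

Lemma cvg_dnbhs_sub (K : numFieldType) (V : normedModType K) (z : V) :
  (fun y => y - z) @ z^' --> (0 : V)^'.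
Proof.
move=> P hP; change (nbhs z (fun y => y != z -> P (y - z))).
have : (fun y => y - z) @ z --> (0 : V).
  by rewrite -(subrr z); apply: cvgB; [exact: cvg_id|exact: cvg_cst].
move=> /(_ _ hP) hz; apply: (@filterS _ (nbhs z) _ _ _ _ hz) => y /= h yz; apply: h.
by rewrite subr_eq0.
Qed.

Lemma derivable_caratheodory (K : numFieldType) (f : K^o -> K^o) (z c : K) :
  derivable f z 1 -> 'D_1 f z = c ->
  exists P : K^o -> K^o, [/\ P @ z --> P z, P z = c & forall y, f y - f z = P y * (y - z)].
Proof.
move=> df dfc; exists (fun y => if y == z then c else (f y - f z) / (y - z)).
split; last 2 first.
- by rewrite eqxx.
- by move=> y; have [->|yx] := eqVneq y z; rewrite ?subrr ?mulr0 // divfK ?subr_eq0.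
set P := fun y => _; suff : P y @[y --> z^'] --> P z by move=> /(continuous_withinNx P z).
rewrite [P z]/P eqxx.
have h : h^-1 *: (f (h *: (1 : K^o) + z) - f z) @[h --> 0^'] --> (c : K^o).
  by rewrite -dfc; exact: df.
have h2 := cvg_comp _ _ (cvg_dnbhs_sub (z : K^o)) h.
apply: cvg_trans h2; apply: near_eq_cvg; near=> y => /=.
have yz : y != z by near: y; exact: nbhs_dnbhs_neq.
by rewrite /P (negbTE yz) [(y - z)%:A]mulr1 subrK mulrC.
Unshelve. all: by end_near. Qed.

Lemma caratheodory_cvg (K : numFieldType) (F P : K^o -> K^o) (x : K) :
  P @ x --> P x -> (forall y, F y - F x = P y * (y - x)) ->
  h^-1 *: (F (h *: 1 + x) - F x) @[h --> 0^'] --> P x.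
Proof.
move=> hP hF; apply: (@cvg_trans _ ((fun h => P (h + x)) @ 0^')).
  apply: near_eq_cvg; near=> h; rewrite hF /=.
  have h0 : h != 0 by near: h; exact: nbhs_dnbhs_neq.
  by rewrite [h%:A]mulr1 addrK -[_ *: _]/(_ * _) mulrCA mulVf ?mulr1.
apply: cvg_within_filter; apply: (@cvg_comp _ _ _ (fun h => h + x) P _ (nbhs x)) => //.
have : (fun h : K^o => h + x) @ (0 : K^o) --> (0 + x : K^o).
  by apply: (@cvgD _ K^o _ (nbhs (0 : K^o)) _ id (fun=> x)); [exact: cvg_id|exact: cvg_cst].
by rewrite add0r.
Unshelve. all: by end_near. Qed.

End Caratheodory.

Section ComplexTopology.
Variable R : realType.
Local Notation C := R[i].
Implicit Types (z w : C).

Lemma normcE' z : `|z| = (Normc.normc z)%:C%C.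
Proof. by []. Qed.

Lemma normc_ltr z e : (`|z| < e%:C%C) = (Normc.normc z < e).
Proof. exact: ltcR. Qed.

Lemma normc_ge0 z : 0 <= Normc.normc z.
Proof. by case: z => a b; exact: sqrtr_ge0. Qed.

Lemma normcR (x : R) : Normc.normc x%:C%C = `|x|.
Proof. by rewrite /= expr0n addr0 sqrtr_sqr. Qed.

Lemma posC_real (e : C) : 0 < e -> e = (complex.Re e)%:C%C /\ 0 < complex.Re e.
Proof. by case: e => a b; rewrite ltcE /= => /andP[/eqP-> ->]. Qed.

Lemma cvgCP (T : Type) (F : set_system T) {FF : Filter F} (f : T -> C^o) (l : C^o) :
  f @ F --> l <-> forall e : R, 0 < e -> \forall x \near F, Normc.normc (f x - l) < e.
Proof.
split=> [/cvgrPdist_lt h e e0|h].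
  have := h (e%:C%C); rewrite ltcR => /(_ e0); apply: filterS => x.
  by rewrite distrC normc_ltr.
apply/cvgrPdist_lt => e /posC_real[-> e0]; apply: filterS (h _ e0) => x.
by rewrite distrC normc_ltr.
Qed.

Lemma normc_ge_abs_Re z : `|complex.Re z| <= Normc.normc z.
Proof. by have := normc_ge_Re z; rewrite lecR. Qed.

Lemma normc_ge_abs_Im z : `|complex.Im z| <= Normc.normc z.
Proof.
have := normc_ge_abs_Re (z * - 'i%C); rewrite Normc.normcM; case: z => a b /=.
by rewrite !oppr0 !mulr0 sub0r mulrN mulr1 opprK expr0n /= add0r sqrrN expr1n sqrtr1 mulr1.
Qed.

Lemma normc_le_ReIm z : Normc.normc z <= `|complex.Re z| + `|complex.Im z|.
Proof.
case: z => a b /=; rewrite -[leRHS]ger0_norm ?addr_ge0// -sqrtr_sqr ler_wsqrtr //.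
by rewrite sqrrD !real_normK ?num_real // lerD2r lerDl mulrn_wge0 // mulr_ge0.
Qed.

Lemma ReB z w : complex.Re (z - w) = complex.Re z - complex.Re w.
Proof. by case: z w => ? ? []. Qed.

Lemma ImB z w : complex.Im (z - w) = complex.Im z - complex.Im w.
Proof. by case: z w => ? ? []. Qed.

Lemma cvgC_M (T : Type) (F : set_system T) {FF : Filter F} (f g : T -> C^o) (a b : C^o) :
  f @ F --> a -> g @ F --> b -> (fun x => f x * g x : C^o) @ F --> (a * b : C^o).
Proof. exact: (@cvgM C T F FF f g a b). Qed.

Lemma cvgC_D (T : Type) (F : set_system T) {FF : Filter F} (f g : T -> C^o) (a b : C^o) :
  f @ F --> a -> g @ F --> b -> (fun x => f x + g x : C^o) @ F --> (a + b : C^o).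
Proof. exact: (@cvgD C C^o T F FF f g a b). Qed.

Lemma cvgC_Re (T : Type) (F : set_system T) {FF : Filter F} (f : T -> C^o) (l : C^o) :
  f @ F --> l -> (fun x => complex.Re (f x)) @ F --> complex.Re l.
Proof.
move=> /cvgCP h; apply/cvgrPdist_lt => e /h; apply: filterS => x.
apply: le_lt_trans; rewrite distrC; apply: le_trans (normc_ge_abs_Re _).
by rewrite -ReB.
Qed.

Lemma cvgC_Im (T : Type) (F : set_system T) {FF : Filter F} (f : T -> C^o) (l : C^o) :
  f @ F --> l -> (fun x => complex.Im (f x)) @ F --> complex.Im l.
Proof.
move=> /cvgCP h; apply/cvgrPdist_lt => e /h; apply: filterS => x.
apply: le_lt_trans; rewrite distrC; apply: le_trans (normc_ge_abs_Im _).
by rewrite -ImB.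
Qed.

Lemma cvgC_ReIm (T : Type) (F : set_system T) {FF : Filter F} (f g : T -> R) (a b : R) :
  f @ F --> a -> g @ F --> b -> (fun x => Complex (f x) (g x) : C^o) @ F --> (Complex a b : C^o).
Proof.
move=> /cvgrPdist_lt hf /cvgrPdist_lt hg; apply/cvgCP => e e0.
have e20 : 0 < e / 2 by rewrite divr_gt0.
near=> x; apply: le_lt_trans (normc_le_ReIm _) _; rewrite /= [ltRHS]splitr ltrD // distrC.
  by near: x; exact: hf.
by near: x; exact: hg.
Unshelve. all: by end_near. Qed.

(** Caratheodory's form of [d f = w d j] at [x]; it makes the product and chain
    rules algebraic, and covers both complex derivatives ([T = C], [j = id]) and
    derivatives along real curves ([T = R], [j] the inclusion). *)
Definition cara (T : topologicalType) (j f : T -> C^o) (x : T) (w : C) : Prop :=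
  exists phi : T -> C^o,
    [/\ phi @ x --> phi x, phi x = w & forall y, f y - f x = phi y * (j y - j x)].

Section Cara.
Variables (T : topologicalType) (j : T -> C^o) (x : T).
Hypothesis jx : j @ x --> j x.

Lemma cara_cont f w : cara j f x w -> f @ x --> f x.
Proof.
move=> [phi [ph _ hf]]; have -> : f = (fun y => phi y * (j y - j x) + f x).
  by apply/funext => y; rewrite -hf subrK.
have : (fun y => phi y * (j y - j x) + f x : C^o) @ x --> (phi x * (j x - j x) + f x : C^o).
  apply: (@cvgC_D _ _ _ (fun y => phi y * (j y - j x)) (fun=> f x)); last exact: cvg_cst.
  apply: (@cvgC_M _ _ _ phi (fun y => j y - j x) _ _ ph).
  by apply: (@cvgC_D _ _ _ j (fun=> - j x) _ _ jx); exact: cvg_cst.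
by [].
Qed.

Lemma cara_cst c : cara j (fun=> c) x 0.
Proof.
by exists (fun=> 0); split=> [|//|y]; [exact: cvg_cst|rewrite subrr mul0r].
Qed.

Lemma cara_id : cara j j x 1.
Proof.
by exists (fun=> 1); split=> [|//|y]; [exact: cvg_cst|rewrite mul1r].
Qed.

Lemma caraD f g a b : cara j f x a -> cara j g x b -> cara j (fun y => f y + g y) x (a + b).
Proof.
move=> [p [hp <- ef]] [q [hq <- eg]]; exists (fun y => p y + q y).
split; [exact: (cvgC_D hp hq) | by [] | move=> y].
by rewrite mulrDl -ef -eg opprD addrACA.
Qed.

Lemma caraM f g a b : cara j f x a -> cara j g x b ->
  cara j (fun y => f y * g y) x (a * g x + f x * b).
Proof.
move=> cf cg; have gx := cara_cont cg.
case: cf cg => [p [hp <- ef]] [q [hq <- eg]]; exists (fun y => p y * g y + f x * q y).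
split; [|by []|move=> y]; last by rewrite mulrDl mulrAC -ef -mulrA -eg mulrBl mulrBr addrA subrK.
apply: (@cvgC_D _ _ _ (fun y => p y * g y) (fun y => f x * q y)).
  exact: (cvgC_M hp gx).
by apply: (@cvgC_M _ _ _ (fun=> f x) q _ _ _ hq); exact: cvg_cst.
Qed.

Lemma caraZ c f a : cara j f x a -> cara j (fun y => c * f y) x (c * a).
Proof. by move=> cf; have := caraM (cara_cst c) cf; rewrite mul0r add0r. Qed.

Lemma cara_comp (f : C^o -> C^o) g a b : cara id f (g x) a -> cara j g x b ->
  cara j (f \o g) x (a * b).
Proof.
move=> [p [hp <- ef]] cg; have gx := cara_cont cg.
case: cg => [q [hq <- eg]]; exists (fun y => p (g y) * q y).
split; [|by []|by move=> y; rewrite /= ef eg mulrA].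
apply: (@cvgC_M _ _ _ (fun y => p (g y)) q _ _ _ hq).
exact: (cvg_comp _ _ gx hp).
Qed.

Lemma cara_sum n (f : 'I_n -> T -> C^o) (a : 'I_n -> C) : (forall i, cara j (f i) x (a i)) ->
  cara j (fun y => \sum_i f i y) x (\sum_i a i).
Proof.
move=> h; elim: n f a h => [|n IHn] f a h.
  rewrite big_ord0; have -> : (fun y => \sum_(i < 0) f i y) = fun=> 0.
    by apply/funext => y; rewrite big_ord0.
  exact: cara_cst.
rewrite big_ord_recl; have -> : (fun y => \sum_(i < n.+1) f i y) =
    fun y => f ord0 y + \sum_(i < n) f (lift ord0 i) y.
  by apply/funext => y; rewrite big_ord_recl.
by apply: caraD; [exact: h|apply: IHn => i; exact: h].
Qed.

Lemma cara_horner (p : {poly C}) : cara j (fun y => p.[j y]) x (p^`().[j x]).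
Proof.
elim/poly_ind: p => [|p c IHp].
  rewrite deriv0 horner0; have -> : (fun y => (0 : {poly C}).[j y]) = fun=> 0.
    by apply/funext => y; rewrite horner0.
  exact: cara_cst.
have -> : (fun y => (p * 'X + c%:P).[j y]) = fun y => p.[j y] * j y + c.
  by apply/funext => y; rewrite hornerMXaddC.
have -> : (p * 'X + c%:P)^`().[j x] = p^`().[j x] * j x + p.[j x] * 1 + 0.
  by rewrite derivMXaddC hornerD hornerMX mulr1 addr0 addrC.
by apply: caraD; [apply: caraM; [exact: IHp|exact: cara_id]|exact: cara_cst].
Qed.

End Cara.

Definition jR : R -> C^o := fun x => x%:C%C.

Lemma jR_cont x : jR @ x --> jR x.
Proof. by apply: (@cvgC_ReIm _ _ _ id (fun=> 0)); [exact: cvg_id|exact: cvg_cst]. Qed.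

Lemma cara_is_derive (f : R -> C^o) (x : R) w : cara jR f x w ->
  is_derive x 1 (fun y => complex.Re (f y)) (complex.Re w) /\
  is_derive x 1 (fun y => complex.Im (f y)) (complex.Im w).
Proof.
move=> [p [hp <- ef]].
have key (F : R -> R) (P : R -> R) : P @ x --> P x ->
    (forall y, F y - F x = P y * (y - x)) -> is_derive x (1 : R) F (P x).
  move=> hP /(caratheodory_cvg hP) h.
  by apply: DeriveDef; [apply/cvg_ex; exists (P x)|exact: cvg_lim h].
have eRe (a b : C) r : complex.Re (a * (jR r - jR x)) = complex.Re a * (r - x).
  by case: a => c d; rewrite /= subrr mulr0 subr0.
have eIm (a b : C) r : complex.Im (a * (jR r - jR x)) = complex.Im a * (r - x).
  by case: a => c d; rewrite /= subrr mulr0 add0r.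
split; apply: (key _ (fun y => _ (p y))).
- exact: cvgC_Re.
- by move=> y; rewrite -eRe // -ef ReB.
- exact: cvgC_Im.
- by move=> y; rewrite -eIm // -ef ImB.
Qed.

Lemma is_derive_cara (A B : R -> R) (x a b : R) : is_derive x 1 A a -> is_derive x 1 B b ->
  cara jR (fun y => Complex (A y) (B y)) x (Complex a b).
Proof.
have key (F : R -> R) c : is_derive x (1 : R) F c ->
    exists P : R -> R, [/\ P @ x --> P x, P x = c & forall y, F y - F x = P y * (y - x)].
  by move=> [dF dFc]; exact: (derivable_caratheodory dF dFc).
move=> /key[P [hP <- eA]] /key[Q [hQ <- eB]].
exists (fun y => Complex (P y) (Q y)); split=> //.
  exact: cvgC_ReIm.
by move=> y; apply/eqP; rewrite eq_complex /= eA eB subrr !mulr0 subr0 add0r !eqxx.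
Qed.

Lemma cara_real_unique (f : R -> C^o) (x : R) w w' : cara jR f x w -> cara jR f x w' -> w = w'.
Proof.
move=> /cara_is_derive[[_ h1] [_ h2]] /cara_is_derive[[_ h3] [_ h4]].
by apply/eqP; rewrite eq_complex -h1 -h2 h3 h4 !eqxx.
Qed.

(** This is the only integration tool for the differential equations below; its hypothesis concerns
    the whole real line, which constrains the parametrization of the curves. *)
Lemma cara_real_cst (f : R -> C^o) : (forall x, cara jR f x 0) -> forall x y, f x = f y.
Proof.
move=> h x y; apply/eqP; rewrite eq_complex; apply/andP; split; apply/eqP.
  by apply: (@is_derive_0_is_cst _ (fun y => complex.Re (f y))) => z; have [] := cara_is_derive (h z).
by apply: (@is_derive_0_is_cst _ (fun y => complex.Im (f y))) => z; have [] := cara_is_derive (h z).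
Qed.

Lemma derivable_cara (f : C^o -> C^o) (z : C) : derivable f z 1 -> exists w, cara id f z w.
Proof. by move=> df; exists ('D_1 f z); exact: (derivable_caratheodory df erefl). Qed.

Lemma cara_derivable (f : C^o -> C^o) (z w : C) : cara id f z w -> derivable f z 1.
Proof.
by move=> [P [hP _ hF]]; apply/cvg_ex; exists (P z); exact: caratheodory_cvg.
Qed.

End ComplexTopology.

(** * The exponential on the circle, and holomorphic functions along circles and radii *)

Section CircleOde.
Variable R : realType.
Local Notation C := R[i].
Local Notation normc := (@Normc.normc R).
Local Notation jR := (@jR R).
Local Notation "x %:C" := (real_complex R x) : ring_scope.

(** This is [exp (i l s)] for a complex frequency [l], split into real and imaginary parts. *)
Definition expi (l : C) (s : R) : C :=
  Complex (expR (- complex.Im l * s) * cos (complex.Re l * s))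
          (expR (- complex.Im l * s) * sin (complex.Re l * s)).

Lemma expi0 l : expi l 0 = 1.
Proof. by rewrite /expi !mulr0 expR0 cos0 sin0 mulr1 mulr0. Qed.

Lemma cara_comp_real (F : R -> C^o) (G P : R -> R) (s : R) w :
  cara jR F (G s) w -> P @ s --> P s -> (forall y, G y - G s = P y * (y - s)) ->
  cara jR (F \o G) s (w * (P s)%:C).
Proof.
move=> [p [hp <- hF]] hP hG.
have Gs : G @ s --> G s.
  have -> : G = (fun y => P y * (y - s) + G s) by apply/funext => y; rewrite -hG subrK.
  have : (fun y => P y * (y - s) + G s) @ s --> P s * (s - s) + G s.
    apply: (@cvgD R R _ _ _ (fun y => P y * (y - s)) (fun=> G s)); last exact: cvg_cst.
    apply: (@cvgM R _ _ _ P (fun y => y - s)); first exact: hP.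
    by apply: (@cvgB R R _ _ _ id (fun=> s)); [exact: cvg_id|exact: cvg_cst].
  by [].
exists (fun y => p (G y) * (P y)%:C); split=> [|//|y]; last first.
  by rewrite /= hF /jR -mulrA -!rmorphB /= hG rmorphM.
apply: (@cvgC_M _ _ _ _ (fun y => p (G y)) (fun y => (P y)%:C)); first exact: (cvg_comp _ _ Gs hp).
by apply: (@cvgC_ReIm _ _ _ _ P (fun=> 0)); [exact: hP|exact: cvg_cst].
Qed.

Lemma cara_scale (F : R -> C^o) (c s : R) w : cara jR F (c * s) w ->
  cara jR (fun y => F (c * y)) s (w * c%:C).
Proof.
move=> hF; apply: (@cara_comp_real F (fun y => c * y) (fun=> c)) => //; first exact: cvg_cst.
by move=> y; rewrite mulrBr.
Qed.

Lemma expi_cara l s : cara jR (expi l) s ('i%C * l * expi l s).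
Proof.
have jx := @jR_cont R s.
have he x : cara jR (fun y => Complex (expR y) 0) x (Complex (expR x) 0).
  exact: is_derive_cara.
have hc x : cara jR (fun y => Complex (cos y) (sin y)) x (Complex (- sin x) (cos x)).
  exact: is_derive_cara.
have := caraM jx (cara_scale (he (- complex.Im l * s))) (cara_scale (hc (complex.Re l * s))).
have -> : (fun y => Complex (expR (- complex.Im l * y)) 0 *
   Complex (cos (complex.Re l * y)) (sin (complex.Re l * y))) = expi l.
  by apply/funext => y; apply/eqP; rewrite eq_complex /= !mul0r subr0 addr0 !eqxx.
congr cara; apply/eqP; rewrite eq_complex; case: l => a b /=.
by apply/andP; split; apply/eqP; ring.
Qed.

Lemma normc_expi l s : normc (expi l s) = expR (- complex.Im l * s).
Proof.
rewrite /= !exprMn -mulrDr cos2Dsin2 mulr1 sqrtr_sqr ger0_norm //.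
Qed.

Lemma normc_expi1 s : normc (expi 1 s) = 1.
Proof. by rewrite normc_expi /= oppr0 mul0r expR0. Qed.

Lemma expi_pow (n : nat) s : expi (- n%:R) s * expi 1 s ^+ n = 1.
Proof.
pose F s := expi (- n%:R) s * expi 1 s ^+ n.
suff h x : cara jR F x 0.
  by rewrite -/(F s) (cara_real_cst h s 0) /F !expi0 expr1n mulr1.
have -> : (0 : C) = 'i%C * (- n%:R) * expi (- n%:R) x * expi 1 x ^+ n
    + expi (- n%:R) x * (('X^n : {poly C})^`().[expi 1 x] * ('i%C * 1 * expi 1 x)).
  rewrite derivXn hornerMn hornerXn -mulr_natr.
  by case: n {F} => [|n] /=; rewrite ?exprS; ring.
have jx := @jR_cont R x.
apply: (caraM jx); first exact: expi_cara.
have -> : (fun y => expi 1 y ^+ n) = (fun z : C^o => ('X^n : {poly C}).[z]) \o expi 1.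
  by apply/funext => y /=; rewrite hornerXn.
apply: (cara_comp jx); last exact: expi_cara.
by apply: cara_horner; exact: cvg_id.
Qed.

Lemma polar (u : C) : exists s, u = (normc u)%:C * expi 1 s.
Proof.
have [->|u0] := eqVneq u 0; first by exists 0; rewrite Normc.normc0 mul0r.
have nu0 : normc u != 0 by apply: contra u0 => /eqP/Normc.eq0_normc ->.
suff [s [hc hs]] : exists s, cos s = complex.Re u / normc u /\ sin s = complex.Im u / normc u.
  exists s; rewrite /expi /= oppr0 !mul0r expR0 !mul1r hc hs.
  apply/eqP; rewrite eq_complex /= !mul0r subr0 addr0 ![_ * (_ / _)]mulrC !divfK //.
  by rewrite !eqxx.
have : (complex.Re u / normc u) ^+ 2 + (complex.Im u / normc u) ^+ 2 = 1.
  rewrite !exprMn -mulrDl; case: u u0 nu0 => a b _ /= nu0.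
  by rewrite -[X in X * _](@sqr_sqrtr _ (a ^+ 2 + b ^+ 2)) ?addr_ge0 ?sqr_ge0 // -exprMn mulfV // expr1n.
move: (_ / _) (complex.Im u / _) => x y xy1.
have x1 : -1 <= x <= 1.
  by rewrite -ler_norml -(@ler_pXn2r _ 2) ?nnegrE // expr1n real_normK ?num_real // -xy1 lerDl sqr_ge0.
have sy : Num.sqrt (1 - x ^+ 2) = `|y| by rewrite -xy1 addrC addKr sqrtr_sqr.
have [y0|y0] := leP 0 y.
  by exists (acos x); rewrite acosK ?in_itv //= sin_acos // sy ger0_norm.
by exists (- acos x); rewrite cosN sinN acosK ?in_itv //= sin_acos // sy ltr0_norm // opprK.
Qed.

(** With [f] the fractional part of [a], the half-angle formula gives [sin (f * pi) = 0], whereas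
    the sine is positive strictly between 0 and [pi]. *)
Lemma cos_eq1_int (a : R) : cos (a * (pi *+ 2)) = 1 -> exists m : int, a = m%:~R.
Proof.
move=> ca; exists (Num.floor a).
have /andP[fa af] := floor_itv a.
set m := Num.floor a in fa af *; pose f := a - m%:~R.
have f0 : 0 <= f by rewrite subr_ge0.
have f1 : f < 1 by rewrite ltrBlDl -[ltRHS](rmorphD _ m 1) /=.
have cos_periodz (x : R) (n : int) : cos (x + n%:~R * (pi *+ 2)) = cos x.
  case: n => n; first by rewrite -pmulrn mulr_natl (periodicn (@cosD2pi R)).
  rewrite NegzE mulrNz mulNr -pmulrn mulr_natl.
  by rewrite -(periodicn (@cosD2pi R) n.+1) subrK.
have cf : cos (f * (pi *+ 2)) = 1.
  by rewrite -(cos_periodz _ m) -mulrDl subrK.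
have : sin (f * pi) = 0.
  apply/eqP; rewrite -sqrf_eq0; apply/eqP.
  move: cf; rewrite mulrnAr mulr2n cosD -!expr2 cos2sin2 -addrA -opprD -mulr2n => /eqP.
  by rewrite eq_sym -subr_eq0 opprD addrA subrr add0r opprK mulrn_eq0 /= => /eqP.
have [f00|f00] := eqVneq f 0; first by move=> _; apply/eqP; rewrite -subr_eq0 -/f f00.
have fp : 0 < f by rewrite lt_neqAle eq_sym f00.
have : 0 < sin (f * pi).
  by apply: sin_gt0_pi; rewrite mulr_gt0 ?pi_gt0 //= -[ltRHS]mul1r ltr_pM2r ?pi_gt0.
by move=> /[swap] ->; rewrite ltxx.
Qed.

Section Ode.
Variables g g' : C -> C.
Hypothesis gd : forall z, normc z < 1 -> cara id (g : C^o -> C^o) z (g' z).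

Lemma expi_curve z0 (m : C) s : normc z0 < 1 ->
  cara jR (fun y => g (z0 * expi 1 y) * expi (- m) y) s
    ('i%C * (z0 * expi 1 s * g' (z0 * expi 1 s) - m * g (z0 * expi 1 s)) * expi (- m) s).
Proof.
move=> z1; have jx := @jR_cont R s.
have := caraM jx (cara_comp jx (gd (z := z0 * expi 1 s) _) (caraZ jx z0 (expi_cara 1 s))) (expi_cara (- m) s).
rewrite Normc.normcM normc_expi1 mulr1 => /(_ z1); congr cara.
by rewrite /=; ring.
Qed.

(** The radius is parametrized by [exp (- y ^ 2)] so that the curve stays in the disc for every real
    [y]; [exp (- y)] would leave it for negative [y]. The derivative again contains the factor
    [z g' - m g]. *)
Lemma expR_curve z0 (m : R) s : normc z0 < 1 -> 
  cara jR (fun y => g (z0 * (expR (- (y * y)))%:C) * (expR (m * (y * y)))%:C) s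
    ((- 2 * s)%:C * (z0 * (expR (- (s * s)))%:C * g' (z0 * (expR (- (s * s)))%:C) 
      - m%:C * g (z0 * (expR (- (s * s)))%:C)) * (expR (m * (s * s)))%:C).
Proof.
move=> z1; have jx := @jR_cont R s.
have he (c : R) : cara jR (fun y => (expR (c * (y * y)))%:C) s ((c * (2 * s) * expR (c * (s * s)))%:C).
  have h : cara jR (fun y => Complex (expR y) 0) (c * (s * s)) (Complex (expR (c * (s * s))) 0).
    exact: is_derive_cara.
  have := @cara_comp_real _ (fun y => c * (y * y)) (fun y => c * (y + s)) s _ h.
  rewrite (_ : _ * (c * (s + s))%:C = (c * (2 * s) * expR (c * (s * s)))%:C).
    apply; last by move=> y; ring.
    apply: (@cvgM R _ _ _ (fun=> c) (fun y => y + s)); first exact: cvg_cst.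
    by apply: (@cvgD R R _ _ _ id (fun=> s)); [exact: cvg_id|exact: cvg_cst].
  by rewrite -[Complex _ 0]/((expR (c * (s * s)))%:C) -rmorphM; congr _%:C; ring.
have zs1 : normc (z0 * (expR (-1 * (s * s)))%:C) < 1.
  rewrite Normc.normcM normcR ger0_norm ?expR_ge0 // (le_lt_trans _ z1) //.
  by rewrite ler_piMr ?normc_ge0 // -[leRHS]expR0 ler_expR mulN1r oppr_le0 -expr2 sqr_ge0.
have := caraM jx (cara_comp jx (gd zs1) (caraZ jx z0 (he (-1)))) (he m).
rewrite /= (_ : (fun y => _) = (fun y => g (z0 * (expR (- (y * y)))%:C) * (expR (m * (y * y)))%:C)); last first.
  by apply/funext => y /=; rewrite mulN1r.
congr cara; rewrite !mulN1r !rmorphM !rmorphN /= !rmorph_nat.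
by ring.
Qed.

End Ode.

End CircleOde.

(** * Holomorphic solutions of Euler equations on the disc are polynomials *)

Section EulerOde.
Variable R : realType.
Local Notation C := R[i].
Local Notation normc := (@Normc.normc R).
Local Notation jR := (@jR R).
Local Notation "x %:C" := (real_complex R x) : ring_scope.
Local Notation deriv_on_disc g g' :=
  (forall z : C, normc z < 1 -> cara id (g : C^o -> C^o) z (g' z)).

Lemma expi_2pi : expi 1 (pi *+ 2) = 1 :> C.
Proof. by rewrite /expi /= oppr0 mul0r expR0 !mul1r cos2pi sin2pi. Qed.

Lemma euler_rotation (g g' : C -> C) (l : C) :
  deriv_on_disc g g' -> (forall z, normc z < 1 -> z * g' z = l * g z) ->
  forall z0 s, normc z0 < 1 -> g (z0 * expi 1 s) * expi (- l) s = g z0.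
Proof.
move=> gd eg z0 s z1; pose F y := g (z0 * expi 1 y) * expi (- l) y.
suff FE : F s = F 0 by rewrite -/(F s) FE /F !expi0 !mulr1.
apply: (@cara_real_cst R F) => y; have := expi_curve gd l y z1.
by rewrite eg ?Normc.normcM ?normc_expi1 ?mulr1 // subrr mulr0 mul0r.
Qed.

Lemma euler_homogeneous (g g' : C -> C) (n : nat) :
  deriv_on_disc g g' -> (forall z, normc z < 1 -> z * g' z = n%:R * g z) ->
  forall z0 u, normc z0 < 1 -> u != 0 -> normc u <= 1 ->
  g (z0 * u) = u ^+ n * g z0.
Proof.
move=> gd eg z0 u z1 u0 u1; have [s us] := polar u.
pose r := normc u; rewrite -/r in us.
have r0 : 0 < r.
  by rewrite lt_neqAle normc_ge0 andbT eq_sym; apply: contra u0 => /eqP/Normc.eq0_normc ->.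
pose z2 := z0 * expi 1 s; have z21 : normc z2 < 1 by rewrite Normc.normcM normc_expi1 mulr1.
have hrot : g z2 = expi 1 s ^+ n * g z0.
  rewrite -(euler_rotation gd eg s z1) mulrCA [expi 1 s ^+ n * _]mulrC.
  by rewrite expi_pow mulr1.
(* Chosen so that [exp (- x ^ 2) = r]: the radial invariant [F] below is compared at [x] and at
   0. *)
pose x := Num.sqrt (- ln r).
have xx : x * x = - ln r.
  by rewrite -expr2 sqr_sqrtr // oppr_ge0 ln_le0.
have hrad : g (z2 * r%:C) * (expR (n%:R * - ln r))%:C = g z2.
  pose F y := g (z2 * (expR (- (y * y)))%:C) * (expR (n%:R * (y * y)))%:C.
  transitivity (F x); first by rewrite /F xx opprK lnK ?posrE.
  rewrite (_ : F x = F 0); last first.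
    apply: (@cara_real_cst R F) => y; have := expR_curve gd n%:R y z21.
    rewrite eg; first by rewrite rmorph_nat subrr mulr0 mul0r.
    rewrite Normc.normcM normcR ger0_norm ?expR_ge0 // (le_lt_trans _ z21) //.
    by rewrite ler_piMr ?normc_ge0 // -[leRHS]expR0 ler_expR oppr_le0 -expr2 sqr_ge0.
  by rewrite /F !mulr0 oppr0 expR0 !mulr1.
have er : (expR (n%:R * - ln r))%:C * r%:C ^+ n = 1.
  rewrite -rmorphXn -rmorphM -[X in _ * X ^+ n](lnK (x := r)) ?posrE //.
  by rewrite -expRM_natl -expRD mulrN addNr expR0 rmorph1.
rewrite us (_ : z0 * _ = z2 * r%:C); last by rewrite /z2 -!mulrA [_ * r%:C]mulrC.
rewrite (_ : _ * g z0 = r%:C ^+ n * g z2); last by rewrite hrot exprMn mulrA.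
by rewrite -hrad mulrCA [r%:C ^+ n * _]mulrC er mulr1.
Qed.

(** Of two nonzero points of the disc, one is the other times a factor of modulus at most 1, so
    homogeneity carries the value at the sample point 1/2 to every nonzero [z]. At 0 the equation
    itself decides when [n > 0], and continuity when [n = 0]. *)
Lemma euler_monomial (g g' : C -> C) (n : nat) :
  deriv_on_disc g g' -> (forall z, normc z < 1 -> z * g' z = n%:R * g z) ->
  exists c, forall z, normc z < 1 -> g z = c * z ^+ n.
Proof.
move=> gd eg; pose h : C := (2^-1)%:C.
have h0 : h != 0 by rewrite fmorph_eq0 invr_eq0.
have h1 : normc h < 1 by rewrite normcR ger0_norm ?invr_ge0 // invf_lt1 // ltr1n.
exists (g h / h ^+ n).
have main z : z != 0 -> normc z < 1 -> g z = g h / h ^+ n * z ^+ n.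
  move=> z0 z1; have zh0 : z / h != 0 by rewrite mulf_neq0 // invr_neq0.
  have [zh|zh] := leP (normc (z / h)) 1.
    have := euler_homogeneous gd eg h1 zh0 zh; rewrite mulrC divfK // => ->.
    by rewrite expr_div_n; field; rewrite expf_neq0.
  have hz0 : h / z != 0 by rewrite mulf_neq0 // invr_neq0.
  have hz : normc (h / z) <= 1.
    by rewrite -[h / z]invrK invf_div Normc.normcV invf_le1 ?ltW // (lt_trans _ zh).
  have := euler_homogeneous gd eg z1 hz0 hz; rewrite mulrC divfK // => ->.
  by rewrite expr_div_n; field; rewrite !expf_neq0.
move=> z z1; have [->|] := eqVneq z 0; last by move=> z0; exact: main.
case: n eg main => [|n] eg main; last first.
  rewrite expr0n mulr0; have := eg 0; rewrite Normc.normc0 ltr01 mul0r => /(_ isT)/esym/eqP.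
  by rewrite mulf_eq0 pnatr_eq0 => /eqP.
have {}main y : y != 0 -> normc y < 1 -> g y = g h.
  by move=> y0 y1; rewrite main // !expr0 mulr1 divr1.
rewrite !expr0 mulr1 divr1.
apply/eqP; rewrite -subr_eq0; apply/negPn/negP => gne.
pose e := normc (g 0 - g h).
have e0 : 0 < e.
  by rewrite lt_neqAle normc_ge0 andbT eq_sym; apply: contra gne => /eqP/Normc.eq0_normc ->.
have g0 : cara id (g : C^o -> C^o) (0 : C) (g' 0) by apply: gd; rewrite Normc.normc0.
have /cvgCP/(_ _ e0) hc := cara_cont (@cvg_id C^o (nbhs (0 : C^o))) g0.
have /cvgCP/(_ _ ltr01) h01 := @cvg_id C^o (nbhs (0 : C^o)).
have h3 : (0 : C^o)^' (fun y : C^o => y != 0 /\ (normc (g y - g 0) < e /\ normc (y - 0) < 1)).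
  by apply: (@filterS _ (nbhs (0 : C^o)) _ _ _ _ (filterI hc h01)) => y hy y0.
have [y [y0 [gy y1]]] := filter_ex h3; rewrite subr0 in y1.
by move: gy; rewrite main // -normcN opprB ltxx.
Qed.

(** A full turn multiplies a nonzero value by [exp (- 2 i pi l)], which must be 1. Its modulus makes
    [l] real, its real part makes [l] an integer, and negative integers leave only the zero
    solution. *)
Lemma euler_eigen (g g' : C -> C) (l : C) :
  deriv_on_disc g g' -> (forall z, normc z < 1 -> z * g' z = l * g z) ->
  exists q : {poly C}, forall z, normc z < 1 -> g z = q.[z].
Proof.
move=> gd eg.
have [[z0 z1 gz0]|gz0] := pselect (exists2 z0, normc z0 < 1 & g z0 != 0); last first.
  exists 0 => z z1; rewrite horner0; apply/eqP/negPn/negP => gz; by apply: gz0; exists z.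
have /(mulfI gz0) : g z0 * expi (- l) (pi *+ 2) = g z0 * 1.
  by rewrite mulr1 -[RHS](euler_rotation gd eg (pi *+ 2) z1) expi_2pi mulr1.
move=> e2; have p2 : (pi : R) *+ 2 != 0 by rewrite mulrn_eq0 /= gt_eqF // pi_gt0.
have Il : complex.Im l = 0.
  have := normc_expi (- l) (pi *+ 2); rewrite e2 Normc.normc1 -[X in X = _ -> _]expR0 => /expR_inj.
  case: (l) => a b /=; rewrite opprK => /esym/eqP; rewrite mulf_eq0 (negbTE p2) orbF => /eqP //.
have [m lm] : exists m : int, l = m%:~R.
  have [|m hm] := @cos_eq1_int R (complex.Re l).
    have := congr1 (@complex.Re R) e2; case: l Il {gd eg e2} => a b /= ->.
    by rewrite oppr0 oppr0 mul0r expR0 mul1r mulNr cosN.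
  exists m; rewrite -(rmorph_int (real_complex R)) -hm; case: l Il hm {gd eg e2} => a b /= -> //.
case: m lm => n lm.
  have [|c hc] := @euler_monomial g g' n gd; first by move=> z /eg ->; rewrite lm.
  by exists (c *: 'X^n) => z /hc ->; rewrite hornerZ hornerXn.
(* Here [l = - n.+1], so [g1] solves the equation with exponent 0; it is constant and vanishes at
   0. *)
exfalso; pose g1 z := z ^+ n.+1 * g z.
pose g1' z := n.+1%:R * z ^+ n * g z + z ^+ n.+1 * g' z.
have [||c hc] := @euler_monomial g1 g1' 0.
- move=> z hz; have iz : (fun x : C^o => x) @ (z : C^o) --> (z : C^o) by exact: cvg_id.
  have hX := @cara_horner R C^o id z iz 'X^(n.+1).
  have -> : g1 = (fun y => ('X^(n.+1) : {poly C}).[y] * g y) by apply/funext => y; rewrite hornerXn.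
  have -> : g1' z = ('X^(n.+1) : {poly C})^`().[z] * g z + ('X^(n.+1) : {poly C}).[z] * g' z.
    by rewrite derivXn hornerMn !hornerXn /g1' mulr_natl.
  exact: (caraM (j := id) iz hX (gd z hz)).
- move=> z hz; rewrite /g1' mul0r.
  transitivity (z ^+ n.+1 * (n.+1%:R * g z + z * g' z)); first by rewrite exprS; ring.
  by rewrite eg // lm NegzE mulrNz -pmulrn mulNr addrN mulr0.
have c0 : c = 0.
  by have := hc 0; rewrite Normc.normc0 ltr01 expr0 mulr1 => /(_ isT) <-; rewrite /g1 expr0n mul0r.
have [z00|z00] := eqVneq z0 0.
  have := eg 0; rewrite Normc.normc0 ltr01 mul0r => /(_ isT)/esym/eqP.
  by rewrite z00 in gz0; rewrite mulf_eq0 (negbTE gz0) orbF lm NegzE mulrNz oppr_eq0 -pmulrn pnatr_eq0 //.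
have := hc z0 z1; rewrite c0 mul0r /g1 => /eqP; rewrite mulf_eq0 expf_eq0 /= (negbTE z00) => /eqP h.
by rewrite h eqxx in gz0.
Qed.

(** A solution would behave like [c z ^ n log z], which is not single-valued: on the circle of
    radius 1/2 the quantity [F] is constant, while a full turn changes its last term by a nonzero
    multiple of [c]. *)
Lemma euler_no_resonance (g g' : C -> C) (n : nat) (c : C) :
  deriv_on_disc g g' -> (forall z, normc z < 1 -> z * g' z - n%:R * g z = c * z ^+ n) -> c = 0.
Proof.
move=> gd eg; pose h : C := (2^-1)%:C.
have h0 : h != 0 by rewrite fmorph_eq0 invr_eq0.
have h1 : normc h < 1 by rewrite normcR ger0_norm ?invr_ge0 // invf_lt1 // ltr1n.
pose F y : C := g (h * expi 1 y) * expi (- n%:R) y + (- ('i%C * c * h ^+ n)) * y%:C.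
have : F (pi *+ 2) = F 0.
  apply: (@cara_real_cst R F) => y; have jx := @jR_cont R y.
  have := caraD (expi_curve gd n%:R y h1) (caraZ jx (- ('i%C * c * h ^+ n)) (cara_id jR y)).
  rewrite eg ?Normc.normcM ?normc_expi1 ?mulr1 //; congr cara.
  rewrite exprMn; have := expi_pow n y; set E := expi (- _) y; set G := _ ^+ n => EG.
  have -> : 'i%C * (c * (h ^+ n * G)) * E = 'i%C * c * h ^+ n * (E * G) by ring.
  by rewrite EG mulr1 addrN.
have en : expi (- n%:R) (pi *+ 2) = 1 :> C by have := expi_pow n (pi *+ 2 : R); rewrite expi_2pi expr1n mulr1.
rewrite /F expi_2pi en !expi0 !mulr1 rmorph0 mulr0 addr0 => /eqP.
have hpi : (pi *+ 2 : R)%:C != 0 by rewrite fmorph_eq0 mulrn_eq0 /= gt_eqF // pi_gt0.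
have hi : ('i%C : C) != 0 by rewrite eq_complex /= oner_eq0 andbF.
rewrite -subr_eq0 addrAC subrr add0r mulf_eq0 oppr_eq0 (negbTE hpi) orbF !mulf_eq0.
by rewrite (negbTE hi) expf_eq0 (negbTE h0) andbF orbF => /eqP.
Qed.

Lemma euler_poly (g g' : C -> C) (l : C) (P : {poly C}) :
  deriv_on_disc g g' -> (forall z, normc z < 1 -> z * g' z - l * g z = P.[z]) ->
  exists q : {poly C}, forall z, normc z < 1 -> g z = q.[z].
Proof.
(* A particular solution, coefficient by coefficient. If [l] is a natural number [n], division by
   zero makes coefficient [n] equal to 0, which leaves the resonant term [P_n z ^ n] over. *)
move=> gd eg; pose q0 := \poly_(i < size P) (P`_i / (i%:R - l)).
pose g1 z := g z + (- q0).[z]; pose g1' z := g' z + (- q0)^`().[z].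
have g1d : deriv_on_disc g1 g1'.
  move=> z hz; have iz : (fun x : C^o => x) @ (z : C^o) --> (z : C^o) by exact: cvg_id.
  exact: caraD (gd z hz) (@cara_horner R C^o id z iz (- q0)).
suff [q hq] : exists q : {poly C}, forall z, normc z < 1 -> g1 z = q.[z].
  by exists (q + q0) => z /hq; rewrite /g1 hornerD hornerN => <-; rewrite subrK.
have eq0 : 'X * q0^`() - l *: q0 = P - (if [pick n : 'I_(size P) | l == (n : nat)%:R] is Some n then P`_n *: 'X^n else 0).
  apply/polyP => i; transitivity ((i%:R - l) * q0`_i).
    rewrite coefB coefXM coefZ coef_deriv mulrBl; congr (_ - _).
    by case: i => [|i]; rewrite ?mul0r //= mulr_natl.
  rewrite coefB coef_poly; case: pickP => [n /eqP ln|hl].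
    rewrite coefZ coefXn ln; have [->|ne] := eqVneq i n; first by rewrite subrr mul0r mulr1 subrr.
    have d0 : i%:R - n%:R != 0 :> C by rewrite subr_eq0 eqr_nat.
    rewrite mulr0 subr0; case: ltnP => isz; last by rewrite mulr0 nth_default.
    by rewrite mulrC divfK.
  rewrite coef0 subr0; case: ltnP => isz; last by rewrite mulr0 nth_default.
  by rewrite mulrC divfK // subr_eq0 eq_sym; apply/negbT; exact: (hl (Ordinal isz)).
have eg1 z : normc z < 1 -> z * g1' z - l * g1 z =
    (if [pick n : 'I_(size P) | l == (n : nat)%:R] is Some n then P`_n *: 'X^n else 0).[z].
  move=> z1; have := congr1 (fun p : {poly C} => p.[z]) eq0.
  rewrite !hornerD !hornerN hornerM hornerX hornerZ -eg //; set X := (if _ is Some _ then _ else _).[z] => e.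
  rewrite /g1 /g1' derivN !hornerN -[X](subKr (z * g' z - l * g z)) -e.
  by ring.
move: eg1; case: pickP => [n /eqP ln|_] eg1.
  have c0 : P`_n = 0.
    apply: (@euler_no_resonance g1 g1' n _ g1d) => z z1.
    by rewrite -ln eg1 // hornerZ hornerXn.
  apply: (@euler_eigen g1 g1' l g1d) => z z1; apply/eqP; rewrite -subr_eq0 eg1 //.
  by rewrite c0 scale0r horner0.
apply: (@euler_eigen g1 g1' l g1d) => z z1; apply/eqP; rewrite -subr_eq0 eg1 //.
by rewrite horner0.
Qed.

(** The roots of the characteristic polynomial are peeled off one at a time. With [g = v phi], the
    expression [z g' - l g] is the combination attached to the row [v (A - l)], a polynomial by
    induction, so [euler_poly] applies. Cayley-Hamilton starts the induction, with no
    diagonalization of [A]. *)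
Lemma euler_system (n : nat) (phi phi' : 'I_n -> C -> C) (A : 'M[C]_n) (v : 'rV[C]_n) :
  (forall i, deriv_on_disc (phi i) (phi' i)) ->
  (forall i z, normc z < 1 -> z * phi' i z = \sum_j A i j * phi j z) ->
  exists q : {poly C}, forall z, normc z < 1 -> \sum_i v 0 i * phi i z = q.[z].
Proof.
case: n phi phi' A v => [|n] phi phi' A v phid ephi.
  by exists 0 => z _; rewrite big_ord0 horner0.
have [rs hrs] := closed_field_poly_normal (char_poly A).
have : v *m horner_mx A (\prod_(z <- rs) ('X - z%:P)) = 0.
  rewrite (monicP (char_poly_monic A)) scale1r in hrs.
  by rewrite -hrs Cayley_Hamilton mulmx0.
elim: rs {hrs} v => [|l rs IHrs] v.
  rewrite big_nil rmorph1 mulmx1 => ->; exists 0 => z _.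
  by rewrite horner0 big1 // => i _; rewrite mxE mul0r.
rewrite big_cons rmorphM /= rmorphB /= horner_mx_X horner_mx_C mulmxA => /IHrs[P hP].
pose g z := \sum_i v 0 i * phi i z; pose g' z := \sum_i v 0 i * phi' i z.
apply: (@euler_poly g g' l P) => [z z1|z z1].
  apply: (@cara_sum R C^o id z _ (fun i y => v 0 i * phi i y)) => i.
  by apply: (@caraZ R C^o id z); [exact: cvg_id|exact: phid].
rewrite -hP // /g /g' !mulr_sumr -sumrB.
under eq_bigr => i _ do rewrite mulrCA ephi // mulr_sumr.
rewrite sumrB exchange_big /= -sumrB; apply: eq_bigr => j _.
under eq_bigr => i _ do rewrite mulrA.
rewrite -mulr_suml mulrA -mulrBl mxE; congr (_ * _).
under [in RHS]eq_bigr => i _ do rewrite !mxE mulrBr.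
rewrite sumrB; congr (_ - _); rewrite (bigD1 j) //= eqxx mulr1n big1 ?addr0 1?mulrC // => i ij.
by rewrite (negbTE ij) mulr0n mulr0.
Qed.

End EulerOde.

(** * Functions whose rotations span a finite dimensional space *)

Section FiniteRank.
Variable R : realType.
Local Notation C := R[i].
Local Notation normc := (@Normc.normc R).
Local Notation deriv_on_disc g g' :=
  (forall z : C, normc z < 1 -> cara id (g : C^o -> C^o) z (g' z)).

(** Bordering a maximal nonzero minor by one more row and column gives determinant 0, which
    expresses [f (b z)] through the functions [f (a_i z)] with coefficients built from the values
    [f (b z_j)]. These are differentiable in [b]; differentiating at [b = 1] along the circle yields
    an Euler system for the [f (a_i z)]. *)
Lemma rotations_finite_rank_horner (f f' : C -> C) (n : nat) (e : 'I_n -> C -> C) :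
  deriv_on_disc f f' ->
  (forall a, normc a = 1 -> exists c : 'I_n -> C,
    forall z, normc z < 1 -> f (a * z) = \sum_i c i * e i z) ->
  exists q : {poly C}, forall z, normc z < 1 -> f z = q.[z].
Proof.
move=> fd fe.
pose mx r (a zs : 'I_r -> C) : 'M[C]_r := \matrix_(i, j) f (a i * zs j).
pose good r := exists a zs : 'I_r -> C, [/\ forall i, normc (a i) = 1,
  forall i, normc (zs i) < 1 & \det (mx r a zs) != 0].
(* The matrix of values factors through a space of dimension [n], which bounds its rank. *)
have good_le r : `[< good r >] -> (r <= n)%N.
  move=> /asboolP[a [zs [a1 zs1 d0]]].
  have /boolp.choice[c hc] i := fe (a i) (a1 i).
  have -> : r = \rank (mx r a zs) by rewrite mxrank_unit // unitmxE unitfE.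
  have -> : mx r a zs = \matrix_(i, k) c i k *m \matrix_(k, j) e k (zs j).
    by apply/matrixP => i j; rewrite !mxE hc //; apply: eq_bigr => k _; rewrite !mxE.
  exact: leq_trans (mxrankM_maxl _ _) (rank_leq_col _).
have good0 : exists r, `[< good r >].
  exists 0%N; apply/asboolP; exists (fun=> 0), (fun=> 0); split=> [[]//|[]//|].
  by rewrite det_mx00 oner_eq0.
case: (ex_maxnP good0 good_le) => r /asboolP[a [zs [a1 zs1 d0]]] rmax.
pose M := mx r a zs; pose Mi := invmx M.
have Mu : M \in unitmx by rewrite unitmxE unitfE.
pose w b : 'rV[C]_r := \row_j f (b * zs j).
have expand b z : normc b = 1 -> normc z < 1 ->
    f (b * z) = \sum_i (w b *m Mi) 0 i * f (a i * z).
  move=> b1 z1; pose u : 'cV[C]_r := \col_i f (a i * z).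
  pose s : 'M[C]_1 := (f (b * z))%:M.
  pose a' (i : 'I_(r + 1)) := if fintype.split i is inl i then a i else b.
  pose zs' (i : 'I_(r + 1)) := if fintype.split i is inl i then zs i else z.
  have bm : mx (r + 1)%N a' zs' = block_mx M u (w b) s.
    have sl (k : 'I_r) : fintype.split (lshift 1 k) = inl k by exact: (@unsplitK r 1 (inl k)).
    have sr (k : 'I_1) : fintype.split (rshift r k) = inr k by exact: (@unsplitK r 1 (inr k)).
    apply/matrixP => i j; rewrite -(@fintype.splitK r 1 i) -(@fintype.splitK r 1 j).
    case: (fintype.split i) => i'; case: (fintype.split j) => j' /=;
      rewrite ?block_mxEul ?block_mxEur ?block_mxEdl ?block_mxEdr !mxE /a' /zs' ?sl ?sr //.
    by rewrite !ord1 eqxx mulr1n.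
  have det0 : \det (mx (r + 1)%N a' zs') = 0.
    apply/eqP/negPn/negP => dn0.
    have : good (r + 1)%N.
      by exists a', zs'; split=> // k; rewrite /a' /zs'; case: (fintype.split k).
    by move=> /asboolP/rmax; rewrite addn1 ltnn.
  (* Block elimination: the determinant is [\det M] times the Schur complement, which therefore
     vanishes and is the wanted expansion. *)
  have fac : block_mx M u (w b) s = block_mx 1%:M 0 (w b *m Mi) 1%:M *m block_mx M u 0 (s - w b *m Mi *m u).
    by rewrite mulmx_block !mul1mx !mul0mx !addr0 mulmxKV // addrC subrK.
  move: det0; rewrite bm fac det_mulmx det_lblock det_ublock !det1 !mul1r => /eqP.
  rewrite mulf_eq0 (negbTE d0) /= det_mx11 !mxE eqxx mulr1n subr_eq0 => /eqP ->.
  by apply: eq_bigr => i _; rewrite !mxE.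
(* The derivative at [s = 0] of the coefficients [w (expi 1 s) *m Mi], divided by [i]. *)
pose v (i : 'I_r) := \sum_j f' (zs j) * zs j * Mi j i.
have euler z : normc z < 1 -> z * f' z = \sum_i v i * f (a i * z).
  move=> z1; have jx := @jR_cont R 0.
  have curve y : normc y < 1 -> cara (@jR R) (fun s => f (expi 1 s * y)) 0 (f' y * (y * 'i%C)).
    move=> y1; have := caraM jx (expi_cara 1 0) (cara_cst _ _ y).
    rewrite expi0 mulr0 addr0 !mulr1 => h.
    have := cara_comp jx (fd (expi 1 0 * y) _) h; rewrite expi0 mul1r => /(_ y1).
    by rewrite [y * _]mulrC.
  have hi : ('i%C : C) != 0 by rewrite eq_complex /= oner_eq0 andbF.
  apply: (mulIf hi); rewrite [z * _]mulrC -mulrA.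
  apply: (cara_real_unique (curve z z1)).
  have -> : (fun s => f (expi 1 s * z)) =
      (fun s => \sum_i \sum_j Mi j i * f (a i * z) * f (expi 1 s * zs j)).
    apply/funext => s; rewrite expand ?normc_expi1 //; apply: eq_bigr => i _.
    by rewrite mxE mulr_suml; apply: eq_bigr => j _; rewrite !mxE; ring.
  have -> : (\sum_i v i * f (a i * z)) * 'i%C =
      \sum_i \sum_j Mi j i * f (a i * z) * (f' (zs j) * (zs j * 'i%C)).
    rewrite mulr_suml; apply: eq_bigr => i _; rewrite /v !mulr_suml; apply: eq_bigr => j _.
    by ring.
  apply: cara_sum => i; apply: cara_sum => j; apply: (caraZ jx); exact: curve.
pose phi i z := f (a i * z); pose phi' i z := f' (a i * z) * a i.
(* The Euler relation at [a i * z] involves the rotations by [a k * a i], which [expand] rewrites in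
   terms of the chosen ones. *)
pose A : 'M[C]_r := \matrix_(i, j) \sum_k v k * (w (a k * a i) *m Mi) 0 j.
have az i z : normc z < 1 -> normc (a i * z) < 1 by rewrite Normc.normcM a1 mul1r.
have [||q hq] := @euler_system R r phi phi' A (w 1 *m Mi).
- move=> i z z1; have iz : (fun x : C^o => x) @ (z : C^o) --> (z : C^o) by exact: cvg_id.
  apply: (@cara_comp R C^o id z iz f (fun y => a i * y)); first exact: fd (az i z z1).
  by rewrite -[X in cara _ _ _ X]mulr1; apply: caraZ; [exact: iz|exact: cara_id].
- move=> i z z1; rewrite /phi' mulrCA [z * _]mulrC [LHS]mulrC [a i * z * _](euler _ (az i z z1)).
  under eq_bigr => k _ do rewrite mulrA expand ?Normc.normcM ?a1 ?mulr1 // mulr_sumr.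
  rewrite exchange_big /=; apply: eq_bigr => j _; rewrite mxE mulr_suml.
  by apply: eq_bigr => k _; rewrite mulrA.
exists q => z z1; rewrite -hq // -[z in LHS]mul1r expand ?Normc.normc1 //.
Qed.

End FiniteRank.

(** * Upper and lower bounds for the Bergman norm *)

Section BergmanNorm.
Variable R : realType.
Local Notation C := R[i].
Local Notation normc := (@Normc.normc R).
Local Notation mu2 := (@lebesgue_measure R \x @lebesgue_measure R)%E.
Local Notation disc := [set p : R * R | p.1 ^+ 2 + p.2 ^+ 2 < 1].

(** The integral of a non-negative function is a supremum over simple functions below it, so the
    comparison extends to functions not known to be measurable, such as those met when testing a
    candidate derivative. *)
Lemma ge0_integral_mono d (T : measurableType d) (mu : {measure set T -> \bar R})
    (D E : set T) (f g : T -> \bar R) :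
  D `<=` E -> (forall x, D x -> (0 <= f x)%E) -> (forall x, E x -> (0 <= g x)%E) ->
  (forall x, D x -> (f x <= g x)%E) ->
  (\int[mu]_(x in D) f x <= \int[mu]_(x in E) g x)%E.
Proof.
move=> DE f0 g0 fg; rewrite !ge0_integralE //; apply: le_ereal_sup => _ [h hf <-].
exists h => // x; apply: le_trans (hf x) _; rewrite /patch.
case: ifPn => [xD|_]; last by case: ifPn => //; rewrite inE => /g0.
by move: xD; rewrite inE => Dx; rewrite mem_set ?fg //; exact: DE.
Qed.

Lemma disc_normc (p : R * R) : disc p <-> normc (Complex p.1 p.2) < 1.
Proof.
suff -> : (normc (Complex p.1 p.2) < 1) = (p.1 ^+ 2 + p.2 ^+ 2 < 1) by [].
by rewrite /= -[X in _ < X = _]sqrtr1 ltr_sqrt ?ltr01.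
Qed.

Lemma box_measure (a b : R) (l : R) : 0 <= l ->
  mu2 (`[a, (a + l)] `*` `[b, (b + l)]) = (l ^+ 2)%:E.
Proof.
move=> l0; rewrite product_measure1E //= !lebesgue_measure_itv /= !lte_fin !ltrDl.
case: (ltgtP 0 l) l0 => // [l1|<-] _; last by rewrite mul0e expr0n.
by rewrite -!EFinD -EFinM ![_ + l]addrC !addrK expr2.
Qed.

Lemma bergman_weight_le1 (k : nat) (p : R * R) : disc p ->
  0 <= (1 - p.1 ^+ 2 - p.2 ^+ 2) ^+ k <= 1.
Proof.
move=> /= hp; have h0 : 0 <= 1 - p.1 ^+ 2 - p.2 ^+ 2 by rewrite -addrA -opprD subr_ge0 ltW.
rewrite exprn_ge0 //= exprn_ile1 // -addrA -opprD lerBlDr lerDl.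
by rewrite addr_ge0 // sqr_ge0.
Qed.

Lemma bergman_sqnorm_le (k : nat) (f : C -> C) (c : R) :
  (forall z, normc z < 1 -> normc (f z) <= c) ->
  (bergman_sqnorm (k%:Z + 2) f <= (c ^+ 2 * 2 ^+ 2)%:E)%E.
Proof.
move=> fc; rewrite /bergman_sqnorm addrK.
have c0 : 0 <= c.
  by apply: le_trans (fc 0 _); [exact: normc_ge0|rewrite Normc.normc0].
pose B := (`[-1, (-1 + 2)] `*` `[-1, (-1 + 2)] : set (R * R)).
apply: (@le_trans _ _ (\int[mu2]_(p in B) (c ^+ 2)%:E)%E).
  apply: ge0_integral_mono.
  - move=> p /= hp; rewrite /B; have -> : -1 + 2 = 1 :> R by rewrite addrC addrK.
    by split; rewrite /= in_itv /= -ler_norml -(@ler_pXn2r _ 2) ?nnegrE // expr1n real_normK ?num_real //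
       (le_trans _ (ltW hp)) // ?lerDl ?lerDr sqr_ge0.
  - move=> p hp; have /andP[h0 _] := bergman_weight_le1 k hp.
    by rewrite lee_fin mulr_ge0 // exprn_ge0 // normc_ge0.
  - by move=> p _; rewrite lee_fin sqr_ge0.
  - move=> p hp; have /andP[h0 h1] := bergman_weight_le1 k hp.
    rewrite lee_fin -[leRHS]mulr1; apply: ler_pM => //; first by rewrite exprn_ge0 // normc_ge0.
    by rewrite ler_pXn2r ?nnegrE ?normc_ge0 //; apply: fc; apply/disc_normc.
by rewrite integral_cst; [rewrite [X in (_ * X)%E](_ : _ = (2 ^+ 2)%:E) -?EFinM //; exact: box_measure|apply: measurableX; exact: measurable_itv].
Qed.

(** The integral is restricted to a small square with corner [z0], inside the ball of radius [r] and
    inside [|z| <= rho < 1], where the weight is at least [(1 - rho ^ 2) ^ k]. The constant [K] does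
    not depend on [f], so convergence in norm controls values near [z0]. *)
Lemma bergman_sqnorm_ge (k : nat) (z0 : C) (r : R) : normc z0 < 1 -> 0 < r ->
  exists2 K : R, 0 < K & forall (f : C -> C) (e : R), 0 <= e ->
    (forall z, normc z < 1 -> normc (z - z0) < r -> e <= normc (f z)) ->
    ((e ^+ 2 * K)%:E <= bergman_sqnorm (k%:Z + 2) f)%E.
Proof.
move=> z01 r0; pose rho := (normc z0 + 1) / 2.
have rho1 : rho < 1 by rewrite ltr_pdivrMr // mul1r ltrD2r.
have rho0 : 0 <= rho by rewrite divr_ge0 // addr_ge0 // normc_ge0.
have d0 : 0 < rho - normc z0 by rewrite subr_gt0 ltr_pdivlMr // mulr2n mulrDr mulr1 ltrD2l.
(* A third suffices because the distance to the corner is at most [l + l]. *)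
pose l := Num.min r (rho - normc z0) / 3.
have m0 : 0 < Num.min r (rho - normc z0) by rewrite lt_min r0.
have l0 : 0 < l by rewrite divr_gt0.
have l3 : l + l < Num.min r (rho - normc z0).
  by rewrite -mulr2n -mulr_natr /l mulrAC ltr_pdivrMr // ltr_pM2l // ltr_nat.
exists ((1 - rho ^+ 2) ^+ k * l ^+ 2).
  by rewrite mulr_gt0 ?exprn_gt0 // subr_gt0 expr_lt1.
move=> f e e0 fe; rewrite /bergman_sqnorm addrK.
pose B := (`[complex.Re z0, (complex.Re z0 + l)] `*` `[complex.Im z0, (complex.Im z0 + l)] : set (R * R)).
have hB p : B p -> normc (Complex p.1 p.2 - z0) < Num.min r (rho - normc z0).
  move=> [] /=; rewrite !in_itv /= => /andP[a1 a2] /andP[b1 b2].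
  apply: le_lt_trans l3; apply: le_trans (normc_le_ReIm _) _.
  by move: a1 a2 b1 b2; case: (z0) => x y /= a1 a2 b1 b2;
    rewrite !ger0_norm ?subr_ge0 // lerD // lerBlDl.
have hBrho p : B p -> normc (Complex p.1 p.2) <= rho.
  move=> /hB; rewrite lt_min => /andP[_ h].
  rewrite -[Complex _ _](subrK z0); apply: le_trans (le_normcD _ _) _.
  by rewrite -lerBrDr ltW.
have hBdisc p : B p -> disc p by move=> /hBrho h; apply/disc_normc; exact: le_lt_trans h rho1.
apply: (@le_trans _ _ (\int[mu2]_(p in B) (e ^+ 2 * (1 - rho ^+ 2) ^+ k)%:E)%E).
  by rewrite integral_cst; [rewrite [X in (_ * X)%E](_ : _ = (l ^+ 2)%:E) -?EFinM ?mulrA //; exact: box_measure (ltW l0)|apply: measurableX; exact: measurable_itv].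
have w0 : 0 <= 1 - rho ^+ 2 by rewrite subr_ge0 expr_le1 // ltW.
apply: ge0_integral_mono => [//|p _|p hp|p hp].
- by rewrite lee_fin mulr_ge0 // ?exprn_ge0.
- have /andP[h0 _] := bergman_weight_le1 k hp.
  by rewrite lee_fin mulr_ge0 // exprn_ge0 // normc_ge0.
rewrite lee_fin; apply: ler_pM; rewrite ?exprn_ge0 //.
  rewrite ler_pXn2r ?nnegrE ?normc_ge0 //; apply: fe; first by apply/disc_normc; exact: hBdisc.
  by have := hB _ hp; rewrite lt_min => /andP[].
have wp : 1 - rho ^+ 2 <= 1 - p.1 ^+ 2 - p.2 ^+ 2.
  rewrite -[leRHS]addrA -opprD lerD2l lerN2 -(@sqr_sqrtr _ (p.1 ^+ 2 + _)) ?addr_ge0 ?sqr_ge0 //.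
  by rewrite ler_pXn2r ?nnegrE ?sqrtr_ge0 //; exact: hBrho.
by apply: lerXn2r => //; rewrite nnegrE (le_trans w0).
Qed.

End BergmanNorm.

(** * The matrix exponential to first order *)

Section ExpSeries.
Variable R : realType.
Local Notation C := R[i].
Local Notation "x %:C" := (real_complex R x) : ring_scope.

Section RealSeries.
Variables (a : nat -> R) (M : R).
Hypothesis aM : forall m, `|a m| <= M ^+ m.
Let M0 : 0 <= M. Proof. by have := aM 1; rewrite expr1; apply: le_trans. Qed.
Definition egf s (m : nat) := m`!%:R^-1 * (s ^+ m * a m).

Lemma egf_le s m : `|egf s m| <= exp_coeff (`|s| * M) m.
Proof.
rewrite /egf /exp_coeff /= normrM normfV normr_nat mulrC ler_wpM2r ?invr_ge0 //.
by rewrite normrM normrX exprMn ler_wpM2l ?exprn_ge0.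
Qed.

Lemma egf_cvg s : cvgn (series (egf s)).
Proof.
apply: normed_cvg; apply: (@series_le_cvg _ _ (exp_coeff (`|s| * M))).
- by move=> m /=.
- by move=> m; rewrite exp_coeff_ge0 // mulr_ge0.
- by move=> m; exact: egf_le.
- exact: is_cvg_series_exp_coeff.
Qed.

(** For [|s| <= 1] each term of index at least 2 is bounded by [s ^ 2] times the corresponding term
    of the series of [exp M]. *)
Lemma egf_taylor s : `|s| <= 1 ->
  `|limn (series (egf s)) - a 0%N - s * a 1%N| <= expR M * s ^+ 2.
Proof.
move=> s1.
have h : (fun n => series (egf s) n - a 0%N - s * a 1%N) @ \oo -->
    limn (series (egf s)) - a 0%N - s * a 1%N.
  apply: cvgB; last exact: cvg_cst.
  by apply: cvgB; [exact: egf_cvg|exact: cvg_cst].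
move: h => /cvg_norm h; rewrite -(cvg_lim _ h) //.
apply: limr_le; first by apply/cvg_ex; eexists; exact: h.
exists 2%N => // n /= n2.
have -> : series (egf s) n - a 0%N - s * a 1%N = \sum_(2 <= m < n) egf s m.
  rewrite /series /= (big_cat_nat (n := 2)) //= !big_nat_recl // big_geq // addr0.
  have -> : egf s 0 = a 0%N by rewrite /egf fact0 invr1 expr0 !mul1r.
  have -> : egf s 1 = s * a 1%N by rewrite /egf invr1 expr1 mul1r.
  by ring.
apply: le_trans (ler_norm_sum _ _ _) _.
apply: (@le_trans _ _ (\sum_(2 <= m < n) s ^+ 2 * exp_coeff M m)).
  rewrite big_nat [leRHS]big_nat; apply: ler_sum => m /andP[m2 _].
  apply: le_trans (egf_le s m) _; rewrite /exp_coeff /= exprMn -mulrA.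
  rewrite ler_wpM2r ?mulr_ge0 ?exprn_ge0 ?invr_ge0 //.
  rewrite -[s ^+ 2]real_normK ?num_real //.
  exact: ler_wiXn2l.
rewrite -mulr_sumr mulrC ler_wpM2r ?sqr_ge0 //.
apply: (@le_trans _ _ (series (exp_coeff M) n)).
  rewrite /series /= [leRHS](big_cat_nat (n := 2)) //= lerDr.
  by apply: sumr_ge0 => i _; exact: exp_coeff_ge0.
rewrite /expR; apply: nondecreasing_cvgn_le; last exact: is_cvg_series_exp_coeff.
by apply: nondecreasing_series => i _ _; exact: exp_coeff_ge0.
Qed.

End RealSeries.

Lemma series_real_complex (u : nat -> R) : cvgn (series u) ->
  series (fun m => (u m)%:C : C^o) @ \oo --> ((limn (series u))%:C : C^o).
Proof.
move=> h; have -> : series (fun m => (u m)%:C : C^o) = (fun n => Complex (series u n) 0 : C^o).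
  by apply/funext => n; rewrite /series /= -[RHS]/((series u n)%:C) rmorph_sum.
by apply: (@cvgC_ReIm _ _ _ _ (series u) (fun=> 0)); [exact: h|exact: cvg_cst].
Qed.

Section ExpMatrix.
Variables (X : 'M[C]_2) (d : R).
Hypothesis X2 : X *m X = (d%:C)%:M.

(* [X ^+ m = a m + b m X] for [(a, b) = (sqpow m.+1, sqpow m)]; [sqpow] is the
   coefficient of [X]. *)
Fixpoint sqpow (m : nat) : R := match m with 0 => 0 | 1 => 1 | m'.+2 => d * sqpow m' end.

Definition sqpow0 (m : nat) : R := if m is m'.+1 then d * sqpow m' else 1.

Lemma sqpowE m : X ^+ m = ((sqpow0 m)%:C)%:M + (sqpow m)%:C *: X.
Proof.
elim: m => [|m IHm].
  by rewrite expr0 /= scale0r addr0.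
rewrite exprS IHm mulrDr -[X * _%:M]/(X *m _%:M) mul_mx_scalar.
have -> : X * ((sqpow m)%:C *: X) = ((d * sqpow m)%:C)%:M.
  by rewrite -scalerAr -[X * X]/(X *m X) X2 scale_scalar_mx -rmorphM mulrC.
rewrite addrC; congr (_ + _ *: _); case: m {IHm} => //.
Qed.

Lemma sqpow_le m : `|sqpow m| <= (1 + `|d|) ^+ m /\ `|sqpow m.+1| <= (1 + `|d|) ^+ m.+1.
Proof.
have h1 : 1 <= 1 + `|d| by rewrite lerDl.
have h0 : 0 <= 1 + `|d| by rewrite (le_trans _ h1).
elim: m => [|m [IH1 IH2]]; first by rewrite /= normr0 expr0 normr1 expr1.
split=> //=; rewrite normrM exprS; apply: ler_pM => //; first by rewrite lerDr.
by apply: le_trans IH1 _; rewrite exprS ler_peMl // exprn_ge0.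
Qed.

(** As [X ^ 2] is the real scalar [d], the even and odd powers sum separately, as for cosh and sinh.
    The coefficients [c] and [o] are real, which preserves the conjugation symmetry of [X]. *)
Lemma expmx_quadratic : exists (c o : R -> R) (K : R),
  (forall s, expmx (s%:C *: X) = ((c s)%:C)%:M + (o s)%:C *: X) /\
  (forall s, `|s| <= 1 -> `|c s - 1| <= K * s ^+ 2 /\ `|o s - s| <= K * s ^+ 2).
Proof.
have h1 : 1 <= 1 + `|d| by rewrite lerDl.
have h0 : 0 <= 1 + `|d| by rewrite (le_trans _ h1).
have o_le m : `|sqpow m| <= (1 + `|d|) ^+ m by have [] := sqpow_le m.
have c_le m : `|sqpow0 m| <= (1 + `|d|) ^+ m.
  case: m => [|m]; first by rewrite /= normr1 expr0.
  by rewrite /= normrM exprS; apply: ler_pM => //; rewrite lerDr.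
exists (fun s => limn (series (egf sqpow0 s))), (fun s => limn (series (egf sqpow s))), (expR (1 + `|d|)).
split=> [s|s s1]; last first.
  have := egf_taylor c_le s1; have := egf_taylor o_le s1.
  by rewrite /= !mulr0 mulr1 !subr0.
apply/matrixP => i j; rewrite !mxE -[X in _ = X + _]mulr_natr; apply: (@cvg_lim C^o); first exact: norm_hausdorff.
have -> : series (fun m => (m`!%:R^-1 *: (s%:C *: X) ^+ m) i j : C^o) =
    (fun n => series (fun m => (egf sqpow0 s m)%:C : C^o) n * (i == j)%:R
              + series (fun m => (egf sqpow s m)%:C : C^o) n * X i j).
  apply/funext => n; rewrite /series /= !mulr_suml -big_split /=; apply: eq_bigr => m _.
  rewrite exprZn sqpowE !mxE /egf !rmorphM rmorphXn fmorphV rmorph_nat /= -mulr_natr.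
  by ring.
pose S0 := series (fun m => (egf sqpow0 s m)%:C : C^o).
pose S1 := series (fun m => (egf sqpow s m)%:C : C^o).
have h2 : (fun n => S0 n * (i == j)%:R : C^o) @ \oo -->
    ((limn (series (egf sqpow0 s)))%:C * (i == j)%:R : C^o).
  have h := @cvgC_M R nat \oo _ S0 (fun=> (i == j)%:R) (limn (series (egf sqpow0 s)))%:C (i == j)%:R (series_real_complex (egf_cvg (s := s) c_le)) (@cvg_cst C^o (i == j)%:R _ _ _).
  exact: h.
have h3 : (fun n => S1 n * X i j : C^o) @ \oo --> ((limn (series (egf sqpow s)))%:C * X i j : C^o).
  have h := @cvgC_M R nat \oo _ S1 (fun=> X i j) (limn (series (egf sqpow s)))%:C (X i j) (series_real_complex (egf_cvg (s := s) o_le)) (@cvg_cst C^o (X i j) _ _ _).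
  exact: h.
exact: (cvgC_D h2 h3).
Qed.

End ExpMatrix.
End ExpSeries.

(** * Calculus of uniform first order expansions *)

Section Jets.
Variable R : realType.
Local Notation C := R[i].
Local Notation normc := (@Normc.normc R).
Local Notation "x %:C" := (real_complex R x) : ring_scope.
Implicit Types F G : C -> C.

(** First-order Taylor expansion in [s] at [0], uniformly in [z] in the disc. *)
Definition jet (F : R -> C -> C) (F0 F1 : C -> C) : Prop := exists c e : R,
  [/\ 1 <= c, 0 < e, e <= 1 & forall z, normc z < 1 ->
    [/\ normc (F0 z) <= c, normc (F1 z) <= c & forall s, `|s| < e ->
      normc (F s z - F0 z - s%:C * F1 z) <= c * s ^+ 2]].

Lemma jet_shrink (F : R -> C -> C) F0 F1 (c e c' e' : R) : (forall z, normc z < 1 ->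
    [/\ normc (F0 z) <= c, normc (F1 z) <= c & forall s, `|s| < e ->
      normc (F s z - F0 z - s%:C * F1 z) <= c * s ^+ 2]) -> c <= c' -> e' <= e ->
  (forall z, normc z < 1 ->
    [/\ normc (F0 z) <= c', normc (F1 z) <= c' & forall s, `|s| < e' ->
      normc (F s z - F0 z - s%:C * F1 z) <= c' * s ^+ 2]).
Proof.
move=> h cc ee z /h[h0 h1 h2]; split; [exact: le_trans cc|exact: le_trans cc|move=> s se].
apply: le_trans (h2 s (lt_le_trans se ee)) _.
by rewrite ler_wpM2r ?sqr_ge0.
Qed.

Lemma jet2 (F G : R -> C -> C) F0 F1 G0 G1 : jet F F0 F1 -> jet G G0 G1 -> exists c e : R,
  [/\ 1 <= c, 0 < e, e <= 1 & forall z, normc z < 1 ->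
    [/\ normc (F0 z) <= c, normc (F1 z) <= c, normc (G0 z) <= c, normc (G1 z) <= c & forall s, `|s| < e ->
      normc (F s z - F0 z - s%:C * F1 z) <= c * s ^+ 2 /\
      normc (G s z - G0 z - s%:C * G1 z) <= c * s ^+ 2]].
Proof.
move=> [c [e [c1 e0 e1 h]]] [c' [e' [c1' e0' e1' h']]].
exists (Num.max c c'), (Num.min e e'); split.
- by rewrite le_max c1.
- by rewrite lt_min e0.
- by rewrite ge_min e1.
move=> z z1.
have [a1 a2 a3] := jet_shrink h (c' := Num.max c c') (e' := Num.min e e') (ltac:(by rewrite le_max lexx)) (ltac:(by rewrite ge_min lexx)) z1.
have [b1 b2 b3] := jet_shrink h' (c' := Num.max c c') (e' := Num.min e e') (ltac:(by rewrite le_max lexx orbT)) (ltac:(by rewrite ge_min lexx orbT)) z1.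
by split=> // s se; split; [exact: a3|exact: b3].
Qed.

Lemma jet_cst (F0 : C -> C) (c : R) : (forall z, normc z < 1 -> normc (F0 z) <= c) ->
  jet (fun=> F0) F0 (fun=> 0).
Proof.
move=> h; have m1 : 1 <= Num.max c 1 by rewrite le_max lexx orbT.
have m0 : 0 <= Num.max c 1 by rewrite (le_trans _ m1).
exists (Num.max c 1), 1; split=> // z /h hz; split.
- by rewrite le_max hz.
- by rewrite Normc.normc0.
by move=> s _; rewrite mulr0 subr0 subrr Normc.normc0 mulr_ge0 ?sqr_ge0.
Qed.

Lemma jetD (F G : R -> C -> C) F0 F1 G0 G1 : jet F F0 F1 -> jet G G0 G1 ->
  jet (fun s z => F s z + G s z) (fun z => F0 z + G0 z) (fun z => F1 z + G1 z).
Proof.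
move=> hF hG; have [c [e [c1 e0 e1 h]]] := jet2 hF hG; exists (c + c), e; split=> //.
  by apply: (le_trans c1); rewrite lerDl (le_trans _ c1).
move=> z /h[a0 a1 b0 b1 hs]; split.
- exact: le_trans (le_normcD _ _) (lerD a0 b0).
- exact: le_trans (le_normcD _ _) (lerD a1 b1).
move=> s /hs[h1 h2].
rewrite (_ : _ - _ = (F s z - F0 z - s%:C * F1 z) + (G s z - G0 z - s%:C * G1 z)); last by ring.
by apply: le_trans (le_normcD _ _) _; rewrite mulrDl lerD.
Qed.

Lemma jetM (F G : R -> C -> C) F0 F1 G0 G1 : jet F F0 F1 -> jet G G0 G1 ->
  jet (fun s z => F s z * G s z) (fun z => F0 z * G0 z) (fun z => F1 z * G0 z + F0 z * G1 z).
Proof.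
(* The constant is [3 + 2 + 1]: the remainder of [F] times [G], the affine part of [F] times the
   remainder of [G], and the product of the two linear terms. *)
move=> hF hG; have [c [e [c1 e0 e1 h]]] := jet2 hF hG; exists (6 * (c * c)), e.
have c0 : 0 <= c by rewrite (le_trans _ c1).
have cc1 : 1 <= c * c by rewrite mulr_ege1.
have cc0 : 0 <= c * c by rewrite (le_trans _ cc1).
split=> //; first by rewrite (le_trans cc1) // ler_peMl // ler1n.
move=> z /h[a0 a1 b0 b1 hs]; split.
- by rewrite Normc.normcM (le_trans (ler_pM _ _ a0 b0)) ?normc_ge0 // ler_peMl // ler1n.
- apply: le_trans (le_normcD _ _) _; rewrite !Normc.normcM.
  apply: (@le_trans _ _ (c * c + c * c)); first by apply: lerD; apply: ler_pM; rewrite ?normc_ge0.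
  by rewrite [c * c + c * c](_ : _ = 2 * (c * c)); [rewrite ler_wpM2r // ler_nat|ring].
move=> s se; have [h1 h2] := hs s se.
have s1 : `|s| <= 1 by rewrite ltW // (lt_le_trans se).
have s2 : s ^+ 2 <= 1 by rewrite -real_normK ?num_real // exprn_ile1.
set rF := F s z - _ - _ in h1; set rG := G s z - _ - _ in h2.
have nF : normc (F0 z + s%:C * F1 z) <= c + c.
  apply: le_trans (le_normcD _ _) _; rewrite lerD // Normc.normcM normcR.
  by rewrite -[leRHS]mul1r; apply: ler_pM; rewrite ?normc_ge0.
have nG : normc (G s z) <= c + c + c.
  rewrite (_ : G s z = G0 z + s%:C * G1 z + rG); last by rewrite /rG; ring.
  apply: le_trans (le_normcD _ _) _; rewrite lerD //; last first.
    by apply: le_trans h2 _; rewrite -[leRHS]mulr1 ler_wpM2l.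
  apply: le_trans (le_normcD _ _) _; rewrite lerD // Normc.normcM normcR.
  by rewrite -[leRHS]mul1r; apply: ler_pM; rewrite ?normc_ge0.
rewrite (_ : _ - _ = rF * G s z + (F0 z + s%:C * F1 z) * rG + s%:C * s%:C * (F1 z * G1 z)); last first.
  by rewrite /rF /rG; ring.
apply: (@le_trans _ _ (c * s ^+ 2 * (c + c + c) + (c + c) * (c * s ^+ 2) + s ^+ 2 * (c * c))); last first.
  by rewrite le_eqVlt; apply/orP; left; apply/eqP; ring.
apply: le_trans (le_normcD _ _) _; apply: lerD.
  apply: le_trans (le_normcD _ _) _; apply: lerD; rewrite Normc.normcM; apply: ler_pM; rewrite ?normc_ge0 //.
rewrite !Normc.normcM !normcR -normrM -expr2 ger0_norm ?sqr_ge0 //.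
by rewrite ler_wpM2l ?sqr_ge0 //; apply: ler_pM; rewrite ?normc_ge0.
Qed.

Lemma jet_ext (F F' : R -> C -> C) F0 F0' F1 F1' : (forall s z, F s z = F' s z) ->
  (forall z, F0 z = F0' z) -> (forall z, F1 z = F1' z) -> jet F F0 F1 -> jet F' F0' F1'.
Proof.
by move=> /(fun h => funext (fun s => funext (h s))) <- /funext <- /funext <-.
Qed.

(** The radius [(4 c)^-1] keeps [F] within 1/2 of its limit 1, so [|F| >= 1/2]. The remainder is a
    numerator of size at most [3 c ^ 2 s ^ 2] divided by [F], whence the factor 6. *)
Lemma jetV (F : R -> C -> C) F1 : jet F (fun=> 1) F1 -> jet (fun s z => (F s z)^-1) (fun=> 1) (fun z => - F1 z).
Proof.
move=> [c [e [c1 e0 e1 h]]].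
have c0 : 0 < c by rewrite (lt_le_trans _ c1).
have cc1 : 1 <= c * c by rewrite mulr_ege1 // ltW.
have cc0 : 0 <= c * c by rewrite (le_trans _ cc1).
have c4 : 0 < 4 * c by rewrite mulr_gt0.
exists (6 * (c * c)), (Num.min e (4 * c)^-1); split.
- by rewrite (le_trans cc1) // ler_peMl // ler1n.
- by rewrite lt_min e0 invr_gt0.
- by rewrite ge_min e1.
have c6 : c <= 6 * (c * c).
  by rewrite mulrA -[leLHS]mul1r ler_pM2r // -[leLHS]mul1r ler_pM // ler1n.
move=> z /h[a0 a1 hs]; split.
- exact: le_trans a0 c6.
- by rewrite normcN (le_trans a1).
move=> s; rewrite lt_min => /andP[se s4]; have h1 := hs s se.
have s1 : `|s| <= 1 by rewrite ltW // (lt_le_trans se).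
have s2 : s ^+ 2 <= `|s|.
  by rewrite -real_normK ?num_real // expr2 -[leRHS]mulr1 ler_wpM2l.
set r := F s z - _ - _ in h1.
have cs : c * `|s| <= 4^-1.
  by have := ltW s4; rewrite invfM mulrC -ler_pdivlMl ?invr_gt0 // invrK.
have nr : normc (s%:C * F1 z) <= 4^-1.
  rewrite Normc.normcM normcR mulrC (le_trans _ cs) // ler_wpM2r //.
have nr2 : normc r <= 4^-1.
  by rewrite (le_trans h1) // (le_trans _ cs) // ler_wpM2l // ltW.
have nF : 2^-1 <= normc (F s z).
  have eF : F s z = 1 + (s%:C * F1 z + r) by rewrite /r; ring.
  have : normc 1 <= normc (F s z) + normc (- (s%:C * F1 z + r)).
    by rewrite [X in normc X <= _](_ : 1 = F s z + - (s%:C * F1 z + r)) ?le_normcD // eF; ring.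
  rewrite Normc.normc1 normcN => hh.
  have h4 : normc (s%:C * F1 z + r) <= 2^-1.
    apply: le_trans (le_normcD _ _) _; apply: le_trans (lerD nr nr2) _.
    by rewrite (_ : 4^-1 + 4^-1 = 2^-1 :> R) //; field.
  rewrite -(lerD2r 2^-1) (_ : 2^-1 + 2^-1 = 1 :> R); last by field.
  by rewrite (le_trans hh) // lerD2l.
have F0 : F s z != 0.
  by apply/eqP => F0; move: nF; rewrite F0 Normc.normc0 invr_le0 lern0.
rewrite (_ : _ - _ = (- r + s%:C * s%:C * (F1 z * F1 z) + s%:C * F1 z * r) / F s z); last first.
  by rewrite /r; field; exact: F0.
rewrite Normc.normcM Normc.normcV ler_pdivrMr; last exact: lt_le_trans nF.
apply: (@le_trans _ _ (3 * (c * c) * s ^+ 2)); last first.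
  apply: (@le_trans _ _ (6 * (c * c) * s ^+ 2 * 2^-1)).
    by rewrite le_eqVlt; apply/orP; left; apply/eqP; field.
  by apply: ler_wpM2l nF; rewrite mulr_ge0 ?sqr_ge0 // mulr_ge0.
apply: (@le_trans _ _ (c * s ^+ 2 + s ^+ 2 * (c * c) + c * (c * s ^+ 2))); last first.
  apply: (@le_trans _ _ (c * c * s ^+ 2 + s ^+ 2 * (c * c) + c * (c * s ^+ 2))); last first.
    by rewrite le_eqVlt; apply/orP; left; apply/eqP; ring.
  by rewrite !lerD2r ler_wpM2r ?sqr_ge0 // ler_peMl // ltW.
apply: le_trans (le_normcD _ _) _; apply: lerD.
  apply: le_trans (le_normcD _ _) _; apply: lerD; first by rewrite normcN.
  rewrite !Normc.normcM !normcR -normrM -expr2 ger0_norm ?sqr_ge0 //.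
  by rewrite ler_wpM2l ?sqr_ge0 //; apply: ler_pM; rewrite ?normc_ge0.
rewrite Normc.normcM; apply: ler_pM; rewrite ?normc_ge0 // Normc.normcM normcR.
by rewrite -[leRHS]mul1r; apply: ler_pM; rewrite ?normc_ge0.
Qed.

Lemma jetX (F : R -> C -> C) F0 F1 n : jet F F0 F1 ->
  jet (fun s z => F s z ^+ n) (fun z => F0 z ^+ n) (fun z => n%:R * (F0 z ^+ n.-1 * F1 z)).
Proof.
move=> hF; elim: n => [|n IHn].
  apply: jet_ext (@jet_cst (fun=> 1) 1 _) => *; rewrite ?expr0 ?mul0r //.
  by rewrite Normc.normc1.
apply: jet_ext (jetM hF IHn) => *; rewrite ?exprS //.
by case: n {IHn} => [|n] /=; rewrite ?exprS ?expr0; ring.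
Qed.

Lemma jet_horner (p : {poly C}) (F : R -> C -> C) F0 F1 : jet F F0 F1 ->
  jet (fun s z => p.[F s z]) (fun z => p.[F0 z]) (fun z => p^`().[F0 z] * F1 z).
Proof.
move=> hF; elim/poly_ind: p => [|p c IHp].
  apply: jet_ext (@jet_cst (fun=> 0) 0 _) => *; rewrite ?deriv0 ?horner0 ?mul0r //.
  by rewrite Normc.normc0.
apply: jet_ext (jetD (jetM IHp hF) (@jet_cst (fun=> c) (normc c) _)) => *; rewrite ?hornerMXaddC //.
by rewrite derivMXaddC hornerD hornerMX; ring.
Qed.

End Jets.

(** * The group action on polynomial functions of the disc *)

Section DiscPolynomials.
Variable R : realType.
Local Notation C := R[i].
Local Notation normc := (@Normc.normc R).
Local Notation "x %:C" := (real_complex R x) : ring_scope.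

Definition disc_horner (p : {poly C}) : C -> C := fun z => if `|z| < 1 then p.[z] else 0.

Lemma normC_lt1 (z : C) : (`|z| < 1) = (normc z < 1).
Proof. exact: (normc_ltr z 1). Qed.

Lemma nearC_ball (z : C) (P : C -> Prop) : (\forall y \near (z : C^o), P y) ->
  exists2 r : R, 0 < r & forall y, normc (y - z) < r -> P y.
Proof.
move=> /nbhs_ballP[e /= /posC_real[-> e0] h]; exists (complex.Re e) => // y yz; apply: h.
by rewrite /ball /= -[`|_|]/((normc (z - y))%:C) ltcR -normcN opprB.
Qed.

Lemma near_disc (z : C) : normc z < 1 -> \forall y \near (z : C^o), normc y < 1.
Proof.
move=> z1; have d0 : 0 < 1 - normc z by rewrite subr_gt0.
have /cvgCP/(_ _ d0) := @cvg_id C^o (nbhs (z : C^o)); apply: filterS => y h.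
by rewrite -[y](subrK z) (le_lt_trans (le_normcD _ _)) // -ltrBrDr.
Qed.

(** The slope function of [f] is kept where [f] and [g] agree and replaced elsewhere by the
    difference quotient of [g]; near [z] nothing changes. *)
Lemma cara_near (f g : C^o -> C^o) (z w : C) : (\forall y \near (z : C^o), f y = g y) ->
  cara id f z w -> cara id g z w.
Proof.
move=> fg [P [hP Pw hf]]; have fz : f z = g z := nbhs_singleton fg.
exists (fun y => if f y == g y then P y else (g y - g z) / (y - z)); split.
- rewrite fz eqxx; apply: (@cvgCP R C^o (nbhs (z : C^o)) (nbhs_filter (z : C^o)) _ _).2 => e e0.
  have h := (@cvgCP R C^o (nbhs (z : C^o)) (nbhs_filter (z : C^o)) _ _).1 hP e e0.
  have hI : nbhs (z : C^o) (fun y : C^o => f y = g y /\ normc (P y - P z) < e) :=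
    @filterI _ _ (nbhs_filter (z : C^o)) _ _ fg h.
  suff : nbhs (z : C^o) (fun y : C^o =>
    normc ((if f y == g y then P y else (g y - g z) / (y - z)) - P z) < e) by [].
  by apply: (@filterS _ _ (nbhs_filter (z : C^o)) _ _ _ hI) => y [-> hy]; rewrite eqxx.
- by rewrite fz eqxx.
move=> y; case: eqP => [<-|fy]; first by rewrite -fz.
have [yz|yz] := eqVneq y z; first by rewrite yz in fy.
by rewrite divfK // subr_eq0.
Qed.

Lemma cara_disc_horner (p : {poly C}) (z : C) : normc z < 1 ->
  cara id (disc_horner p : C^o -> C^o) z p^`().[z].
Proof.
move=> z1; apply: (@cara_near (fun y => p.[y])).
  by apply: (@filterS _ _ (nbhs_filter (z : C^o)) _ _ _ (near_disc z1)) => y y1; rewrite /disc_horner normC_lt1 y1.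
by apply: (@cara_horner R C^o id z); exact: cvg_id.
Qed.

Lemma horner_bounded (p : {poly C}) :
  exists c : R, forall z, normc z < 1 -> normc p.[z] <= c.
Proof.
elim/poly_ind: p => [|p c [K hK]].
  by exists 0 => z _; rewrite horner0 Normc.normc0.
exists (K + normc c) => z z1; rewrite hornerMXaddC (le_trans (le_normcD _ _)) // lerD2r.
rewrite Normc.normcM -[leRHS]mulr1; apply: ler_pM; rewrite ?normc_ge0 ?hK //.
exact: ltW.
Qed.

Lemma su11E (X : 'M[C]_2) : su11 X ->
  [/\ X 1 1 = - X 0 0, (X 0 0)^*%C = - X 0 0, (X 0 1)^*%C = X 1 0 & (X 1 0)^*%C = X 0 1].
Proof.
move=> [/matrixP hX /in_sl2E X11].
have l1 : lift 0 0 = 1 :> 'I_2 by apply: val_inj.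
have h i j := hX i j.
have := h 0 0; have := h 0 1.
rewrite !mxE !big_ord_recl !big_ord0 !mxE /= !l1 /=.
rewrite !(mul0r, mulr0, mul1r, mulr1, addr0, add0r, expr0, expr1, mulrN1, mulN1r).
move=> h01 h00.
have e00 : (X 0 0)^*%C = - X 0 0 by apply/eqP; rewrite -addr_eq0 addrC h00.
have e10 : (X 1 0)^*%C = X 0 1 by apply/eqP; rewrite -subr_eq0 addrC h01.
by split=> //; rewrite -e10 conjcK.
Qed.

Lemma invmx2 (g : 'M[C]_2) : \det g != 0 ->
  [/\ invmx g 0 0 = (\det g)^-1 * g 1 1, invmx g 0 1 = (\det g)^-1 * - g 0 1,
      invmx g 1 0 = (\det g)^-1 * - g 1 0 & invmx g 1 1 = (\det g)^-1 * g 0 0].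
Proof.
move=> d0; have gu : g \in unitmx by rewrite unitmxE unitfE.
have l1 : lift 0 0 = 1 :> 'I_2 by apply: val_inj.
have l2 : lift 1 0 = 0 :> 'I_2 by apply: val_inj.
rewrite /invmx gu; split; rewrite !mxE /cofactor det_mx11 !mxE ?l1 ?l2 /=.
- by rewrite expr0 mul1r.
- by rewrite expr1 mulN1r.
- by rewrite expr1 mulN1r.
- by rewrite sqrrN expr1n mul1r.
Qed.

Lemma det_mx2 (g : 'M[C]_2) : \det g = g 0 0 * g 1 1 - g 0 1 * g 1 0.
Proof.
have l1 : lift 0 0 = 1 :> 'I_2 by apply: val_inj.
have l2 : lift 1 0 = 0 :> 'I_2 by apply: val_inj.
rewrite (expand_det_row g 0) !big_ord_recl big_ord0 /cofactor !det_mx11 !mxE -[ord0]/(0 : 'I_2) !l1 !l2 /=.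
by rewrite expr0 expr1 mul1r mulN1r addr0 mulrN.
Qed.

(** A traceless matrix has scalar square; the symmetries of su(1,1) make the scalar real. *)
Lemma su11_sqr (X : 'M[C]_2) : su11 X ->
  X *m X = ((complex.Re (X 0 0 ^+ 2 + X 0 1 * X 1 0))%:C)%:M.
Proof.
move=> /su11E[X11 X00 X01 X10].
have l1 : lift 0 0 = 1 :> 'I_2 by apply: val_inj.
have -> : (complex.Re (X 0 0 ^+ 2 + X 0 1 * X 1 0))%:C = X 0 0 ^+ 2 + X 0 1 * X 1 0.
  apply: RRe_real; apply/complex_realP.
  have : ((X 0 0 ^+ 2 + X 0 1 * X 1 0)^*)%C = X 0 0 ^+ 2 + X 0 1 * X 1 0.
    by rewrite rmorphD rmorphXn rmorphM /= X00 X01 X10 sqrrN [X 1 0 * _]mulrC.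
  case: (X 0 0 ^+ 2 + _) => a b /= [] /eqP; rewrite eq_sym -subr_eq0 opprK -mulr2n mulrn_eq0 /= => /eqP b0.
  by exists a; rewrite b0.
apply/matrixP => i j; rewrite !mxE !big_ord_recl big_ord0 -[ord0]/(0 : 'I_2) l1 addr0.
have ord2 (k : 'I_2) : k = 0 \/ k = 1.
  by case: k => [[|[|k]] hk]; [left|right|]; rewrite //; apply: val_inj.
case: (ord2 i) => ->; case: (ord2 j) => ->; rewrite /= ?X11 ?mulr1n ?mulr0n.
- by rewrite expr2.
- by rewrite mulrN [X 0 1 * _]mulrC addrN.
- by rewrite mulNr [X 1 0 * _]mulrC addrN.
- by rewrite mulrNN expr2 addrC [X 1 0 * _]mulrC.
Qed.

Lemma jet_expmx (X : 'M[C]_2) : su11 X -> forall i j,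
  jet (fun s _ => expmx (s%:C *: X) i j) (fun=> (i == j)%:R) (fun=> X i j).
Proof.
move=> sX i j; have [X11 _ X01 _] := su11E sX.
have [c [so [K [eX ho]]]] := expmx_quadratic (su11_sqr sX).
have K1 : K <= Num.max K 1 by rewrite le_max lexx.
have m1 : 1 <= Num.max K 1 by rewrite le_max lexx orbT.
have m0 : 0 <= Num.max K 1 by rewrite (le_trans _ m1).
have jc : jet (fun s _ => (c s)%:C) (fun=> 1) (fun=> 0).
  exists (Num.max K 1), 1; split=> // z _; rewrite Normc.normc0 Normc.normc1; split=> // s s1.
  rewrite mulr0 subr0 -[1]/(1%:C) -rmorphB normcR.
  by have [h _] := ho s (ltW s1); rewrite (le_trans h) // ler_wpM2r // sqr_ge0.
have jo : jet (fun s _ => (so s)%:C) (fun=> 0) (fun=> 1).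
  exists (Num.max K 1), 1; split=> // z _; rewrite Normc.normc0 Normc.normc1; split=> // s s1.
  rewrite subr0 mulr1 -rmorphB normcR.
  by have [_ h] := ho s (ltW s1); rewrite (le_trans h) // ler_wpM2r // sqr_ge0.
have cst (a : C) : jet (fun _ _ => a) (fun=> a) (fun=> 0) by apply: (@jet_cst R _ (normc a)).
apply: jet_ext (jetD (jetM jc (cst (i == j)%:R)) (jetM jo (cst (X i j)))) => [s z|z|z].
- by rewrite eX !mxE mulr_natr.
- by rewrite /=; ring.
- by rewrite /=; ring.
Qed.

Lemma expmx_su11_conj (X : 'M[C]_2) (s : R) : su11 X ->
  let g := expmx (s%:C *: X) in (g 0 0)^*%C = g 1 1 /\ (g 0 1)^*%C = g 1 0.
Proof.
move=> sX; have [X11 X00 X01 X10] := su11E sX.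
have [c [so [K [eX _]]]] := expmx_quadratic (su11_sqr sX).
rewrite /= eX !mxE /= !mulr1n !mulr0n !add0r !(rmorphD, rmorphM) /= X00 X01 X11.
by split; rewrite ?oppr0.
Qed.

(** [F] is the expression of the action as powers and quotients of the entries of [exp (s X)], to
    which the rules for jets apply. It agrees with the action as long as the Moebius map sends the
    disc to itself, since [disc_horner] vanishes outside. *)
Lemma disc_action (X : 'M[C]_2) (n : nat) (p : {poly C}) : su11 X ->
  exists (F : R -> C -> C) (e : R), [/\ 0 < e,
    jet F (fun z => p.[z]) (fun z => (weight_op n%:R X p).[z]) &
    forall s z, `|s| < e -> normc z < 1 ->
      gaction (D_plus R (- n%:Z)) (expmx (s%:C *: X)) (disc_horner p) z = F s z].
Proof.
move=> sX; have [X11 X00 X01 X10] := su11E sX; have jX := jet_expmx sX.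
pose g s := expmx (s%:C *: X).
pose Dl s := g s 0 0 * g s 1 1 - g s 0 1 * g s 1 0.
pose A s z := g s 1 1 * z - g s 0 1.
pose B s z := - g s 1 0 * z + g s 0 0.
have cst (a : C) : jet (fun _ _ => a) (fun=> a) (fun=> 0) by apply: (@jet_cst R _ (normc a)).
have jz : jet (fun (_ : R) z => z) id (fun=> 0) by apply: (@jet_cst R id 1) => z /ltW.
have jN F F0 F1 : @jet R F F0 F1 -> jet (fun s z => - F s z) (fun z => - F0 z) (fun z => - F1 z).
  by move=> h; apply: jet_ext (jetM (cst (-1)) h) => *; rewrite ?mulN1r ?mul0r ?add0r.
have jDl : jet (fun s _ => Dl s) (fun=> 1) (fun=> 0).
  apply: jet_ext (jetD (jetM (jX 0 0) (jX 1 1)) (jN _ _ _ (jetM (jX 0 1) (jX 1 0)))) => // z /=.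
    by rewrite mulr1 mulr0 subr0.
  by rewrite mulr1 mul1r mulr0 mul0r addr0 subr0 X11 addrN.
have jA : jet A id (fun z => X 1 1 * z - X 0 1).
  apply: jet_ext (jetD (jetM (jX 1 1) jz) (jN _ _ _ (jX 0 1))) => // z /=.
    by rewrite mul1r subr0.
  by rewrite mulr0 addr0.
have jB : jet B (fun=> 1) (fun z => X 0 0 - X 1 0 * z).
  apply: jet_ext (jetD (jetM (jN _ _ _ (jX 1 0)) jz) (jX 0 0)) => // z /=.
    by rewrite oppr0 mul0r add0r.
  by rewrite mulr0 addr0 addrC mulNr.
have jBV := jetV jB.
pose F s z := Dl s ^+ n * (B s z)^-1 ^+ n * p.[A s z * (B s z)^-1].
have jF : jet F (fun z => p.[z]) (fun z => (weight_op n%:R X p).[z]).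
  apply: jet_ext (jetM (jetM (jetX n jDl) (jetX n jBV)) (jet_horner p (jetM jA jBV))) => // z.
    by rewrite !expr1n !mul1r mulr1.
  rewrite /= !expr1n !mul1r !mulr1 !mulr0 add0r.
  rewrite /weight_op !(hornerD, hornerN, hornerM, hornerZ, hornerX, hornerXn, hornerC) X11; ring.
have [c [e [c1 e0 e1 h]]] := jDl.
exists F, (Num.min e (c + 1)^-1); split=> //.
  by rewrite lt_min e0 invr_gt0 ltr_wpDl // (le_trans _ c1).
move=> s z; rewrite lt_min => /andP[se sc] z1.
(* The determinant is controlled only through its jet: [|Dl s - 1| <= c s ^ 2 < 1] by the choice of
   radius. *)
have Dl0 : 0 < complex.Re (Dl s).
  have [|_ _ /(_ s se)] := h 0; first by rewrite Normc.normc0.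
  rewrite mulr0 subr0 => hD.
  have c10 : 0 < c + 1 by rewrite ltr_wpDl // (le_trans _ c1).
  have s1 : `|s| <= 1 by rewrite ltW // (lt_le_trans se).
  have : normc (Dl s - 1) < 1.
    apply: le_lt_trans hD _; apply: (@le_lt_trans _ _ (c * `|s|)).
      rewrite ler_wpM2l //; first by rewrite (le_trans _ c1).
      by rewrite -real_normK ?num_real // expr2 -[leRHS]mulr1 ler_wpM2l.
    apply: (@lt_le_trans _ _ (c * (c + 1)^-1)); first by rewrite ltr_pM2l // (lt_le_trans _ c1).
    by rewrite ler_pdivrMr // mul1r lerDl.
  move=> /(le_lt_trans (normc_ge_abs_Re _)); rewrite ReB ltr_norml => /andP[+ _].
  by rewrite -[complex.Re 1]/(1 : R) ltrBrDr addNr.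
have [g00 g01] := expmx_su11_conj s sX; rewrite -/(g s) in g00 g01.
have g11 : (g s 1 1)^*%C = g s 0 0 by rewrite -g00 conjcK.
have g10 : (g s 1 0)^*%C = g s 0 1 by rewrite -g01 conjcK.
(* Invariance of the Hermitian form of signature (1,1), up to the determinant: it makes [|A| < |B|]
   inside the disc. *)
have hAB : normc (B s z) ^+ 2 - normc (A s z) ^+ 2 = complex.Re (Dl s) * (1 - normc z ^+ 2).
  have sq (x : C) : (normc x ^+ 2)%:C = x * x^*%C by rewrite rmorphXn -sqr_normc.
  have : (normc (B s z) ^+ 2 - normc (A s z) ^+ 2)%:C = Dl s * (1 - normc z ^+ 2)%:C.
    have -> : (1 - normc z ^+ 2)%:C = 1 - z * z^*%C by rewrite -sq; exact: (rmorphB (real_complex R) 1).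
    have -> : (normc (B s z) ^+ 2 - normc (A s z) ^+ 2)%:C = B s z * (B s z)^*%C - A s z * (A s z)^*%C.
      by rewrite -!sq; exact: (rmorphB (real_complex R)).
    rewrite /A /B /Dl !(rmorphD, rmorphB, rmorphN, rmorphM) /= g00 g01 g10 g11.
    by ring.
  by move=> /(congr1 (@complex.Re R)); case: (Dl s) => a b /=; rewrite mulr0 subr0.
have AB : normc (A s z) < normc (B s z).
  rewrite -(@ltr_pXn2r _ 2) ?nnegrE ?normc_ge0 // -subr_gt0 hAB mulr_gt0 // subr_gt0.
  by rewrite expr_lt1 ?normc_ge0.
have B0 : 0 < normc (B s z) by apply: le_lt_trans AB; exact: normc_ge0.
have Dl00 : Dl s != 0 by apply/eqP => D0; move: Dl0; rewrite D0 ltxx.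
have [|i1 i2 i3 i4] := @invmx2 (g s); first by rewrite det_mx2.
rewrite /= normC_lt1 z1 /cocycle /moebius i1 i2 i3 i4 det_mx2 -/(Dl s).
have -> : (Dl s)^-1 * g s 1 1 * z + (Dl s)^-1 * - g s 0 1 = (Dl s)^-1 * A s z.
  by rewrite /A; ring.
have -> : (Dl s)^-1 * - g s 1 0 * z + (Dl s)^-1 * g s 0 0 = (Dl s)^-1 * B s z.
  by rewrite /B; ring.
have -> : (Dl s)^-1 * A s z / ((Dl s)^-1 * B s z) = A s z / B s z.
  by rewrite invfM mulrACA divff ?invr_eq0 // mul1r.
have AB1 : normc (A s z / B s z) < 1.
  by rewrite Normc.normcM Normc.normcV ltr_pdivrMr // mul1r.
rewrite /disc_horner normC_lt1 AB1 /F; congr (_ * _).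
by rewrite -exprnN exprMn invfM -!exprVn invrK.
Qed.

End DiscPolynomials.

(** * From su(1,1) to sl(2, C) *)

Section Complexification.
Variable R : realType.
Local Notation C := R[i].
Local Notation normc := (@Normc.normc R).
Local Notation "x %:C" := (real_complex R x) : ring_scope.

Lemma ord2_cases (i : 'I_2) : i = 0 \/ i = 1.
Proof. by case: i => [[|[|i]] hi]; [left|right|]; rewrite //; apply: val_inj. Qed.

Lemma su11I (X : 'M[C]_2) : X 1 1 = - X 0 0 -> (X 0 0)^*%C = - X 0 0 ->
  (X 0 1)^*%C = X 1 0 -> su11 X.
Proof.
move=> X11 X00 X01; split; last exact/in_sl2E.
have X10 : (X 1 0)^*%C = X 0 1 by rewrite -X01 conjcK.
have l1 : lift 0 0 = 1 :> 'I_2 by apply: val_inj.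
apply/matrixP => i j.
case: (ord2_cases i) => ->; case: (ord2_cases j) => ->;
  rewrite !mxE !big_ord_recl !big_ord0 !mxE -[ord0]/(0 : 'I_2) !l1 /= ?X11 ?rmorphN /= ?X00 ?X01 ?X10;
  by rewrite !(mul0r, mulr0, mul1r, mulr1, addr0, add0r, expr0, expr1, mulrN1, mulN1r, opprK, addrN, addNr).
Qed.

(** [X1] is [X] plus its image under the antilinear involution fixing su(1,1), and [X2] is [- i]
    times the difference; each is then halved. *)
Lemma sl2_su11_decomp (X : 'M[C]_2) : in_sl2 X ->
  exists X1 X2, [/\ su11 X1, su11 X2 & X = X1 + 'i%C *: X2].
Proof.
move=> /in_sl2E X11.
pose X1 : 'M[C]_2 := \matrix_(i, j) (if i == j then X i j - (X i j)^*%C else X i j + (X j i)^*%C).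
pose X2 : 'M[C]_2 := \matrix_(i, j) (- 'i%C * (if i == j then X i j + (X i j)^*%C else X i j - (X j i)^*%C)).
have h (Y : 'M[C]_2) : su11 Y -> su11 ((2^-1)%:C *: Y).
  move=> /su11E[a b c d]; apply: su11I; rewrite !mxE ?a ?mulrN //.
    by rewrite rmorphM /= b oppr0 mulrN.
  by rewrite rmorphM /= c oppr0.
exists ((2^-1)%:C *: X1), ((2^-1)%:C *: X2); split.
- apply: h; apply: su11I; rewrite !mxE /=.
  + by rewrite X11 rmorphN opprB opprK addrC.
  + by rewrite rmorphB /= conjcK opprB.
  + by rewrite rmorphD /= conjcK addrC.
- have ic : ('i%C : C)^*%C = - 'i%C by apply/eqP; rewrite eq_complex /= oppr0 !eqxx.
  have cM (x y : C) : (x * y)^*%C = x^*%C * y^*%C by exact: rmorphM.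
  have cD (x y : C) : (x + y)^*%C = x^*%C + y^*%C by exact: rmorphD.
  have cN (x : C) : (- x)^*%C = - x^*%C by exact: rmorphN.
  apply: h; apply: su11I; rewrite !mxE /=.
  + by rewrite X11 rmorphN /= -opprD mulrN.
  + by rewrite cM cN cD ic conjcK opprK mulNr opprK addrC.
  + by rewrite cM cN cD cN ic conjcK opprK mulNr -mulrN opprB addrC.
have half : (2^-1)%:C * 2%:R = 1 :> C by rewrite -(rmorph_nat (real_complex R)) -rmorphM mulVf ?pnatr_eq0 // rmorph1.
have ii : ('i%C : C) * 'i%C = -1 by rewrite -expr2 sqr_i.
apply/matrixP => i j; rewrite !mxE.
transitivity ((2^-1)%:C * 2%:R * X i j); first by rewrite half mul1r.
set a := (2^-1)%:C.
have e b : 'i%C * (a * (- 'i%C * b)) = a * b.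
  transitivity (- ('i%C * 'i%C) * (a * b)); first by ring.
  by rewrite ii opprK mul1r.
by rewrite e -mulrDr -mulrA; congr (_ * _); case: ifP => _; ring.
Qed.

(** Linearity of [opr] in the matrix makes the complexified action independent of the chosen
    decomposition. *)
Lemma dactC_horner (pi : disc_rep R) (psi : {poly C} -> C -> C)
    (opr : 'M[C]_2 -> {poly C} -> {poly C}) :
  (forall c p q, psi (c *: p + q) = c *: psi p + psi q) ->
  (forall X Y c p, opr (c *: X + Y) p = c *: opr X p + opr Y p) ->
  (forall X p u, su11 X -> dact pi X (psi p) u <-> u = psi (opr X p)) ->
  forall X p u, in_sl2 X -> dactC pi X (psi p) u <-> u = psi (opr X p).
Proof.
move=> psiL oprL h X p u sX.
have key X1 X2 : psi (opr (X1 + 'i%C *: X2) p) = psi (opr X1 p) + 'i%C *: psi (opr X2 p).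
  by rewrite addrC oprL psiL addrC.
split=> [[X1 [X2 [u1 [u2 [s1 s2 -> [/(h _ _ _ s1) -> /(h _ _ _ s2) ->] ->]]]]]|->].
  by rewrite key.
have [X1 [X2 [s1 s2 ->]]] := sl2_su11_decomp sX.
exists X1, X2, (psi (opr X1 p)), (psi (opr X2 p)); split=> //.
by split; apply/h.
Qed.

End Complexification.

(** * The derived action on the holomorphic discrete series *)

Section HolomorphicDiscreteSeries.
Variables (R : realType) (k : nat).
Local Notation C := R[i].
Local Notation normc := (@Normc.normc R).
Local Notation "x %:C" := (real_complex R x) : ring_scope.
Local Notation Dp := (D_plus R (- (k.+2)%:Z)).

Lemma bergman_weightE : - - (k.+2)%:Z = k%:Z + 2.
Proof. by rewrite opprK -addn2 PoszD. Qed.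

Lemma D_plus_sqnormE f : sqnorm Dp f = bergman_sqnorm (k%:Z + 2) f.
Proof. by rewrite /= bergman_weightE. Qed.

Lemma disc_horner_vectors (p : {poly C}) : vectors Dp (disc_horner p).
Proof.
rewrite /= bergman_weightE; split.
- move=> z; rewrite normC_lt1 => z1; exact: cara_derivable (cara_disc_horner p z1).
- by move=> z /negbTE z1; rewrite /disc_horner z1.
have [c hc] := horner_bounded p.
apply: le_lt_trans (@bergman_sqnorm_le R k _ c _) (ltry _) => z z1.
by rewrite /disc_horner normC_lt1 z1; exact: hc.
Qed.

Lemma quotient_bound (X : 'M[C]_2) (p : {poly C}) : su11 X ->
  exists c e : R, [/\ 0 <= c, 0 < e, e <= 1 & forall s, s != 0 -> `|s| < e ->
   forall z, normc z < 1 -> normc (((s^-1)%:C *: (gaction Dp (expmx (s%:C *: X)) (disc_horner p) - disc_horner p)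
     - disc_horner (weight_op (k.+2)%:R X p)) z) <= c * `|s|].
Proof.
move=> sX; have [F [e [e0 [c [e' [c1 e0' e1' hF]]] hg]]] := disc_action k.+2 p sX.
exists c, (Num.min e e'); split.
- by rewrite (le_trans _ c1).
- by rewrite lt_min e0.
- by rewrite ge_min e1' orbT.
move=> s s0; rewrite lt_min => /andP[se se'] z z1.
have [_ _ /(_ s se') hs] := hF z z1.
have -> : ((s^-1)%:C *: (gaction Dp (expmx (s%:C *: X)) (disc_horner p) - disc_horner p)
     - disc_horner (weight_op (k.+2)%:R X p)) z =
   (s^-1)%:C * (gaction Dp (expmx (s%:C *: X)) (disc_horner p) z - disc_horner p z)
     - disc_horner (weight_op (k.+2)%:R X p) z by [].
rewrite hg // /disc_horner !normC_lt1 !z1.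
have sC : (s^-1)%:C * s%:C = 1 by rewrite -rmorphM mulVf.
have -> (x y : C) : (s^-1)%:C * x - y = (s^-1)%:C * (x - s%:C * y).
  by rewrite mulrBr mulrA sC mul1r.
rewrite Normc.normcM normcR normfV ler_pdivrMl ?normr_gt0 // mulrCA -expr2 real_normK ?num_real //.
Qed.

(** The uniform bound on difference quotients gives convergence in norm. Conversely, a limit [u]
    different from [u0] at some [z0] stays away from it near [z0] by continuity, while the quotients
    approach [u0] uniformly; by [bergman_sqnorm_ge] the norm cannot tend to 0. *)
Lemma D_plus_dact (X : 'M[C]_2) (p : {poly C}) u : su11 X ->
  dact Dp X (disc_horner p) u <-> u = disc_horner (weight_op (k.+2)%:R X p).
Proof.
move=> sX; set u0 := disc_horner (weight_op _ _ _).
have [c [e [c0 e0 e1 hq]]] := quotient_bound p sX; rewrite -/u0 in hq.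
have small (r : R) : 0 < r -> \forall s \near (0 : R)^', s != 0 /\ `|s| < r.
  move=> r0; near=> s; split; first by near: s; exact: nbhs_dnbhs_neq.
  by near: s; exact: dnbhs0_lt.
split=> [[[hu hu0 _] hlim]|->]; last first.
  split; first exact: disc_horner_vectors.
  apply: (@squeeze_cvge _ _ _ _ (fun=> 0%E) _ (fun s => ((c * `|s|) ^+ 2 * 2 ^+ 2)%:E)).
  - near=> s; have [s0 se] : s != 0 /\ `|s| < e by near: s; exact: small.
    rewrite D_plus_sqnormE; apply/andP; split.
      apply: integral_ge0 => q /= hq'; rewrite lee_fin mulr_ge0 ?exprn_ge0 ?normc_ge0 // addrK.
      by have /andP[] := bergman_weight_le1 k hq'.
    by apply: bergman_sqnorm_le => z; exact: hq.
  - exact: cvg_cst.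
  apply: cvg_EFin; first by near=> s.
  have -> : fine \o (fun s : R => ((c * `|s|) ^+ 2 * 2 ^+ 2)%:E) = (fun s => (4 * c ^+ 2) * (s * s)).
    by apply/funext => s /=; rewrite exprMn real_normK ?num_real // -expr2; ring.
  apply: cvg_within_filter.
  have : (fun s : R => 4 * c ^+ 2 * (s * s)) @ (0 : R) --> 4 * c ^+ 2 * (0 * 0 : R).
    apply: (@cvgM R _ _ _ (fun=> 4 * c ^+ 2) (fun s => s * s)); first exact: cvg_cst.
    by apply: (@cvgM R _ _ _ id id); exact: cvg_id.
  by rewrite !mulr0.
apply/funext => z0; have [z01|z01] := boolP (`|z0| < 1); last first.
  by rewrite hu0 // /u0 /disc_horner (negbTE z01).
apply/eqP; rewrite -subr_eq0; apply/negPn/negP => ne.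
(* Half of the gap at [z0] survives on a neighbourhood; half of that survives the replacement of
   [u0] by a difference quotient. *)
pose d := normc (u z0 - u0 z0) / 2.
have d0 : 0 < d.
  have : 0 < normc (u z0 - u0 z0); last by move=> ?; rewrite divr_gt0.
  rewrite lt_neqAle normc_ge0 andbT; apply/eqP => /esym/Normc.eq0_normc h.
  by case/eqP: ne; exact: h.
have [w wu] := derivable_cara (hu z0 z01).
have cu := cara_cont (@cvg_id C^o (nbhs (z0 : C^o))) wu.
have z01' : normc z0 < 1 by rewrite -normC_lt1.
have cu0 := cara_cont (@cvg_id C^o (nbhs (z0 : C^o))) (cara_disc_horner (weight_op (k.+2)%:R X p) z01').
have d20 : 0 < d / 2 by rewrite divr_gt0.
have n1 := (@cvgCP R C^o (nbhs (z0 : C^o)) (nbhs_filter (z0 : C^o)) _ _).1 cu _ d20.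
have n2 := (@cvgCP R C^o (nbhs (z0 : C^o)) (nbhs_filter (z0 : C^o)) _ _).1 cu0 _ d20.
have [r r0 hr] := nearC_ball (@filterI _ _ (nbhs_filter (z0 : C^o)) _ _ n1 n2).
have [K K0 hK] := @bergman_sqnorm_ge R k z0 r z01' r0.
have lowd z : normc (z - z0) < r -> d <= normc (u z - u0 z).
  move=> /hr[h1 h2]; rewrite -/u0 in h2.
  have : normc (u z0 - u0 z0) <= normc (u z - u0 z) + (normc (u z - u z0) + normc (u0 z - u0 z0)).
    have ez (a b x y : C) : a - b = (x - y) + (- (x - a) + (y - b)) by ring.
    rewrite [X in normc X <= _](ez _ _ (u z) (u0 z)).
    apply: le_trans (le_normcD _ _) _; rewrite lerD2l.
    by apply: le_trans (le_normcD _ _) _; rewrite normcN.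
  have -> : normc (u z0 - u0 z0) = d + d by rewrite /d -splitr.
  move=> h; rewrite -(lerD2r d) (le_trans h) // lerD2l [leRHS](splitr d).
  by rewrite ltW // ltrD.
have a0 : 0 < (d / 2) ^+ 2 * K by rewrite mulr_gt0 ?exprn_gt0.
have lt_nbhs : nbhs (0 : R)%:E [set x : \bar R | (x < ((d / 2) ^+ 2 * K)%:E)%E].
  by have := lt_nbhsl a0; apply: filterS => x; rewrite /= lte_fin.
have hl := hlim _ lt_nbhs.
pose rr := Num.min e (d / 2 / (c + 1)).
have c10 : 0 < c + 1 by rewrite ltr_wpDl.
have rr0 : 0 < rr by rewrite lt_min e0 divr_gt0.
have [s [hs [s0]]] := filter_ex (@filterI R ((0 : R)^') _ _ _ hl (small rr rr0)).
rewrite lt_min => /andP[se sd].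
pose Q : C -> C := (s^-1)%:C *: (gaction Dp (expmx (s%:C *: X)) (disc_horner p) - disc_horner p).
pose Qu := Q - u; suff : (((d / 2) ^+ 2 * K)%:E <= sqnorm Dp Qu)%E.
  by move=> /le_lt_trans/(_ hs); rewrite ltxx.
rewrite D_plus_sqnormE; apply: hK => [|z z1 zr]; first exact: ltW.
have hQ : normc ((Q - u0) z) <= c * `|s| := hq s s0 se z z1.
have hQ' : normc ((Q - u0) z) <= d / 2.
  apply: le_trans hQ _; apply: (@le_trans _ _ ((c + 1) * `|s|)).
    by rewrite ler_wpM2r // lerDl.
  by rewrite mulrC -ler_pdivlMr // ltW.
have := lowd z zr; rewrite [X in X <= _ -> _]splitr.
have -> : u z - u0 z = (Q - u0) z - (Q - u) z.
  by rewrite -[(Q - u0) z]/(Q z - u0 z) -[(Q - u) z]/(Q z - u z); ring.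
move=> h; have := le_trans h (le_normcD _ _); rewrite normcN => h'.
by rewrite -(lerD2l (d / 2)) (le_trans h') // lerD2r.
Unshelve. all: by end_near. Qed.

End HolomorphicDiscreteSeries.

(** * K-finite vectors of the holomorphic discrete series *)

Section HolomorphicModel.
Variables (R : realType) (k : nat).
Local Notation C := R[i].
Local Notation normc := (@Normc.normc R).
Local Notation Dp := (D_plus R (- (k.+2)%:Z)).

Lemma conjcM (x y : C) : (x * y)^*%C = x^*%C * y^*%C. Proof. exact: rmorphM. Qed.
Lemma conjcD (x y : C) : (x + y)^*%C = x^*%C + y^*%C. Proof. exact: rmorphD. Qed.
Lemma conjcN (x : C) : (- x)^*%C = - x^*%C. Proof. exact: rmorphN. Qed.

Lemma normc_conj (z : C) : normc z^*%C = normc z.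
Proof. by apply: complexI; exact: normcJ. Qed.

Lemma normc_sqr (b : C) : ((normc b) ^+ 2)%:C%C = b * b^*%C.
Proof. by rewrite rmorphXn -sqr_normc. Qed.

Lemma unit_conj (b : C) : normc b = 1 -> b * b^*%C = 1.
Proof. by move=> b1; rewrite -normc_sqr b1 expr1n. Qed.

Lemma K11E (g : 'M[C]_2) : K11 g ->
  [/\ g 0 1 = 0, g 1 0 = 0, g 0 0 * (g 0 0)^*%C = 1 & g 1 1 = (g 0 0)^*%C].
Proof.
move=> [[/matrixP hJ hd] /is_diag_mxP hdiag].
have g01 : g 0 1 = 0 by apply: hdiag.
have g10 : g 1 0 = 0 by apply: hdiag.
have l1 : lift 0 0 = 1 :> 'I_2 by apply: val_inj.
have b1 : g 0 0 * (g 0 0)^*%C = 1.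
  have := hJ 0 0; rewrite !mxE !big_ord_recl !big_ord0 !mxE !big_ord_recl !big_ord0 !mxE.
  rewrite -[ord0]/(0 : 'I_2) !l1 /= g01.
  by rewrite !(mul0r, mulr0, mul1r, mulr1, addr0, add0r, expr0, expr1).
split=> //; rewrite det_mx2 g01 mul0r subr0 in hd.
have g0 : g 0 0 != 0 by apply: contra_eq_neq b1 => ->; rewrite mul0r eq_sym oner_neq0.
by apply: (mulfI g0); rewrite hd b1.
Qed.

Lemma K11_exists (b : C) : normc b = 1 -> exists2 g : 'M[C]_2, K11 g & g 0 0 = b.
Proof.
move=> /unit_conj b1.
pose g : 'M[C]_2 := \matrix_(i, j) (if i == j then if i == 0 then b else b^*%C else 0).
have l1 : lift 0 0 = 1 :> 'I_2 by apply: val_inj.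
exists g; last by rewrite mxE.
split; last by apply/is_diag_mxP => i j ij; rewrite mxE; case: eqP => // e; rewrite e eqxx in ij.
split; last by rewrite det_mx2 !mxE /= b1 mul0r subr0.
apply/matrixP => i j; case: (ord2_cases i) => ->; case: (ord2_cases j) => ->;
  rewrite !mxE !big_ord_recl !big_ord0 !mxE !big_ord_recl !big_ord0 !mxE;
  rewrite -[ord0]/(0 : 'I_2) !l1 /= ?oppr0 ?conjcK -?[Complex 0 0]/(0 : C);
  rewrite !(mul0r, mulr0, mul1r, mulr1, addr0, add0r, expr0, expr1) //.
by rewrite mulrN1 mulNr mulrC b1.
Qed.

Lemma K11_action (g : 'M[C]_2) : K11 g ->
  normc (g 0 0) = 1 /\ forall f z, normc z < 1 ->
    gaction Dp g f z = (g 0 0) ^ (- (k.+2)%:Z) * f ((g 0 0)^*%C * (g 0 0)^*%C * z).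
Proof.
move=> gK; have [g01 g10 b1 g11] := K11E gK; have [[_ hd] _] := gK.
have b0 : g 0 0 != 0 by apply: contra_eq_neq b1 => ->; rewrite mul0r eq_sym oner_neq0.
split.
  have : (normc (g 0 0) ^+ 2)%:C%C = 1%:C%C by rewrite normc_sqr b1.
  by move=> /complexI/eqP; rewrite -[X in _ == X](expr1n _ 2) eqrXn2 ?normc_ge0 // => /eqP.
move=> f z z1; have [|i1 i2 i3 i4] := @invmx2 R g; first by rewrite hd oner_neq0.
rewrite /= normC_lt1 z1 /cocycle /moebius i1 i2 i3 i4 hd invr1 !mul1r g01 g10 g11 !oppr0.
rewrite mul0r add0r addr0; congr (_ * f _).
by apply: (mulIf b0); rewrite divfK // -mulrA mulrAC [_ * g 0 0]mulrC mulrA b1 mul1r.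
Qed.

Lemma disc_hornerP c (p q : {poly C}) :
  disc_horner (c *: p + q) = c *: disc_horner p + disc_horner q.
Proof.
apply/funext => z; rewrite -[RHS]/(c * disc_horner p z + disc_horner q z) /disc_horner.
by case: ifP => _; rewrite ?hornerD ?hornerZ // mulr0 addr0.
Qed.

(** The points [1 / (i + 2)] of the disc supply as many distinct roots of the difference as its
    size. *)
Lemma disc_horner_inj : injective (@disc_horner R).
Proof.
move=> p q pq; apply/eqP; rewrite -subr_eq0; apply/eqP.
pose rs := [seq (i.+2%:R)^-1 : C | i <- iota 0 (size (p - q))].
apply: (@roots_geq_poly_eq0 _ _ rs); last by rewrite size_map size_iota.
  apply/allP => _ /mapP[i _ ->]; apply/rootP; rewrite hornerD hornerN.
  have z1 : `|(i.+2%:R)^-1 : C| < 1 by rewrite normfV normr_nat invf_lt1 ?ltr1n ?ltr0n.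
  by have := congr1 (fun f => f (i.+2%:R)^-1) pq; rewrite /disc_horner z1 => ->; rewrite subrr.
rewrite map_inj_uniq ?iota_uniq // => i j /invr_inj/eqP.
by rewrite eqr_nat => /eqP [].
Qed.

Lemma disc_horner_K_finite (p : {poly C}) : K_finite Dp (disc_horner p).
Proof.
exists (size p), (fun i => disc_horner 'X^i) => g gK; have [b1 hg] := K11_action gK.
pose b := g 0 0; exists (fun i => b ^ (- (k.+2)%:Z) * p`_i * (b^*%C * b^*%C) ^+ i).
apply/funext => z; rewrite fct_sumE.
have [z1|z1] := boolP (normc z < 1); last first.
  rewrite /= normC_lt1 (negbTE z1) big1 // => i _.
  by rewrite -[LHS]/(_ * disc_horner 'X^i z) /disc_horner normC_lt1 (negbTE z1) mulr0.
rewrite hg // /disc_horner normC_lt1 !Normc.normcM.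
have bc1 : normc b^*%C = 1 by rewrite normc_conj.
rewrite bc1 !mul1r z1 horner_coef mulr_sumr; apply: eq_bigr => i _.
rewrite -[RHS]/(_ * (if `|z| < 1 then ('X^i : {poly C}).[z] else 0)) normC_lt1 z1 hornerXn exprMn.
by rewrite !mulrA.
Qed.

(** An element of [K] with first entry [b] rotates the disc by the square of the conjugate of [b],
    so every rotation is reached by a complex square root; the cocycle is a scalar, absorbed in the
    coefficients. *)
Lemma K_finite_disc_horner v : vectors Dp v -> K_finite Dp v -> exists p, v = disc_horner p.
Proof.
move=> [hv v0 _] [n [e he]].
have /boolp.choice[v' hv'] z : exists w, normc z < 1 -> cara id (v : C^o -> C^o) z w.
  have [z1|z1] := boolP (normc z < 1); last by exists 0.
  by have [|w hw] := derivable_cara (hv z _); [rewrite normC_lt1|exists w].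
have [|q hq] := @rotations_finite_rank_horner R v v' n e hv'.
  move=> a a1; have [b sb] : exists b : C, b^*%C * b^*%C = a.
    by exists (sqrtc a)^*%C; rewrite conjcK -expr2 sqr_sqrtc.
  have b1 : normc b = 1.
    have : normc b ^+ 2 = 1.
      by rewrite -a1 -sb Normc.normcM normc_conj expr2.
    by move=> /eqP; rewrite -[X in _ == X](expr1n _ 2) eqrXn2 ?normc_ge0 // => /eqP.
  have b0 : b != 0 by apply: contra_eq_neq b1 => ->; rewrite Normc.normc0 eq_sym oner_neq0.
  have [g gK g0] := K11_exists b1; have [c hc] := he g gK.
  exists (fun i => b ^ (k.+2)%:Z * c i) => z z1.
  have := congr1 (fun f => f z) hc; rewrite (K11_action gK).2 // g0 sb fct_sumE => h.
  transitivity (b ^ (k.+2)%:Z * (b ^ (- (k.+2)%:Z) * v (a * z))).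
    by rewrite mulrA -expfzDr // addrN expr0z mul1r.
  by rewrite h mulr_sumr; apply: eq_bigr => i _; exact: mulrA.
exists q; apply/funext => z; rewrite /disc_horner normC_lt1.
by case: ifPn => [/hq //|z1]; rewrite v0 // normC_lt1.
Qed.

Lemma sl2_model_D_plus :
  sl2_model (weight_op (k.+2)%:R) (M := harish_chandra Dp) (@disc_horner R).
Proof.
split; [exact: disc_hornerP|exact: disc_horner_inj| |].
- apply/seteqP; split=> [v [hv hK]|_ [p _ <-]].
    by have [p ->] := K_finite_disc_horner hv hK; exists p.
  by split; [exact: disc_horner_vectors|exact: disc_horner_K_finite].
- apply: (@dactC_horner R Dp (@disc_horner R)); first exact: disc_hornerP.
    by have [_ h _] := weight_op_axioms ((k.+2)%:R : C).
  exact: D_plus_dact.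
Qed.

End HolomorphicModel.

(** * The antiholomorphic series by complex conjugation *)

Section AntiholomorphicModel.
Variables (R : realType) (k : nat).
Local Notation C := R[i].
Local Notation normc := (@Normc.normc R).
Local Notation Dp := (D_plus R (- (k.+2)%:Z)).
Local Notation Dm := (D_minus R (k.+2)%:Z).

Definition conj_fun (f : C -> C) : C -> C := fun z => (f z)^*%C.

Lemma conj_funK : involutive conj_fun.
Proof. by move=> f; apply/funext => z; exact: conjcK. Qed.

Lemma bergman_sqnorm_conj n f : bergman_sqnorm n (conj_fun f) = bergman_sqnorm n f.
Proof. by rewrite /bergman_sqnorm; apply: eq_integral => p _; rewrite normc_conj. Qed.

Lemma D_minus_sqnormE f : sqnorm Dm f = sqnorm Dp (conj_fun f).
Proof. by rewrite /= opprK bergman_sqnorm_conj. Qed.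

Lemma D_minus_vectors f : vectors Dm f <-> vectors Dp (conj_fun f).
Proof.
rewrite /= opprK; split=> -[h1 h2 h3]; split=> //.
- by move=> z /h2; rewrite /conj_fun => ->; rewrite conjc0.
- by rewrite bergman_sqnorm_conj.
- by move=> z /h2; rewrite /conj_fun => /eqP; rewrite conjc_eq0 => /eqP.
- by rewrite -bergman_sqnorm_conj.
Qed.

Lemma D_minus_gaction g f : gaction Dm g f = conj_fun (gaction Dp g (conj_fun f)).
Proof.
apply/funext => z; rewrite /conj_fun /=; case: ifP => _; last by rewrite conjc0.
by rewrite conjcM conjcK.
Qed.

(** Conjugation commutes with the difference quotients because [s] is real, and it preserves the
    norm. *)
Lemma D_minus_dact X v u : dact Dm X v u <-> dact Dp X (conj_fun v) (conj_fun u).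
Proof.
have e (s : R) : sqnorm Dm ((s^-1)%:C%C *: (gaction Dm (expmx (s%:C%C *: X)) v - v) - u) =
    sqnorm Dp ((s^-1)%:C%C *: (gaction Dp (expmx (s%:C%C *: X)) (conj_fun v) - conj_fun v) - conj_fun u).
  rewrite D_minus_sqnormE; congr (sqnorm Dp).
  apply/funext => z; rewrite D_minus_gaction.
  set w := gaction _ _ _.
  transitivity (((s^-1)%:C%C * ((w z)^*%C - v z) - u z)^*%C); first by [].
  transitivity ((s^-1)%:C%C * (w z - (v z)^*%C) - (u z)^*%C); last by [].
  by rewrite conjcD conjcN conjcM conjcD conjcN conjcK conjc_real.
split=> -[hu hl]; split; try exact/D_minus_vectors.
  by move: hl; under eq_fun do rewrite e.
by under eq_fun do rewrite e.
Qed.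

Lemma D_minus_K_finite v : K_finite Dm v <-> K_finite Dp (conj_fun v).
Proof.
have cs n (c : 'I_n -> C) (e : 'I_n -> C -> C) :
    conj_fun (\sum_i c i *: e i) = \sum_i (c i)^*%C *: conj_fun (e i).
  apply/funext => z; rewrite /conj_fun !fct_sumE.
  rewrite -[LHS]/(conjc (\sum_i c i * e i z)) (rmorph_sum (@conjc R)).
  by apply: eq_bigr => i _; exact: conjcM.
split=> -[n [e he]]; exists n, (fun i => conj_fun (e i)) => g /he[c hc];
  exists (fun i => (c i)^*%C); rewrite -cs -hc D_minus_gaction ?conj_funK //.
Qed.

(** Conjugating both the coefficients and the values makes the map complex linear: on the disc it is
    [p] evaluated at the conjugate of [z]. *)
Definition disc_horner_conj (p : {poly C}) : C -> C := conj_fun (disc_horner (map_poly conjc p)).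

Lemma map_poly_conjcK : involutive (map_poly (@conjc R)).
Proof. by move=> p; apply/polyP => i; rewrite !coef_map /= conjcK. Qed.

Lemma map_weight_op (f : {rmorphism C -> C}) (n : nat) X p :
  map_poly f (weight_op n%:R X p) = weight_op n%:R (map_mx f X) (map_poly f p).
Proof.
rewrite /weight_op !mxE -!mul_polyC !(rmorphD, rmorphB, rmorphM) /= ?map_polyXn.
by rewrite !rmorphN /= !map_polyC !map_polyX deriv_map /= ?rmorphN ?rmorph_nat ?polyCB ?expr2.
Qed.

(** On su(1,1), entrywise complex conjugation coincides with [wflip]. Both sides of the model then
    extend linearly to sl(2, C). *)
Lemma weight_op_conj (n : nat) X (p : {poly C}) : su11 X ->
  map_poly conjc (weight_op n%:R X (map_poly conjc p)) = weight_op n%:R (wflip X) p.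
Proof.
move=> /su11E[X11 X00 X01 X10]; rewrite map_weight_op map_poly_conjcK.
congr weight_op; apply/matrixP => i j; rewrite [LHS]mxE.
case: (ord2_cases i) => ->; case: (ord2_cases j) => ->; rewrite !wflipE //=.
  by rewrite X00 X11.
by rewrite X11 conjcN X00 opprK.
Qed.

Lemma sl2_model_D_minus :
  sl2_model (fun X => weight_op (k.+2)%:R (wflip X)) (M := harish_chandra Dm) disc_horner_conj.
Proof.
have psiL c p q : disc_horner_conj (c *: p + q) = c *: disc_horner_conj p + disc_horner_conj q.
  apply/funext => z; rewrite /disc_horner_conj rmorphD /= map_polyZ disc_hornerP.
  rewrite -[RHS]/(c * _^*%C + _^*%C) -[c in RHS]conjcK -conjcM -conjcD.
  by [].
split; [exact: psiL| | |].
- by move=> p q /(can_inj conj_funK)/disc_horner_inj/(can_inj map_poly_conjcK).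
- apply/seteqP; split=> [v [/D_minus_vectors h1 /D_minus_K_finite h2]|_ [p _ <-]].
    have [q hq] := K_finite_disc_horner h1 h2; exists (map_poly conjc q) => //.
    by rewrite /disc_horner_conj map_poly_conjcK -hq conj_funK.
  split; [apply/D_minus_vectors|apply/D_minus_K_finite]; rewrite /disc_horner_conj conj_funK.
    exact: disc_horner_vectors.
  exact: disc_horner_K_finite.
- apply: (@dactC_horner R Dm disc_horner_conj); first exact: psiL.
    by have [_ h _] := sl2_op_axioms_wflip (weight_op_axioms ((k.+2)%:R : C)).
  move=> X p u sX; rewrite D_minus_dact conj_funK D_plus_dact //.
  rewrite /disc_horner_conj -weight_op_conj // map_poly_conjcK.
  by split=> [<-|->]; rewrite conj_funK.
Qed.

End AntiholomorphicModel.

Theorem theorem7p1 (R : realType) (t : int) (ht : 1 <= t) :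
  [/\ sl2_isomorphic (global_sections (sheaf_I0 R[i] t))
        (harish_chandra (D_plus R (- t - 1))),
      sl2_isomorphic (global_sections (sheaf_Ioo R[i] t))
        (harish_chandra (D_minus R (t + 1))),
      sl2_irreducible (harish_chandra (D_plus R (- t - 1))) &
      sl2_irreducible (harish_chandra (D_minus R (t + 1)))].
Proof.
(* Here [1 <= t] is used: both series have parameter at least 2. *)
have [k tk] : exists k : nat, t + 1 = (k.+2)%:Z.
  by case: t ht => [[|k]|k] //; exists k; rewrite -PoszD addn1.
have char0 : [pchar R[i]] =i pred0 by exact: pchar_num.
have muE : (t + 1)%:~R = (k.+2)%:R :> R[i] by rewrite tk.
have mu_neq n : (t + 1)%:~R + n%:R != 0 :> R[i] by rewrite muE -natrD pnatr_eq0.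
have mu_neq' n : (k.+2)%:R + n%:R != 0 :> R[i] by rewrite -natrD pnatr_eq0.
have hp := sl2_model_D_plus R k; have hm := sl2_model_D_minus R k.
have h0 := sl2_model_I0 char0 mu_neq; have hoo := sl2_model_Ioo char0 mu_neq.
rewrite muE in h0 hoo.
have wA := weight_op_axioms ((k.+2)%:R : R[i]); have wfA := sl2_op_axioms_wflip wA.
rewrite -opprD tk; split.
- exact: sl2_model_isomorphic wA h0 hp.
- exact: sl2_model_isomorphic wfA hoo hm.
- by apply: sl2_model_irreducible wA hp _ => W W0 WL WX; exact: weight_op_irreducible char0 mu_neq' W0 WL WX.
(* Stability under the flipped action for all [X] is stability under the plain one, because [wflip]
   is an involution of sl(2). *)
- apply: sl2_model_irreducible wfA hm _ => W W0 WL WX.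
  apply: weight_op_irreducible char0 mu_neq' W0 WL _ => X p sX Wp.
  by rewrite -[X]wflipK; apply: WX => //; exact: in_sl2_wflip.
Qed.
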